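(* Let $c>1$ and let $\mathbb H$ be the graded Hecke algebra of type $F_4$ with parameter $1$ on the long roots and $c$ on the short roots. Let $\mathscr C\subset\mathfrak h_{\mathbb R}=\mathbb R^4$ be the dominant Weyl chamber and let $K=\{\nu:\langle\epsilon_1+\epsilon_2,\nu\rangle<c\}$. The unitary regions $\mathcal F$ contained in $\mathscr C\cap K$ are the following (all subsets of $\mathscr C$): $(\mathcal F_1)$ $\{2\nu_1<1,\ \nu_1+\nu_2<c\}$; $(\mathcal F_2)$ $\{\nu_1+\nu_2+\nu_3+\nu_4>1,\ \nu_1+\nu_2+\nu_3-\nu_4<1,\ \nu_1+\nu_2<c\}$; $(\mathcal F_3)$ $\{\nu_1+\nu_2-\nu_3+\nu_4>1,\ \nu_1-\nu_2+\nu_3+\nu_4<1,\ \nu_1+\nu_2-\nu_3-\nu_4<1,\ \nu_1+\nu_2<c\}$; $(\mathcal F_4)$ $\{\nu_1-\nu_2+\nu_3+\nu_4<1,\ 2\nu_2>1,\ \nu_1+\nu_2<c\}$; $(\mathcal F_5)$ $\{2\nu_2>1,\ \nu_1-\nu_2+\nu_3-\nu_4>1,\ 2\nu_3<1,\ \nu_1-\nu_2-\nu_3+\nu_4<1,\ \nu_1+\nu_2<c\}$; $(\mathcal F_6)$ $\{2\nu_2>1,\ \nu_1-\nu_2-\nu_3-\nu_4>1,\ 2\nu_3<1,\ \nu_1+\nu_2<c\}$; $(\mathcal F_7)$ $\{\nu_1-\nu_2-\nu_3-\nu_4>1,\ 2\nu_4>1,\ \nu_1+\nu_2<c\}$.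
   Context: **Algebra.** The simple roots of $F_4$ in $\mathbb R^4$ are $\alpha_1=\epsilon_1-\epsilon_2-\epsilon_3-\epsilon_4$, $\alpha_2=2\epsilon_4$ (long), $\alpha_3=\epsilon_3-\epsilon_4$, $\alpha_4=\epsilon_2-\epsilon_3$ (short). Let $R$ be the root system, $W$ its Weyl group, $\mathfrak h=\mathbb C^4$, with $c_\alpha=1$ for long roots and $c_\alpha=c$ for short roots. The algebra $\mathbb H$ is $\mathbb C[W]\otimes S(\mathfrak h^* )$ as a vector space, with the usual products in $\mathbb C[W]$ (basis $t_w$) and $S(\mathfrak h^* )$, and $\omega t_{s_\alpha}=t_{s_\alpha}s_\alpha(\omega)+c_\alpha\omega(\check\alpha)$ for $\alpha$ simple and $\omega\in\mathfrak h^*$. The $*$-operation is the conjugate-linear anti-involution with $t_w^*=t_{w^{-1}}$ and $\omega^*=-\overline\omega+\sum_{\alpha\in R^+}c_\alpha\overline\omega(\check\alpha)t_{s_\alpha}$. A module is unitary if it admits a positive definite Hermitian form with $\langle xv,v'\rangle=\langle v,x^*v'\rangle$. **Regions.** The dominant chamber is $\mathscr C=\{\nu\in\mathbb R^4:\langle\alpha_i,\nu\rangle\ge0,\ i=1,\dots,4\}$, i.e. $\nu_1\ge\nu_2+\nu_3+\nu_4$ and $\nu_2\ge\nu_3\ge\nu_4\ge0$. For $\nu\in\mathscr C$ let $X(\nu)=\mathbb H\otimes_{S(\mathfrak h^* )}\mathbb C_\nu$ be the principal series. It is reducible exactly when $\nu$ lies on one of the hyperplanes $\langle\alpha_l,\nu\rangle=1$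 ($\alpha_l$ a long root) or $\langle\alpha_s,\nu\rangle=c$ ($\alpha_s$ a short root). A region is a connected component $\mathcal F$ (relatively open in $\mathscr C$) of the complement in $\mathscr C$ of these hyperplanes. A region $\mathcal F$ is unitary if $X(\nu)$ is unitary for all (equivalently, for one) $\nu\in\mathcal F$. For particular values of $c$ some of the listed sets may be empty. *)

(* Defs.v *)
From HB Require Import structures.
From mathcomp Require Import all_boot all_order all_algebra fingroup perm.
From mathcomp Require Import generic_quotient ring_quotient zify ring.
From mathcomp Require Import boolp classical_sets reals topology normedtype.
From mathcomp Require Import complex.
From mathcomp Require mpoly.
(* Importing mpoly in full would clash with the notations of the analysis
   library; only its algebraic structures are needed. *)
Import (canonicals, coercions) mpoly.

Set Implicit Arguments.
Unset Strict Implicit.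
Unset Printing Implicit Defensive.

Import Order.TTheory GRing.Theory Num.Theory.
Import numFieldNormedType.Exports.
Local Open Scope classical_set_scope.
Local Open Scope complex_scope.
Local Open Scope ring_scope.

Definition dotv (K : pzRingType) (u v : 'rV[K]_4) : K :=
  \sum_i u 0 i * v 0 i.

(* The root system F4 in the coordinates eps_1, ..., eps_4: the 24 short roots
   +-eps_i +- eps_j are the vectors of Z^4 of square length 2, the 24 long
   roots +-2 eps_i and +-eps_1 +- eps_2 +- eps_3 +- eps_4 are those of square
   length 4 (lemma mem_f4_roots). *)
Definition f4_roots : seq 'rV[int]_4 :=
  [seq v <- [seq \row_j ((f j : nat)%:Z - 2) | f : {ffun 'I_4 -> 'I_5}]
     | (dotv v v == 2) || (dotv v v == 4)].

Definition f4root : finType := seq_sub f4_roots.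

Lemma dotv4 (K : pzRingType) (u v : 'rV[K]_4) :
  dotv u v = u 0 0 * v 0 0 + u 0 1 * v 0 1 + u 0 2 * v 0 2 + u 0 3 * v 0 3.
Proof.
rewrite /dotv !big_ord_recr big_ord0 /= add0r.
by congr (_ * _ + _ * _ + _ * _ + _ * _); congr (_ 0 _); apply/val_inj.
Qed.

Lemma mem_f4_roots v :
  (v \in f4_roots) = (dotv v v == 2) || (dotv v v == 4).
Proof.
rewrite mem_filter; case N: (_ || _) => //=.
have B j : -2 <= v 0 j <= 2.
  have: v 0 j * v 0 j <= 4.
    have: dotv v v <= 4 by case/orP: N => /eqP ->.
    apply: le_trans; rewrite /dotv (bigD1 j) //= lerDl.
    by apply: sumr_ge0 => i _; rewrite -expr2 sqr_ge0.
  by move=> ?; nia.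
apply/mapP; exists [ffun j => inord (absz (v 0 j + 2))]; first exact: mem_enum.
apply/rowP=> j; rewrite mxE ffunE inordK; last by have := B j; lia.
by have := B j; lia.
Qed.

(* a(w^vee) = 2 (w, a) / (a, a); the division is exact on roots. *)
Definition reflz (a b : 'rV[int]_4) : 'rV[int]_4 :=
  b - (2 * dotv b a %/ dotv a a)%Z *: a.

Lemma f4_crystallographic a b : a \in f4_roots -> b \in f4_roots ->
  (dotv a a %| 2 * dotv b a)%Z.
Proof.
rewrite !mem_f4_roots => /orP[] /eqP Na Nb; rewrite Na; first exact: dvdz_mulr.
have {Nb}: exists m, dotv b b = 2 * m.
  by case/orP: Nb => /eqP ->; [exists 1 | exists 2].
move: Na; rewrite !dotv4.
move: (a 0 0) (a 0 1) (a 0 2) (a 0 3) => a0 a1 a2 a3.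
move: (b 0 0) (b 0 1) (b 0 2) (b 0 3) => b0 b1 b2 b3 Na [m Nb].
have par (z : int) : exists k, z = 2 * k \/ z = 2 * k + 1.
  by exists (z %/ 2)%Z; lia.
suff [k ->] : exists k, b0 * a0 + b1 * a1 + b2 * a2 + b3 * a3 = 2 * k.
  by rewrite mulrA; exact: dvdz_mulr.
have sqp (z : int) : exists k, z * z = z + 2 * k.
  by have [k [->|->]] := par z;
    [exists (2 * k * k - k) | exists (2 * k * k + k)]; ring.
have [q0 e0] := sqp b0; have [q1 e1] := sqp b1.
have [q2 e2] := sqp b2; have [q3 e3] := sqp b3.
have [k0 [E0|E0]] := par a0; have [k1 [E1|E1]] := par a1;
have [k2 [E2|E2]] := par a2; have [k3 [E3|E3]] := par a3; subst;
try (exfalso; nia).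
- by exists (b0 * k0 + b1 * k1 + b2 * k2 + b3 * k3); ring.
- exists (b0 * k0 + b1 * k1 + b2 * k2 + b3 * k3 + m - q0 - q1 - q2 - q3).
  by nia.
Qed.

Lemma dotvC (K : comPzRingType) (u v : 'rV[K]_4) : dotv u v = dotv v u.
Proof. by apply: eq_bigr => i _; rewrite mulrC. Qed.

Lemma dotvB (K : comPzRingType) (k : K) (u v w : 'rV[K]_4) :
  dotv (u - k *: v) w = dotv u w - k * dotv v w.
Proof. by rewrite !dotv4 !mxE; ring. Qed.

Lemma reflz_root a b : a \in f4_roots -> b \in f4_roots ->
  reflz a b \in f4_roots.
Proof.
move=> Ra Rb; have /dvdzP[k Ek] := f4_crystallographic Ra Rb.
have Na : dotv a a != 0 by move: Ra; rewrite mem_f4_roots => /orP[] /eqP ->.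
rewrite /reflz Ek mulzK // mem_f4_roots.
suff -> : dotv (b - k *: a) (b - k *: a) = dotv b b by rewrite -mem_f4_roots.
rewrite dotvB (dotvC b) (dotvC a) !dotvB (dotvC a b).
transitivity (dotv b b - k * (2 * dotv b a - k * dotv a a)); first by ring.
by rewrite Ek subrr mulr0 subr0.
Qed.

Lemma reflzK a b : a \in f4_roots -> b \in f4_roots ->
  reflz a (reflz a b) = b.
Proof.
move=> Ra Rb; have /dvdzP[k Ek] := f4_crystallographic Ra Rb.
have Na : dotv a a != 0 by move: Ra; rewrite mem_f4_roots => /orP[] /eqP ->.
rewrite /reflz Ek mulzK // dotvB.
have -> : 2 * (dotv b a - k * dotv a a) = (- k) * dotv a a.
  by rewrite mulrBr Ek; ring.
by rewrite mulzK // scaleNr opprK subrK.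
Qed.

Definition refl_root (a b : f4root) : f4root :=
  SeqSub (reflz_root (valP a) (valP b)).

Lemma refl_rootK a : involutive (refl_root a).
Proof. by move=> b; apply/val_inj; rewrite /= reflzK ?(valP a) ?(valP b). Qed.

(* s_a as a permutation of the roots; W is realised as a permutation group of
   the roots, on which it acts faithfully. *)
Definition srefl (a : f4root) : {perm f4root} :=
  perm (can_inj (refl_rootK a)).

Definition simple_vec (i : 'I_4) : 'rV[int]_4 :=
  \row_j nth 0 (nth [::] [:: [:: 1; -1; -1; -1];
                             [:: 0;  0;  0;  2];
                             [:: 0;  0;  1; -1];
                             [:: 0;  1; -1;  0]] i) j.

Lemma simple_vec_root i : simple_vec i \in f4_roots.
Proof. by rewrite mem_f4_roots dotv4 !mxE; case: i => -[|[|[|[|]]]]. Qed.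

Definition simple (i : 'I_4) : f4root := SeqSub (simple_vec_root i).

Definition weyl : {group {perm f4root}} :=
  <<[set srefl (simple i) | i : 'I_4]>>%G.

Definition positive (a : f4root) : bool :=
  `[< exists n : 'I_4 -> nat, val a = \sum_i val (simple i) *+ n i >].

Definition is_long (a : f4root) : bool := dotv (val a) (val a) == 4.

Definition cpar (K : nzRingType) (c : K) (a : f4root) : K :=
  if is_long a then 1 else c.

Definition rootv (K : nzRingType) (a : f4root) : 'rV[K]_4 :=
  map_mx intr (val a).

(* h and h^* are both K^4, paired by dotv; coroot a w is w(a^vee). *)
Definition coroot (K : fieldType) (a : f4root) (w : 'rV[K]_4) : K :=
  2 * dotv w (rootv K a) / dotv (rootv K a) (rootv K a).

Definition refl (K : fieldType) (a : f4root) (w : 'rV[K]_4) : 'rV[K]_4 :=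
  w - coroot a w *: rootv K a.

Lemma rootv_srefl (K : numFieldType) (a b : f4root) :
  rootv K (srefl a b) = refl a (rootv K b).
Proof.
have dotz (u v : 'rV[int]_4) :
    dotv (map_mx intr u) (map_mx intr v) = (dotv u v)%:~R :> K.
  by rewrite !dotv4 !mxE !rmorphD !rmorphM.
have /dvdzP[k Ek] := f4_crystallographic (valP a) (valP b).
have Na : dotv (val a) (val a) != 0.
  by have := valP a; rewrite mem_f4_roots => /orP[] /eqP ->.
rewrite permE /refl /coroot /rootv /= /reflz Ek mulzK // !dotz.
have -> : 2 * (dotv (val b) (val a))%:~R = (k * dotv (val a) (val a))%:~R :> K.
  by rewrite -Ek rmorphM.
rewrite rmorphM mulfK ?intr_eq0 //.
by apply/rowP => j; rewrite !mxE rmorphB rmorphM.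
Qed.

Section GradedHecke.
Variable R : realType.
Local Notation C := R[i].
Local Notation S := (mpoly.mpoly 4 C).

(* The linear form w_1 eps_1 + ... + w_4 eps_4 as an element of S(h^* ). *)
Definition linform (w : 'rV[C]_4) : S :=
  \sum_i w 0 i *: mpoly.mpolyX C (mpoly.mnm1 i).

(* A graded Hecke algebra of type F4 with its star operation. The fields
   hecke_span and hecke_free say that t_w (x) p |-> t_w p is an isomorphism
   C[W] (x) S(h^* ) -> H; with the remaining fields, they determine H up to a
   unique isomorphism. Only the values of hecke_t on W matter. *)
Record gradedHecke (c : R) := GradedHecke {
  hecke_alg :> algType C;
  hecke_t : {perm f4root} -> hecke_alg;
  hecke_S : {lrmorphism S -> hecke_alg};
  hecke_star : hecke_alg -> hecke_alg;
  hecke_t1 : hecke_t 1%g = 1;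
  hecke_tM : {in weyl &, forall v w,
    hecke_t (v * w)%g = hecke_t v * hecke_t w};
  hecke_span : forall h, exists p : {perm f4root} -> S,
    h = \sum_(w in weyl) hecke_t w * hecke_S (p w);
  hecke_free : forall p : {perm f4root} -> S,
    \sum_(w in weyl) hecke_t w * hecke_S (p w) = 0 ->
    {in weyl, forall w, p w = 0};
  hecke_cross : forall (i : 'I_4) (w : 'rV[C]_4),
    let a := simple i in
    hecke_S (linform w) * hecke_t (srefl a) =
    hecke_t (srefl a) * hecke_S (linform (refl a w))
      + ((cpar c a)%:C * coroot a w)%:A;
  hecke_star_semilinear : forall (z : C) x y,
    hecke_star (z *: x + y) = z^* *: hecke_star x + hecke_star y;
  hecke_star_anti : forall x y,
    hecke_star (x * y) = hecke_star y * hecke_star x;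
  hecke_starK : involutive hecke_star;
  hecke_star_t : {in weyl, forall w, hecke_star (hecke_t w) = hecke_t w^-1%g};
  hecke_star_S : forall w : 'rV[C]_4,
    let wbar := map_mx Num.conj w in
    hecke_star (hecke_S (linform w)) =
    - hecke_S (linform wbar)
      + \sum_(a | positive a)
          ((cpar c a)%:C * coroot a wbar) *: hecke_t (srefl a)
}.

Variables (c : R) (H : gradedHecke c).

(* H acts on an lmodType H; a complex scalar z acts through z%:A. *)
Definition unitary_module (V : lmodType H) : Prop :=
  exists f : V -> V -> C,
    [/\ forall (z : C) u v w,
          f ((z%:A : H) *: u + v) w = z * f u w + f v w,
        forall u v, f v u = (f u v)^*,
        forall u, u != 0 -> 0 < f u u
      & forall (x : H) u v, f (x *: u) v = f u (hecke_star x *: v)].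

(* The tensor product H (x)_S C_nu is the quotient of the left module H by the
   span of the h p - p(nu) h. *)
Section PrincipalSeries.
Variable nu : 'rV[C]_4.

Definition balancing : {pred H^o} := fun x : H =>
  `[< exists n (h : 'I_n -> H) (p : 'I_n -> S),
        x = \sum_i (h i * hecke_S H (p i)
                    - mpoly.meval (fun j => nu 0 j) (p i) *: h i) >].

Lemma balancing_submod : submod_closed balancing.
Proof.
split=> [|a x y /asboolP[n [h [p ->]]] /asboolP[m [k [q ->]]]].
  apply/asboolP; exists 0%N, (fun=> 0), (fun=> 0).
  by rewrite big_ord0.
apply/asboolP; exists (n + m)%N,
  (fun i => match split i with inl i => a * h i | inr i => k i end),
  (fun i => match split i with inl i => p i | inr i => q i end).
rewrite big_split_ord /=; congr (_ + _).
  rewrite [LHS]mulr_sumr; apply: eq_bigr => i _.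
  by rewrite (unsplitK (inl i)) mulrBr mulrA scalerAr.
by apply: eq_bigr => i _; rewrite (unsplitK (inr i)).
Qed.

HB.instance Definition _ :=
  GRing.isSubmodClosed.Build H H^o balancing balancing_submod.

Definition principal_series := Quotient.quot balancing.
Local Notation X := principal_series.

HB.instance Definition _ := GRing.Zmodule.on X.

Definition ps_scale (x : H) (u : X) : X :=
  \pi_X%qT (x *: (repr u : H^o)).

Lemma ps_scale_pi x (h : H^o) : ps_scale x (\pi_X%qT h) = \pi_X%qT (x *: h).
Proof.
apply/eqP; rewrite -Quotient.idealrBE -scalerBr rpredZ //.
by rewrite Quotient.idealrBE reprK.
Qed.

Lemma ps_piP (u : X) : exists h : H^o, u = \pi_X%qT h.
Proof. by exists (repr u); rewrite reprK. Qed.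

Lemma ps_piD (h k : H^o) : \pi_X%qT (h + k) = \pi_X%qT h + \pi_X%qT k.
Proof. exact: Quotient.pi_add. Qed.

Lemma ps_scaleA x y u : ps_scale x (ps_scale y u) = ps_scale (x * y) u.
Proof. by have [h ->] := ps_piP u; rewrite !ps_scale_pi scalerA. Qed.

Lemma ps_scale1 : left_id 1 ps_scale.
Proof. by move=> u; have [h ->] := ps_piP u; rewrite ps_scale_pi scale1r. Qed.

Lemma ps_scaleDr : right_distributive ps_scale +%R.
Proof.
move=> x u v; have [h ->] := ps_piP u; have [k ->] := ps_piP v.
by rewrite -ps_piD !ps_scale_pi scalerDr ps_piD.
Qed.

Lemma ps_scaleDl u : {morph ps_scale^~ u : x y / x + y}.
Proof.
move=> x y; have [h ->] := ps_piP u.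
by rewrite !ps_scale_pi scalerDl ps_piD.
Qed.

HB.instance Definition _ := GRing.Zmodule_isLmodule.Build H X
  ps_scaleA ps_scale1 ps_scaleDr ps_scaleDl.

End PrincipalSeries.

Definition chamber : set 'rV[R]_4 :=
  [set nu | forall i, 0 <= dotv (rootv R (simple i)) nu].

Definition walls (d : R) : set 'rV[R]_4 :=
  [set nu | exists a : f4root, dotv (rootv R a) nu = cpar d a].

Definition is_region (d : R) (F : set 'rV[R]_4) : Prop :=
  exists2 nu, (chamber `\` walls d) nu
    & F = connected_component (chamber `\` walls d) nu.

Definition unitary_region (F : set 'rV[R]_4) : Prop :=
  forall nu, F nu ->
    unitary_module (principal_series (map_mx (fun x => x%:C) nu)).

Definition halfspaceK (d : R) : set 'rV[R]_4 :=
  [set nu | nu 0 0 + nu 0 1 < d].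

Definition F1 (d : R) : set 'rV[R]_4 := chamber `&` [set nu |
  2 * nu 0 0 < 1 /\ nu 0 0 + nu 0 1 < d].

Definition F2 (d : R) : set 'rV[R]_4 := chamber `&` [set nu |
  [/\ nu 0 0 + nu 0 1 + nu 0 2 + nu 0 3 > 1,
      nu 0 0 + nu 0 1 + nu 0 2 - nu 0 3 < 1
    & nu 0 0 + nu 0 1 < d]].

Definition F3 (d : R) : set 'rV[R]_4 := chamber `&` [set nu |
  [/\ nu 0 0 + nu 0 1 - nu 0 2 + nu 0 3 > 1,
      nu 0 0 - nu 0 1 + nu 0 2 + nu 0 3 < 1,
      nu 0 0 + nu 0 1 - nu 0 2 - nu 0 3 < 1
    & nu 0 0 + nu 0 1 < d]].

Definition F4 (d : R) : set 'rV[R]_4 := chamber `&` [set nu |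
  [/\ nu 0 0 - nu 0 1 + nu 0 2 + nu 0 3 < 1,
      2 * nu 0 1 > 1
    & nu 0 0 + nu 0 1 < d]].

Definition F5 (d : R) : set 'rV[R]_4 := chamber `&` [set nu |
  [/\ 2 * nu 0 1 > 1,
      nu 0 0 - nu 0 1 + nu 0 2 - nu 0 3 > 1,
      2 * nu 0 2 < 1,
      nu 0 0 - nu 0 1 - nu 0 2 + nu 0 3 < 1
    & nu 0 0 + nu 0 1 < d]].

Definition F6 (d : R) : set 'rV[R]_4 := chamber `&` [set nu |
  [/\ 2 * nu 0 1 > 1,
      nu 0 0 - nu 0 1 - nu 0 2 - nu 0 3 > 1,
      2 * nu 0 2 < 1
    & nu 0 0 + nu 0 1 < d]].

Definition F7 (d : R) : set 'rV[R]_4 := chamber `&` [set nu |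
  [/\ nu 0 0 - nu 0 1 - nu 0 2 - nu 0 3 > 1,
      2 * nu 0 3 > 1
    & nu 0 0 + nu 0 1 < d]].

End GradedHecke.

Arguments chamber {R}.

(* Main.v *)
Require Import Defs.
From HB Require Import structures.
From mathcomp Require Import all_boot all_order all_algebra fingroup perm.
From mathcomp Require Import generic_quotient ring_quotient zify ring lra ssrZ.
From mathcomp Require Import boolp classical_sets reals topology normedtype.
From mathcomp Require Import complex.
From mathcomp Require mpoly.
From Stdlib Require BinNums.
Import (canonicals, coercions) mpoly.

(* An invariant Hermitian form on X(nu) is a function phi on W whose
   convolution operator is the Gram matrix in the basis t_w (x) 1. Invariance under
   h^* amounts to the linear system KZ below, solved by the ordered product r of
   the 24 factors c_a + <a, nu> s_a along a word for w0 = -1, and for regular nu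
   all solutions are multiples of r; so X(nu) is unitary iff r is positive
   definite. The signature is locally constant as long as all factors stay
   invertible. When all short roots are < c on nu, scaling the short factors to
   constants keeps them invertible and leaves a product in R[S_3], S_3 being
   generated by the two long simple reflections; moving nu inside its sign cell
   for the long hyperplanes reduces this to one rational point per cell. There
   are 21 cells, and exactly 7 of the 21 elements of R[S_3] are positive
   definite. *)

(** Constancy of the signature along a path requires symmetric operators, that is r(w^-1) = r(w),
    and for deformed products no invariant form supplies this. It comes from uniqueness: inversion
    preserves the linear system, and a solution is determined by its value at w0, which is its own
    inverse. Uniqueness needs nu to separate the roots, while paths meet singular points, so the
    symmetry is proved over polynomial rings and specialised.

    Uniqueness up to a multiple leaves a sign open. It is fixed on the constant function, where each
    factor acts by the scalar c_a + <a, nu>, positive in the dominant chamber.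

    No eigenvalues are followed. A lower bound on every factor gives a spectral gap for a
    semidefinite operator of the family, so short steps preserve semidefiniteness and the gap
    restores definiteness.

    Once the short factors are constants, only the signs at the long roots matter. A sample point
    therefore represents its whole long cell even if it does not lie in K itself. Conversely K fixes
    the position of every short root relative to its wall, which makes a nonempty intersection of K
    with a long cell a single region. *)

Set Implicit Arguments.
Unset Strict Implicit.
Unset Printing Implicit Defensive.

Import Order.TTheory GRing.Theory Num.Theory.
Import numFieldNormedType.Exports.
Local Open Scope classical_set_scope.
Local Open Scope ring_scope.

(** * Roots and Weyl group *)

Definition cart (b a : f4root) : int :=
  (2 * dotv (val b) (val a) %/ dotv (val a) (val a))%Z.

Lemma dotv_root_neq0 (a : f4root) : dotv (val a) (val a) != 0.
Proof. by have := valP a; rewrite mem_f4_roots => /orP[] /eqP ->. Qed.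

Lemma cartE (b a : f4root) :
  2 * dotv (val b) (val a) = cart b a * dotv (val a) (val a).
Proof.
by rewrite /cart divzK //; apply: f4_crystallographic; apply: valP.
Qed.

Lemma val_srefl (a b : f4root) : val (srefl a b) = val b - cart b a *: val a.
Proof. by rewrite permE. Qed.

Lemma srefl_invol (a b : f4root) : srefl a (srefl a b) = b.
Proof. by rewrite !permE refl_rootK. Qed.

Lemma sreflM (a : f4root) : (srefl a * srefl a = 1)%g.
Proof. by apply/permP => b; rewrite permM srefl_invol perm1. Qed.

Lemma sreflV (a : f4root) : (srefl a)^-1%g = srefl a.
Proof. by apply: (mulIg (srefl a)); rewrite mulVg sreflM. Qed.

Lemma cart_self a : cart a a = 2.
Proof. by rewrite /cart mulzK // dotv_root_neq0. Qed.

Lemma dotvBr (K : comPzRingType) (k : K) (u v w : 'rV[K]_4) :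
  dotv w (u - k *: v) = dotv w u - k * dotv w v.
Proof. by rewrite dotvC dotvB !(dotvC w). Qed.

Lemma dotv_srefl (a b b' : f4root) :
  dotv (val (srefl a b)) (val (srefl a b')) = dotv (val b) (val b').
Proof.
rewrite !val_srefl dotvB !dotvBr.
have Eb := cartE b a; have Eb' := cartE b' a.
rewrite (dotvC (val a) (val b')).
have N := dotv_root_neq0 a.
move: (dotv (val a) (val a)) (dotv (val b) (val a)) (dotv (val b') (val a)) (dotv (val b) (val b')) Eb Eb' N.
by move=> n p q s Eb Eb' N; nia.
Qed.

Lemma cart_srefl (c a b : f4root) : cart (srefl c b) (srefl c a) = cart b a.
Proof. by rewrite /cart !dotv_srefl. Qed.

Lemma sreflJ (c a b : f4root) :
  srefl c (srefl a b) = srefl (srefl c a) (srefl c b).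
Proof.
apply: val_inj; rewrite !val_srefl.
have E : cart (srefl a b) c = cart b c - cart b a * cart a c.
  apply: (mulIf (dotv_root_neq0 c)); rewrite mulrBl -mulrA -!cartE val_srefl dotvB.
  by ring.
rewrite E cart_srefl; move: (val a) (val b) (val c) => u v w.
by apply/rowP => j; rewrite !mxE; ring.
Qed.

Lemma simple_weyl i : srefl (simple i) \in weyl.
Proof. by apply: mem_gen; apply: imset_f. Qed.

Lemma weyl_ind (P : {perm f4root} -> Prop) :
  P 1%g ->
  (forall w i, w \in weyl -> P w -> P (w * srefl (simple i))%g) ->
  forall w, w \in weyl -> P w.
Proof.
move=> P1 PS w /gen_prodgP[n [c cA ->]].
elim: n c cA => [|n IH] c cA; first by rewrite big_ord0.
rewrite big_ord_recr /=.
have /imsetP[i _ ->] := cA ord_max.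
apply: PS; last exact: IH.
by apply: group_prod => j _; apply: mem_gen; apply: cA.
Qed.

Lemma weyl_ind_l (P : {perm f4root} -> Prop) :
  P 1%g ->
  (forall w i, w \in weyl -> P w -> P (srefl (simple i) * w)%g) ->
  forall w, w \in weyl -> P w.
Proof.
move=> P1 PS w Ww; rewrite -[w]invgK.
have: (w^-1)%g \in weyl by rewrite groupV.
move: (w^-1)%g; apply: weyl_ind => [|v i Wv Pv]; first by rewrite invg1.
by rewrite invMg sreflV; apply: PS; rewrite ?groupV.
Qed.

Lemma weyl_srefl w a b : w \in weyl -> w (srefl a b) = srefl (w a) (w b).
Proof.
move=> Ww; move: w Ww a b; apply: weyl_ind => [|w i Ww IH] a b; first by rewrite !perm1.
by rewrite !permM IH sreflJ.
Qed.

Lemma weyl_dotv w a b : w \in weyl ->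
  dotv (val (w a)) (val (w b)) = dotv (val a) (val b).
Proof.
move=> Ww; move: w Ww a b; apply: weyl_ind => [|w i Ww IH] a b; first by rewrite !perm1.
by rewrite !permM dotv_srefl IH.
Qed.

Lemma weyl_cart w a b : w \in weyl -> cart (w a) (w b) = cart a b.
Proof. by move=> Ww; rewrite /cart !weyl_dotv. Qed.

Lemma weyl_long w a : w \in weyl -> is_long (w a) = is_long a.
Proof. by move=> Ww; rewrite /is_long weyl_dotv. Qed.

Lemma weyl_sreflC w a : w \in weyl ->
  (srefl a * w = w * srefl (w a))%g.
Proof. by move=> Ww; apply/permP => b; rewrite !permM weyl_srefl. Qed.

Definition oppr_root (b : f4root) : f4root := srefl b b.

Lemma srefl_self a : srefl a a = oppr_root a. Proof. by []. Qed.

Lemma val_oppr_root b : val (oppr_root b) = - val b.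
Proof.
rewrite val_srefl.
by rewrite cart_self scaler_nat mulr2n opprD addrA subrr sub0r.
Qed.

Lemma oppr_rootK : involutive oppr_root.
Proof. by move=> b; apply: val_inj; rewrite !val_oppr_root opprK. Qed.

Lemma weyl_opp w b : w \in weyl -> w (oppr_root b) = oppr_root (w b).
Proof. by move=> Ww; rewrite /oppr_root weyl_srefl. Qed.

Lemma cart_opp a b : cart a (oppr_root b) = - cart a b.
Proof.
have D1 (u v : 'rV[int]_4) : dotv u (- v) = - dotv u v by rewrite !dotv4 !mxE; ring.
have D2 (u v : 'rV[int]_4) : dotv (- u) v = - dotv u v by rewrite !dotv4 !mxE; ring.
apply: (mulIf (dotv_root_neq0 b)); have := cartE a (oppr_root b).
by rewrite !val_oppr_root !D1 D2 opprK mulNr -cartE mulrN => <-.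
Qed.

Lemma srefl_opp b : srefl (oppr_root b) = srefl b.
Proof.
apply/permP => a; apply: val_inj.
by rewrite (val_srefl (oppr_root b)) (val_srefl b) cart_opp val_oppr_root scalerN scaleNr opprK.
Qed.

(** * Roots as integer quadruples, for decisions by computation *)

Definition zvec : Type := (int * int * int * int)%type.

Definition row_coords (v : 'rV[int]_4) : zvec := (v 0 0, v 0 1, v 0 2, v 0 3).

Definition zsub (k : int) (s t : zvec) : zvec :=
  let: (a, b, c, d) := s in let: (a', b', c', d') := t in
  (a - k * a', b - k * b', c - k * c', d - k * d').

Lemma row_coordsB k u v :
  row_coords (u - k *: v) = zsub k (row_coords u) (row_coords v).
Proof. by rewrite /row_coords !mxE. Qed.

Definition coords (b : f4root) : zvec := row_coords (val b).

Definition vrange : seq int := [:: -2; -1; 0; 1; 2].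

Definition zbox : seq zvec :=
  [seq (t, d) | t <- [seq (t, c) | t <- [seq (a, b) | a <- vrange, b <- vrange], c <- vrange], d <- vrange].

Lemma mem_zbox a b c d :
  ((a, b, c, d) \in zbox) =
  [&& a \in vrange, b \in vrange, c \in vrange & d \in vrange].
Proof.
have P (T1 T2 : eqType) (x : T1) (y : T2) u v :
    ((x, y) \in [seq (x, y) | x <- u, y <- v]) = (x \in u) && (y \in v).
  apply/allpairsP/andP => [[[x' y'] /= [? ? [-> ->]]] //|[? ?]].
  by exists (x, y).
by rewrite /zbox !P -!andbA.
Qed.

Definition root_coords : seq zvec :=
  [seq t <- zbox | let: (a, b, c, d) := t in
     
     let n := a * a + b * b + c * c + d * d in (n == 2) || (n == 4)].

Lemma ord4P (P : 'I_4 -> Prop) : P 0 -> P 1 -> P 2 -> P 3 -> forall j, P j.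
Proof.
move=> P0 P1 P2 P3 -[[|[|[|[|//]]]] p].
- by rewrite (_ : Ordinal p = 0) //; apply/val_inj.
- by rewrite (_ : Ordinal p = 1) //; apply/val_inj.
- by rewrite (_ : Ordinal p = 2) //; apply/val_inj.
- by rewrite (_ : Ordinal p = 3) //; apply/val_inj.
Qed.

Lemma coords_inj : injective coords.
Proof.
by move=> a b [E0 E1 E2 E3]; apply/val_inj/rowP; apply: ord4P.
Qed.

Lemma coords_mem b : coords b \in root_coords.
Proof.
have := valP b; rewrite mem_f4_roots dotv4 => N.
rewrite mem_filter; apply/andP; split=> //.
have R (x y z t : int) : x * x + y * y + z * z + t * t <= 4 -> x \in vrange.
  move=> L; have : -2 <= x <= 2 by nia.
  by move=> /andP[A B]; rewrite !inE; lia.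
have {N}: val b 0 0 * val b 0 0 + val b 0 1 * val b 0 1 + val b 0 2 * val b 0 2
    + val b 0 3 * val b 0 3 <= 4 by case/orP: N => /eqP ->.
rewrite /coords /row_coords mem_zbox.
move: (val b 0 0) (val b 0 1) (val b 0 2) (val b 0 3) => x y z t L.
apply/and4P; split.
- exact: (R _ y z t).
- by apply: (R _ x z t); rewrite (addrC (y * y)).
- by apply: (R _ x y t); lia.
- by apply: (R _ x y z); lia.
Qed.

Lemma coords_all (P : pred zvec) : all P root_coords -> forall b, P (coords b).
Proof. by move/allP => A b; apply: A; apply: coords_mem. Qed.

Definition zsimple (i : nat) : zvec :=
  nth (0, 0, 0, 0) [:: (1, -1, -1, -1); (0, 0, 0, 2); (0, 0, 1, -1); (0, 1, -1, 0)] i.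

Definition zcart (i : nat) (t : zvec) : int :=
  let: (a, b, c, d) := t in
  nth 0 [:: ((a - b - c - d) %/ 2)%Z; d; c - d; b - c] i.

Definition zrefl (i : nat) (t : zvec) : zvec :=
  zsub (zcart i t) t (zsimple i).

Lemma coords_simple (i : 'I_4) : coords (simple i) = zsimple i.
Proof. by rewrite /coords /row_coords !mxE; case: i => -[|[|[|[|]]]]. Qed.

Lemma cart_simple b (i : 'I_4) : cart b (simple i) = zcart i (coords b).
Proof.
rewrite /cart !dotv4 /= !mxE /coords /row_coords; case: i => -[|[|[|[|//]]]] p /=.
- rewrite !(mulr1, mulrN1, mulr0, addr0, mulrN, opprK) /=.
  have -> : 1 + 1 + 1 + 1 = 2 * 2 :> int by [].
  by rewrite divzMpl.
- rewrite !(mulr0, addr0, add0r) (mulrC _ 2) mulrA mulKz //.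
- rewrite !(mulr0, mulr1, addr0, add0r, mulrN1, opprK) mulKz //.
- rewrite !(mulr0, mulr1, addr0, add0r, mulrN1, opprK) mulKz //.
Qed.

Lemma coords_srefl b (i : 'I_4) :
  coords (srefl (simple i) b) = zrefl i (coords b).
Proof.
by rewrite {1}/coords val_srefl row_coordsB cart_simple -!/(coords _) coords_simple.
Qed.

Lemma coords_opp b : coords (oppr_root b) = zsub 2 (coords b) (coords b).
Proof.
rewrite /coords val_oppr_root -row_coordsB scaler_nat mulr2n opprD addrA.
by rewrite subrr sub0r.
Qed.

Definition zheight (t : zvec) : int :=
  let: (a, b, c, d) := t in 729 * a + 81 * b + 9 * c + d.

(* Pairing with the regular dominant vector (729, 81, 9, 1): roots have entries
   in [-2, 2], so this base 9 expansion separates them. *)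
Definition height (b : f4root) : int := zheight (coords b).

Lemma heightE b : height b = zheight (coords b). Proof. by []. Qed.

Lemma height_inj : injective height.
Proof.
move=> a b E; apply: coords_inj.
have R (x : int) : x \in vrange -> -2 <= x <= 2 by rewrite !inE => H; lia.
have := coords_mem a; have := coords_mem b.
move: E; rewrite /height; case: (coords a) => [[[x y] z] t]; case: (coords b) => [[[x' y'] z'] t'] /= E.
have mem u v w s : (u, v, w, s) \in root_coords ->
    [/\ -2 <= u <= 2, -2 <= v <= 2, -2 <= w <= 2 & -2 <= s <= 2].
  by rewrite mem_filter mem_zbox => /andP[_ /and4P[? ? ? ?]]; split; apply: R.
move=> /mem[A' B' C' D'] /mem[A B C D].
have ? : x = x' by lia.
have ? : y = y' by lia.
have ? : z = z' by lia.
have ? : t = t' by lia.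
by subst.
Qed.

Definition pos (b : f4root) : bool := 0 < height b.

Lemma height_srefl a b : height (srefl a b) = height b - cart b a * height a.
Proof.
rewrite /height {1}/coords val_srefl row_coordsB -!/(coords _).
by case: (coords a) (coords b) => [[[? ?] ?] ?] [[[? ?] ?] ?] /=; ring.
Qed.

Lemma height_opp b : height (oppr_root b) = - height b.
Proof.
rewrite /height coords_opp.
by case: (coords b) => [[[? ?] ?] ?] /=; ring.
Qed.

Lemma height_neq0 b : height b != 0.
Proof.
apply/eqP => E; have := height_opp b; rewrite E oppr0 -E => /height_inj H.
have := dotv_root_neq0 b; have /rowP V := val_oppr_root b.
have Z j : val b 0 j = 0 by have := V j; rewrite H mxE; move: (val b 0 j) => z Ez; lia.
by rewrite dotv4 !Z.
Qed.

Lemma pos_opp b : pos (oppr_root b) = ~~ pos b.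
Proof. by rewrite /pos height_opp; have := height_neq0 b; lia. Qed.

Lemma pos_simple (i : 'I_4) : pos (simple i).
Proof. by rewrite /pos /height coords_simple; case: i => -[|[|[|[|//]]]]. Qed.

(** The coefficient of t on the i-th simple root, from solving the triangular system read off the
    coordinates. *)
Definition zcoef (i : nat) (t : zvec) : int :=
  let: (a, b, c, d) := t in
  nth 0 [:: a; ((3 * a + b + c + d) %/ 2)%Z; 2 * a + b + c; a + b] i.

(** The height is additive, positive on simple roots and nonzero on roots, which gives one
    direction. Conversely the coefficients [zcoef] are checked on the list; the equalities with
    absolute values also certify their signs. *)
Lemma positiveE b : positive b = pos b.
Proof.
apply/idP/idP => [/asboolP[n E]|Pb].
  pose g (v : 'rV[int]_4) := zheight (row_coords v).
  have gD : {morph g : u v / u + v >-> u + v}.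
    by move=> u v; rewrite /g /row_coords !mxE /=; ring.
  have g0 : g 0 = 0 by rewrite /g /row_coords !mxE.
  have H : height b = \sum_i height (simple i) *+ n i.
    rewrite /height /coords E -/(g _) (big_morph g gD g0).
    apply: eq_bigr => i _; rewrite -/(g _).
    by elim: (n i) => [|k IH]; rewrite ?mulr0n // !mulrS gD IH.
  have : 0 <= height b.
    rewrite H; apply: sumr_ge0 => i _; apply: mulrn_wge0; apply: ltW; exact: pos_simple.
  by rewrite /pos lt_neqAle eq_sym height_neq0.
apply/asboolP; exists (fun i => absz (zcoef i (coords b))).
apply/rowP => j; rewrite summxE.
pose P (t : zvec) := (0 < zheight t) ==>
   (let: (a, b, c, d) := t in
    let n i := Posz (absz (zcoef i t)) in
    [&& a == n 0%N, b == n 3%N - n 0%N, c == n 2%N - n 0%N - n 3%N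
      & d == 2 * n 1%N - n 0%N - n 2%N]).
have F : all P root_coords by vm_compute.
pose n i := Posz (absz (zcoef i (coords b))).
have {F} : [&& val b 0 0 == n 0%N, val b 0 1 == n 3%N - n 0%N,
    val b 0 2 == n 2%N - n 0%N - n 3%N & val b 0 3 == 2 * n 1%N - n 0%N - n 2%N].
  by have := coords_all F b; rewrite /P -/(height b) -/(pos b) Pb implyTb.
have -> : \sum_i (val (simple i) *+ absz (zcoef i (coords b))) 0 j =
   \sum_(i < 4) n i * val (simple i) 0 j.
  by apply: eq_bigr => i _; rewrite mulmxnE -mulr_natl natz.
rewrite !big_ord_recr big_ord0 /= !mxE /=.
move: {Pb} (val b) n => v n /and4P[/eqP A /eqP B /eqP C /eqP D].
by move: j; apply: ord4P; rewrite /= ?A ?B ?C ?D; ring.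
Qed.

Lemma pos_srefl (i : 'I_4) b : b != simple i -> b != oppr_root (simple i) ->
  pos (srefl (simple i) b) = pos b.
Proof.
have neg_coords : coords (oppr_root (simple i)) = zrefl i (zsimple i).
  by rewrite /oppr_root coords_srefl coords_simple.
rewrite -!(inj_eq coords_inj) neg_coords coords_simple /pos /height coords_srefl.
pose P (t : zvec) := (t != zsimple i) ==> (t != zrefl i (zsimple i)) ==>
   ((0 < zheight (zrefl i t)) == (0 < zheight t)).
have F : all P root_coords.
  by rewrite /P; move: i {P neg_coords} => -[[|[|[|[|//]]]] p]; vm_compute.
by move: (coords_all F b); rewrite /P => + A B; rewrite A B => /eqP.
Qed.

(** A positive root pairs positively with some simple root, since its square length is positive; so
    the default 3 is the only index left. *)
Definition descent (t : zvec) : nat :=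
  if 0 < zcart 0 t then 0 else if 0 < zcart 1 t then 1
  else if 0 < zcart 2 t then 2 else 3.

(* Every positive root reaches a simple one by height-lowering simple
   reflections. *)
Fixpoint descends (k : nat) (t : zvec) : bool :=
  if has (fun i => t == zsimple i) (iota 0 4) then true
  else if k is k'.+1 then descends k' (zrefl (descent t) t) else false.

Lemma descends_weyl k b : descends k (coords b) -> srefl b \in weyl.
Proof.
have simpleP c : has (fun i => coords c == zsimple i) (iota 0 4) -> srefl c \in weyl.
  case/hasP => i; rewrite mem_iota add0n => /andP[_ Li] /eqP E.
  suff -> : c = simple (Ordinal Li) by exact: simple_weyl.
  by apply: coords_inj; rewrite coords_simple.
elim: k b => [|k IH] b; rewrite /descends -/descends; case: ifP => [/simpleP //|_] //.
have Li : (descent (coords b) < 4)%N by rewrite /descent; do 3?case: ifP.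
rewrite -(coords_srefl b (Ordinal Li)) => /IH.
set s := srefl (simple (Ordinal Li)) => sW.
have Ws : s \in weyl by exact: simple_weyl.
have := weyl_sreflC (s b) Ws.
rewrite {3}/s srefl_invol => E.
by rewrite -(groupMl _ Ws) -E groupM.
Qed.

(** Each descent lowers the sum of the coefficients on the simple roots, which is at most 11 in F4,
    so 12 steps are ample. Opposite roots have the same reflection. *)
Lemma srefl_weyl b : srefl b \in weyl.
Proof.
pose P t := (0 < zheight t) ==> descends 12 t.
have F : all P root_coords by vm_compute.
have D c : pos c -> descends 12 (coords c).
  by move=> Pc; have /implyP := coords_all F c; apply.
case: (boolP (pos b)) => [Pb|Nb]; first exact: (@descends_weyl 12) (D _ Pb).
rewrite -srefl_opp; rewrite -pos_opp in Nb.
exact: (@descends_weyl 12) (D _ Nb).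
Qed.

(* Keeps unification from evaluating integer arithmetic on coordinates. *)
Opaque height cart srefl oppr_root simple weyl.

(** * The linear system for invariant forms *)

Lemma oppr_root_neq a : oppr_root a != a.
Proof. by apply/eqP => E; have := pos_opp a; rewrite E; case: pos. Qed.

(** The behaviour of b -> <b, nu>, kept as a function on roots: the ring can then be a polynomial
    ring and W acts by composition. *)
Definition weight (D : pzRingType) (x : f4root -> D) : Prop :=
  forall a b, x (srefl a b) = x b - (cart b a)%:~R * x a.

Lemma weight_opp (D : comPzRingType) (x : f4root -> D) a :
  weight x -> x (oppr_root a) = - x a.
Proof. by move=> X; rewrite -srefl_self X cart_self; ring. Qed.

Lemma weight_comp (D : pzRingType) (x : f4root -> D) c :
  weight x -> weight (x \o srefl c).
Proof. by move=> X a b; rewrite /= sreflJ X cart_srefl. Qed.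

Definition by_length (D : Type) (cl cs : D) (a : f4root) : D :=
  if is_long a then cl else cs.

(* phi w = Phi (t w) for a functional Phi on H on which right multiplication by
   omega_b acts as - nu b and left multiplication by omega_b^* as mu b. *)
Definition KZ (D : pzRingType) (c mu nu : f4root -> D)
    (phi : {perm f4root} -> D) : Prop :=
  forall b w, w \in weyl ->
    \sum_(e | pos e && pos (w e)) c e * (cart b e)%:~R * phi (srefl e * w)%g
    = (mu b - nu (w b)) * phi w.

Definition delta1 (D : pzRingType) (w : {perm f4root}) : D := (w == 1%g)%:R.

(** A nonzero term of the sum would need w = s_e, but then w e = -e is negative and e is not summed
    over. *)
Lemma KZ_delta (D : pzRingType) (c nu : f4root -> D) : KZ c nu nu (@delta1 D).
Proof.
move=> b w Ww; rewrite /delta1; case: (eqVneq w 1%g) => [->|Nw].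
  rewrite perm1 subrr mul0r big1 // => e _.
  suff /negPf -> : (srefl e * 1 != 1)%g by rewrite mulr0.
  rewrite mulg1; apply/eqP => E; have := oppr_root_neq e.
  by rewrite -srefl_self E perm1 eqxx.
rewrite mulr0 big1 // => e /andP[Pe Pwe].
suff /negPf -> : (srefl e * w != 1)%g by rewrite mulr0.
apply/eqP => /eqP; rewrite -eq_invg_mul sreflV => /eqP E.
by move: Pwe; rewrite -E srefl_self pos_opp Pe.
Qed.

(** A simple reflection preserves the sign of every root other than plus or minus its own. [Q]
    selects exactly one of these two, hence a single correction term. *)
Lemma pos_srefl_sum (D : zmodType) (i : 'I_4) (Q : pred f4root) (f : f4root -> D) :
  (forall e, Q (oppr_root e) = ~~ Q e) ->
  \sum_(e | pos e && Q e) f e =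
  \sum_(e | pos (srefl (simple i) e) && Q e) f e
    + (if Q (simple i) then f (simple i) else - f (oppr_root (simple i))).
Proof.
move=> QN; move: (simple i) (pos_simple i) (@pos_srefl i) (simple_weyl i) => a Pa Ps Ws.
have Po : pos (srefl a a) = false by rewrite srefl_self pos_opp Pa.
have Pso : pos (srefl a (oppr_root a)) = true by rewrite weyl_opp // pos_opp Po.
case: ifP => Qa.
  rewrite (bigD1 a); last by rewrite Pa Qa.
  rewrite addrC; congr (_ + _); apply: eq_bigl => e.
  case: (eqVneq e a) => [->|N]; first by rewrite Po !andbF.
  rewrite andbT; case: (boolP (Q e)) => Qe; last by rewrite !andbF.
  rewrite !andbT (Ps e N) => [//|]; apply: contraTneq Qe => ->; by rewrite QN Qa.
rewrite [in RHS](bigD1 (oppr_root a)); last by rewrite QN Qa Pso.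
rewrite addrAC subrr add0r; apply: eq_bigl => e.
case: (eqVneq e (oppr_root a)) => [->|N]; first by rewrite pos_opp Pa !andbF.
rewrite andbT; case: (boolP (Q e)) => Qe; last by rewrite !andbF.
rewrite !andbT Ps => [//||]; [apply: contraTneq Qe => ->; by rewrite Qa|exact: N].
Qed.

Lemma pos_srefl_weyl_sum (D : zmodType) (i : 'I_4) (w : {perm f4root})
    (f : f4root -> D) :
  let e0 := ((w^-1)%g : {perm f4root}) (simple i) in w \in weyl ->
  \sum_(e | pos e && pos (w e)) f e =
  \sum_(e | pos e && pos (srefl (simple i) (w e))) f e
    + (if pos e0 then f e0 else - f (oppr_root e0)).
Proof.
move=> e0 Ww; pose v : {perm f4root} := (w^-1)%g.
have Wv : v \in weyl by rewrite groupV.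
have wv e : w (v e) = e by exact: permKV.
have QN e : pos (v (oppr_root e)) = ~~ pos (v e) by rewrite weyl_opp // pos_opp.
rewrite (reindex_inj (@perm_inj _ v)) [in RHS](reindex_inj (@perm_inj _ v)).
under eq_bigl => e do rewrite wv andbC.
under [in RHS]eq_bigl => e do rewrite wv andbC.
by rewrite (pos_srefl_sum i _ QN) -/e0 weyl_opp.
Qed.

(** This is the intertwining property of the factor c_a + nu(a) s_a. The sums for w and for w s_a
    differ only in the root w^-1 a, whose term is c_a <w b, a^vee> phi(w); it accounts for the
    change from nu to its reflection. *)
Lemma KZ_step (D : comPzRingType) (c mu nu : f4root -> D) phi i :
  let a := simple i in
  {in weyl, forall (w : {perm f4root}) e, c (w e) = c e} -> (forall e, c (oppr_root e) = c e) ->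
  weight nu -> KZ c mu nu phi ->
  KZ c mu (nu \o srefl a)
     (fun w => c a * phi w + nu a * phi (w * srefl a)%g).
Proof.
move=> a cW cN X K b w Ww.
have Wa : srefl a \in weyl by exact: simple_weyl.
pose e0 := ((w^-1)%g : {perm f4root}) a.
have we0 : w e0 = a by rewrite permKV.
have -> : \sum_(e | pos e && pos (w e)) c e * (cart b e)%:~R *
      (c a * phi (srefl e * w)%g + nu a * phi (srefl e * w * srefl a)%g)
  = c a * (\sum_(e | pos e && pos (w e)) c e * (cart b e)%:~R * phi (srefl e * w)%g)
    + nu a * (\sum_(e | pos e && pos (w e)) c e * (cart b e)%:~R * phi (srefl e * (w * srefl a))%g).
  rewrite !mulr_sumr -big_split; apply: eq_bigr => e _; rewrite mulgA.
  by rewrite mulrDr !(mulrCA _ (c a)) !(mulrCA _ (nu a)) mulrA.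
rewrite K // (pos_srefl_weyl_sum i) // -/a -/e0.
have := K b (w * srefl a)%g (groupM Ww Wa).
under eq_bigl => e do rewrite permM.
move=> ->; rewrite permM; rewrite -[(nu \o srefl a) (w b)]/(nu (srefl a (w b))).
have -> : (if pos e0 then c e0 * (cart b e0)%:~R * phi (srefl e0 * (w * srefl a))%g
   else - (c (oppr_root e0) * (cart b (oppr_root e0))%:~R *
        phi (srefl (oppr_root e0) * (w * srefl a))%g))
  = c a * (cart (w b) a)%:~R * phi w.
  have ce : c e0 = c a by rewrite -we0 cW.
  have ne : cart b e0 = cart (w b) a by rewrite -we0 weyl_cart.
  have se : (srefl e0 * (w * srefl a) = w)%g.
    by rewrite mulgA weyl_sreflC // we0 -mulgA sreflM mulg1.
  rewrite srefl_opp cart_opp cN se ce ne; case: ifP => // _.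
  by rewrite rmorphN /=; ring.
by rewrite X; ring.
Qed.

Fixpoint rprod (D : pzRingType) (l : seq ('I_4 * D * D)) (phi : {perm f4root} -> D)
    : {perm f4root} -> D :=
  if l is (i, p, q) :: l' then
    rprod l' (fun w => p * phi w + q * phi (w * srefl (simple i))%g)
  else phi.

Lemma eq_rprod (D : pzRingType) (l : seq ('I_4 * D * D)) phi psi :
  phi =1 psi -> rprod l phi =1 rprod l psi.
Proof. by move=> /funext ->. Qed.

(** The k-th letter is paired with s_{i_1} ... s_{i_{k-1}} alpha_{i_k}; for a reduced word of w0
    these roots enumerate the positive ones. *)
Fixpoint betaseq (word : seq 'I_4) : seq ('I_4 * f4root) :=
  if word is i :: l then
    (i, simple i) :: [seq (jb.1, srefl (simple i) jb.2) | jb <- betaseq l]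
  else [::].

Definition factors (D : Type) (c x : f4root -> D) (word : seq 'I_4) :=
  [seq (jb.1, c (simple jb.1), x jb.2) | jb <- betaseq word].

Definition word_act (word : seq 'I_4) (b : f4root) : f4root :=
  foldr (fun i => srefl (simple i)) b word.

Lemma KZ_prod (D : comPzRingType) (c mu : f4root -> D) word nu phi :
  {in weyl, forall (w : {perm f4root}) e, c (w e) = c e} -> (forall e, c (oppr_root e) = c e) ->
  weight nu -> KZ c mu nu phi ->
  KZ c mu (nu \o word_act word) (rprod (factors c nu word) phi).
Proof.
move=> cW cN; elim: word nu phi => [|i l IH] nu phi X K //=.
have := IH _ _ (weight_comp (simple i) X) (KZ_step i cW cN X K).
by rewrite /factors -map_comp.
Qed.

(** The Coxeter number of F4 is 12 and w0 = -1, so w0 is the sixth power of a Coxeter element; 24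
    letters make the word reduced. *)
Definition coxeter_word : seq 'I_4 := flatten (nseq 6 [:: 0; 1; 2; 3]).

Definition zword_act (word : seq nat) (t : zvec) : zvec := foldr zrefl t word.

Lemma coords_word_act word b :
  coords (word_act word b) = zword_act (map val word) (coords b).
Proof. by elim: word => //= i l IH; rewrite coords_srefl IH. Qed.

Lemma coxeter_word_act b : word_act coxeter_word b = oppr_root b.
Proof.
apply: coords_inj; rewrite coords_word_act coords_opp.
pose P t := zword_act (map val coxeter_word) t == zsub 2 t t.
have F : all P root_coords by rewrite /P; vm_compute.
by apply/eqP; exact: coords_all F b.
Qed.

(** The word is reversed because [word_act] applies its last letter first, whereas a product of
    permutations applies its first factor first. *)
Definition w0 : {perm f4root} :=
  (\prod_(i <- rev coxeter_word) srefl (simple i))%g.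

Lemma w0E b : w0 b = oppr_root b.
Proof.
rewrite -coxeter_word_act /w0 -{2}[coxeter_word]revK.
elim: (rev coxeter_word) b => [|i l IH] b; first by rewrite big_nil perm1.
by rewrite big_cons permM IH rev_cons /word_act -cats1 foldr_cat.
Qed.

Fixpoint zbetaseq (word : seq nat) : seq (nat * zvec) :=
  if word is i :: l then
    (i, zsimple i) :: [seq (jb.1, zrefl i jb.2) | jb <- zbetaseq l]
  else [::].

Lemma coords_betaseq word :
  [seq (val jb.1, coords jb.2) | jb <- betaseq word] = zbetaseq (map val word).
Proof.
elim: word => //= i l <-; rewrite coords_simple -!map_comp; congr (_ :: _).
by apply: eq_map => jb /=; rewrite coords_srefl.
Qed.

Definition coxeter_betas : seq (nat * zvec) :=
  zbetaseq (flatten (nseq 6 [:: 0; 1; 2; 3]%N)).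

Lemma coords_coxeter :
  [seq (val jb.1, coords jb.2) | jb <- betaseq coxeter_word] = coxeter_betas.
Proof. by rewrite coords_betaseq; congr zbetaseq. Qed.

Opaque coxeter_word.

Lemma w0V : (w0^-1 = w0)%g.
Proof.
apply/eqP; rewrite eq_invg_mul; apply/eqP/permP => b.
by rewrite permM perm1 !w0E oppr_rootK.
Qed.

(** Taking the equation at w^-1 and w b, and reindexing e by w, recovers the sum for w. The right
    side is unchanged because its coefficient x(b) + x(w b) is symmetric in b and w b. *)
Lemma KZ_inv (D : comPzRingType) (c x : f4root -> D) phi :
  {in weyl, forall (w : {perm f4root}) e, c (w e) = c e} ->
  KZ c x (fun b => - x b) phi ->
  KZ c x (fun b => - x b) (fun w => phi (w^-1)%g).
Proof.
move=> cW K b w Ww.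
have Wi : (w^-1)%g \in weyl by rewrite groupV.
have PK e : (w^-1%g : {perm f4root}) (w e) = e by exact: permK.
have := K (w b) _ Wi; rewrite PK !opprK => E.
rewrite addrC -E (reindex_inj (@perm_inj _ (w^-1)%g)).
apply: eq_big => [e|e _].
  by rewrite -[w _]/(w ((w^-1%g : {perm f4root}) e)) permKV andbC.
pose e' := (w^-1%g : {perm f4root}) e; have we' : w e' = e by exact: permKV.
rewrite -/e' -[in RHS]we' cW // weyl_cart // weyl_sreflC // invMg sreflV we'.
by [].
Qed.

(** Reindexing by s_e negates [cart b e] and shifts [height b], so the sum equals minus itself plus
    [height e] times a positive sum of squares. *)
Lemma cart_height_gt0 e : pos e -> 0 < \sum_b cart b e * height b.
Proof.
move=> Pe; pose s := \sum_b cart b e * height b.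
have : s = - s + height e * \sum_b cart b e ^+ 2.
  rewrite {1}/s (reindex_inj (@perm_inj _ (srefl e))) /=.
  rewrite /s mulr_sumr -sumrN -big_split /=; apply: eq_bigr => b _.
  have -> : cart (srefl e b) e = - cart b e.
    have := cart_srefl e (oppr_root e) b.
    by rewrite cart_opp weyl_opp ?srefl_weyl // srefl_self oppr_rootK.
  by rewrite height_srefl mulrBr !mulNr opprK; congr (_ + _); rewrite expr2 [RHS]mulrC mulrA.
have : 0 < \sum_b cart b e ^+ 2.
  rewrite (bigD1 e) //= cart_self; apply: ltr_pwDl => //.
  by apply: sumr_ge0 => b _; exact: sqr_ge0.
by rewrite -/s; move: Pe; rewrite /pos => Pe S E; nia.
Qed.

(** Among w with phi(w) nonzero, take one minimising m. Every s_e w in its equation has smaller m,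
    so the sum vanishes and x(w b) = -x(b) for all b; injectivity of x then forces w = w0. *)
Lemma KZ_uniq (D : idomainType) (c x : f4root -> D) phi :
  weight x -> injective x -> KZ c x (fun b => - x b) phi -> phi w0 = 0 ->
  {in weyl, forall w, phi w = 0}.
Proof.
move=> X xI K p0 v Wv; apply/eqP/negPn/negP => Nv.
pose m (w : {perm f4root}) := \sum_b height b * height (w b).
pose P w := (w \in weyl) && (phi w != 0).
have Pv : P v by rewrite /P Wv.
case: (@Order.TotalTheory.arg_minP _ _ _ v P m Pv) => w /andP[Ww Nw] min.
suff E : w = w0 by rewrite E p0 eqxx in Nw.
apply/permP => b; rewrite w0E; apply: xI; rewrite weight_opp //.
apply/eqP; rewrite -addr_eq0 addrC -[x (w b)]opprK; apply/eqP.
have := K b w Ww; rewrite big1 => [/esym/eqP|e /andP[Pe Pwe]].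
  by rewrite mulf_eq0 (negPf Nw) orbF => /eqP.
have [->|Ne] := eqVneq (phi (srefl e * w)%g) 0; first by rewrite mulr0.
have Pew : P (srefl e * w)%g by rewrite /P groupM ?srefl_weyl.
have := min _ Pew; rewrite leNgt => /negP[].
have -> : m (srefl e * w)%g = m w - height (w e) * \sum_b cart b e * height b.
  rewrite /m mulr_sumr -sumrB; apply: eq_bigr => b' _.
  rewrite permM weyl_srefl // height_srefl weyl_cart //.
  rewrite mulrBr; congr (_ - _).
  by rewrite mulrA mulrC; congr (_ * _); exact: mulrC.
by rewrite gtrBl mulr_gt0 // cart_height_gt0.
Qed.

Lemma rprod_morph (D E : pzRingType) (f : {rmorphism D -> E}) l phi w :
  rprod [seq (t.1.1, f t.1.2, f t.2) | t <- l] (f \o phi) w = f (rprod l phi w).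
Proof.
elim: l phi => [|[[i p] q] l IH] phi //=.
rewrite -IH; apply: eq_rprod => v /=.
by rewrite rmorphD !rmorphM.
Qed.

Lemma rprod_delta_morph (D E : pzRingType) (f : {rmorphism D -> E}) l w :
  rprod [seq (t.1.1, f t.1.2, f t.2) | t <- l] (@delta1 E) w =
  f (rprod l (@delta1 D) w).
Proof.
rewrite -rprod_morph; apply: eq_rprod => v.
by rewrite /delta1 /= rmorph_nat.
Qed.

Lemma rprod_scale (D : comPzRingType) (s : 'I_4 -> D) l k phi w :
  rprod [seq (t.1.1, s t.1.1 * t.1.2, s t.1.1 * t.2) | t <- l]
    (fun w => k * phi w) w
  = (\prod_(t <- l) s t.1.1) * k * rprod l phi w.
Proof.
elim: l k phi => [|[[i p] q] l IH] k phi; first by rewrite big_nil mul1r.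
pose psi v := p * phi v + q * phi (v * srefl (simple i))%g.
transitivity (rprod [seq (t.1.1, s t.1.1 * t.1.2, s t.1.1 * t.2) | t <- l]
    (fun v => (s i * k) * psi v) w).
  by rewrite [LHS]/=; apply: eq_rprod => v; rewrite /psi; ring.
by rewrite IH big_cons mulrA (mulrC (s i)).
Qed.

Lemma by_length_weyl (D : Type) (cl cs : D) :
  {in weyl, forall (w : {perm f4root}) e, by_length cl cs (w e) = by_length cl cs e}.
Proof. by move=> w Ww e; rewrite /by_length weyl_long. Qed.

Lemma by_length_opp (D : Type) (cl cs : D) e :
  by_length cl cs (oppr_root e) = by_length cl cs e.
Proof. by rewrite -srefl_self by_length_weyl ?srefl_weyl. Qed.

Lemma KZ_coxeter (D : comPzRingType) (cl cs : D) (x : f4root -> D) :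
  weight x -> KZ (by_length cl cs) x (fun b => - x b)
    (rprod (factors (by_length cl cs) x coxeter_word) (@delta1 D)).
Proof.
move=> X.
have := KZ_prod coxeter_word (@by_length_weyl _ cl cs) (@by_length_opp _ cl cs) X
  (KZ_delta (by_length cl cs) x).
suff -> : x \o word_act coxeter_word = (fun b => - x b) by [].
apply/funext => b; rewrite -[LHS]/(x (word_act coxeter_word b)).
by rewrite coxeter_word_act weight_opp.
Qed.

Lemma polyC_int (D : nzRingType) (n : int) : (n%:~R : D)%:P = n%:~R.
Proof. exact: (rmorph_int (@polyC D)). Qed.

Definition char0 (D : pzRingType) := injective (fun z : int => z%:~R : D).

Lemma char0_poly (D : nzRingType) : char0 D -> char0 {poly D}.
Proof.
move=> C z z' /= E; apply: C; have := congr1 (fun p : {poly D} => p`_0) E.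
by rewrite -!polyC_int !coefC.
Qed.

(** The difference of r and its inverted copy solves the same system and vanishes at w0, which is an
    involution. *)
Lemma rprod_inv_regular (D : idomainType) (cl cs : D) (x : f4root -> D) w :
  weight x -> injective x -> w \in weyl ->
  let r := rprod (factors (by_length cl cs) x coxeter_word) (@delta1 D) in
  r (w^-1)%g = r w.
Proof.
move=> X xI Ww r.
have K := KZ_coxeter cl cs X; rewrite -/r in K.
have K' := KZ_inv (@by_length_weyl _ cl cs) K.
clearbody r.
apply/eqP; rewrite -subr_eq0; apply/eqP.
pose d v := r (v^-1)%g - r v.
suff Kd : KZ (by_length cl cs) x (fun b => - x b) d.
  by apply: (KZ_uniq X xI Kd) => //; rewrite /d w0V subrr.
move=> b v Wv; have Kb := K b v Wv; have K'b := K' b v Wv.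
rewrite /d mulrBr -Kb -K'b -sumrB.
by apply: eq_bigr => e _; rewrite mulrBr.
Qed.

(* A generic perturbation of x over D['X] is injective on the roots. *)
Lemma rprod_inv (D : idomainType) (cl cs : D) (x : f4root -> D) w :
  char0 D -> weight x -> w \in weyl ->
  let r := rprod (factors (by_length cl cs) x coxeter_word) (@delta1 D) in
  r (w^-1)%g = r w.
Proof.
move=> C X Ww r.
pose X' b : {poly D} := (x b)%:P + (height b)%:~R * 'X.
have wX : weight X'.
  move=> a b; rewrite /X' X height_srefl.
  rewrite polyCB polyCM polyC_int mulrzBr intrM.
  by move: (cart b a) (height a) (height b) => n h k; ring.
have iX : injective X'.
  move=> a b /(congr1 (fun p : {poly D} => p`_1)).
  rewrite /X' -!polyC_int !mul_polyC !coefD !coefC !coefZ !coefX !mulr1 !add0r.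
  by move=> /C/height_inj.
pose f : {rmorphism {poly D} -> D} := horner_eval (0 : D).
have E v : r v = f (rprod (factors (by_length cl%:P cs%:P) X' coxeter_word) (@delta1 _) v).
  rewrite -(rprod_delta_morph f) /r /factors.
  move: (betaseq coxeter_word) => bs; rewrite -map_comp.
  congr (rprod _ _ _); apply: eq_map => jb; rewrite [RHS]/=; congr (_, _, _); rewrite /f /= /horner_eval.
    by rewrite /by_length; case: ifP; rewrite hornerC.
  by rewrite /X' hornerD hornerM hornerX mulr0 hornerC addr0.
by rewrite (E w) (E (w^-1)%g) rprod_inv_regular.
Qed.

Definition tfactors (D : pzRingType) (cl cs t : D) (x : f4root -> D) word :=
  [seq (jb.1, by_length cl cs (simple jb.1), by_length 1 t (simple jb.1) * x jb.2)
     | jb <- betaseq word].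

(* Scaling every long factor by t turns the family into the one with parameters
   (t cl, cs) and weight t x; t = 'X is then cancelled and specialised. *)
Lemma rprod_tfactors_inv (D : idomainType) (cl cs t : D) (x : f4root -> D) w :
  char0 D -> weight x -> w \in weyl ->
  let r := rprod (tfactors cl cs t x coxeter_word) (@delta1 D) in
  r (w^-1)%g = r w.
Proof.
move=> C X Ww r.
pose X' b := 'X * (x b)%:P.
have wX : weight X'.
  move=> a b; rewrite /X' X polyCB polyCM polyC_int.
  by move: (cart b a) => n; ring.
pose l := tfactors cl%:P cs%:P 'X (fun b => (x b)%:P) coxeter_word.
pose s i : {poly D} := by_length 'X 1 (simple i).
have S v : rprod (factors (by_length ('X * cl%:P) cs%:P) X' coxeter_word) (@delta1 _) v
   = (\prod_(t <- l) s t.1.1) * rprod l (@delta1 _) v.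
  rewrite -[\prod_(t <- l) _]mulr1 -rprod_scale.
  rewrite /l /tfactors /factors.
  move: (betaseq coxeter_word) => bs; rewrite -!map_comp.
  have -> : (fun w => 1 * @delta1 {poly D} w) = @delta1 _.
    by apply/funext => u; rewrite mul1r.
  congr (rprod _ _ _); apply: eq_map => jb; rewrite [RHS]/=; congr (_, _, _).
    by rewrite /s /by_length; case: ifP => // _; rewrite mul1r.
  by rewrite /s /X' /by_length; case: ifP => // _; rewrite !mul1r.
have N : \prod_(t <- l) s t.1.1 != 0.
  elim: (l) => [|t' l' IH]; first by rewrite big_nil oner_neq0.
  rewrite big_cons mulf_neq0 // /s /by_length.
  by case: ifP => _; rewrite ?polyX_eq0 ?oner_neq0.
have I : rprod l (@delta1 _) (w^-1)%g = rprod l (@delta1 _) w.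
  apply: (mulfI N); have Sw := S w; have SV := S (w^-1)%g.
  apply: (etrans (esym SV)); apply: etrans Sw.
  exact: (@rprod_inv _ _ _ _ w (char0_poly C) wX Ww).
pose f : {rmorphism {poly D} -> D} := horner_eval t.
have E v : r v = f (rprod l (@delta1 _) v).
  rewrite -(rprod_delta_morph f) /r /l /tfactors.
  move: (betaseq coxeter_word) => bs; rewrite -map_comp.
  congr (rprod _ _ _); apply: eq_map => jb; rewrite [RHS]/=; congr (_, _, _); rewrite /f /= /horner_eval.
    by rewrite /by_length; case: ifP; rewrite hornerC.
  by rewrite /by_length hornerM; case: ifP; rewrite ?hornerX !hornerC.
by rewrite (E w) (E (w^-1)%g) I.
Qed.

(** * Positive definite functions on W *)

Lemma In_map (A B : Type) (f : A -> B) (l : seq A) b :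
  List.In b [seq f a | a <- l] -> exists2 a, List.In a l & b = f a.
Proof.
elim: l => //= a l IH [<-|/IH[a' In_a' ->]]; first by exists a; first left.
by exists a' => //; right.
Qed.

Section PositiveDefinite.
Variable R : realType.
Implicit Types (r a b : {perm f4root} -> R) (l : seq ('I_4 * R * R)).

Definition dotW a b : R := \sum_(y in weyl) a y * b y.

Definition convolution r a (y : {perm f4root}) : R := \sum_(z in weyl) r z * a (y * z)%g.

(** Substituting w = y z turns this into the sum of a(y) a(w) r(y^-1 w), the form with Gram matrix
    r(y^-1 w). *)
Definition quad r a : R := dotW a (convolution r a).

Definition pd r : Prop :=
  forall a, (exists2 w, w \in weyl & a w != 0) -> 0 < quad r a.

Definition psd r : Prop := forall a, 0 <= quad r a.

Definition sym_fun r : Prop := {in weyl, forall w, r (w^-1)%g = r w}.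

Lemma dotW_ge0 a : 0 <= dotW a a.
Proof. by apply: sumr_ge0 => y _; rewrite -expr2 sqr_ge0. Qed.

Lemma dotW_gt0 a : (exists2 w, w \in weyl & a w != 0) -> 0 < dotW a a.
Proof.
case=> w Ww aw; rewrite /dotW (bigD1 w) //=; apply: ltr_pwDl.
  by rewrite -expr2 exprn_even_gt0.
by apply: sumr_ge0 => y _; rewrite -expr2 sqr_ge0.
Qed.

Lemma dotW_shift a b v : v \in weyl ->
  dotW (fun y => a (y * v)%g) b = dotW a (fun y => b (y * v^-1)%g).
Proof.
move=> Wv; rewrite /dotW [RHS](reindex_inj (mulIg v)).
by apply: eq_big => [y|y _]; rewrite ?groupMr // mulgK.
Qed.

Lemma dotW_shift_norm a v : v \in weyl ->
  dotW (fun y => a (y * v)%g) (fun y => a (y * v)%g) = dotW a a.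
Proof.
move=> Wv; rewrite dotW_shift //; apply: eq_bigr => y _.
by rewrite mulgKV.
Qed.

Lemma dotWC a b : dotW a b = dotW b a.
Proof. by apply: eq_bigr => y _; rewrite mulrC. Qed.

Lemma dotW_le a b : `|dotW a b| <= (dotW a a + dotW b b) / 2.
Proof.
have E : (dotW a a + dotW b b) / 2 = \sum_(y in weyl) ((a y * a y + b y * b y) / 2).
  by rewrite -mulr_suml big_split.
rewrite E; apply: le_trans (ler_norm_sum _ _ _) _; apply: ler_sum => y _.
by rewrite ler_norml; apply/andP; split;
  [have := sqr_ge0 (a y + b y)|have := sqr_ge0 (a y - b y)]; rewrite expr2; lra.
Qed.

Lemma quad_sum r a :
  quad r a = \sum_(z in weyl) r z * dotW a (fun y => a (y * z)%g).
Proof.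
rewrite /quad /dotW /convolution; under eq_bigr => y _ do rewrite mulr_sumr.
rewrite exchange_big; apply: eq_bigr => z _; rewrite mulr_sumr.
by apply: eq_bigr => y _; ring.
Qed.

Lemma quad_le r a K : {in weyl, forall z, `|r z| <= K} ->
  `|quad r a| <= K * #|weyl|%:R * dotW a a.
Proof.
move=> B; rewrite quad_sum; apply: le_trans (ler_norm_sum _ _ _) _.
have -> : K * #|weyl|%:R * dotW a a = \sum_(z in weyl) K * dotW a a.
  by rewrite sumr_const -mulr_natr; ring.
apply: ler_sum => z Wz; rewrite normrM; apply: ler_pM => //; first exact: B.
by apply: le_trans (dotW_le _ _) _; rewrite dotW_shift_norm //; lra.
Qed.

Lemma quad_sub r s a : quad r a - quad s a = quad (fun z => r z - s z) a.
Proof.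
by rewrite !quad_sum -sumrB; apply: eq_bigr => z _; rewrite mulrBl.
Qed.

Lemma conv_adj r a b : sym_fun r -> dotW a (convolution r b) = dotW (convolution r a) b.
Proof.
move=> S; rewrite /dotW /convolution.
under eq_bigr => y _ do rewrite mulr_sumr.
under [in RHS]eq_bigr => y _ do rewrite mulr_suml.
rewrite exchange_big [RHS]exchange_big /=.
rewrite [RHS](reindex_inj invg_inj) /=.
apply: eq_big => [z|z Wz]; first by rewrite groupV.
rewrite S // (reindex_inj (mulIg (z^-1)%g)).
apply: eq_big => [y|y Wy]; first by rewrite groupMr // groupV.
by rewrite mulgKV; ring.
Qed.

Lemma quad_sub_arg r a b s : sym_fun r ->
  quad r (fun y => a y - s * b y) =
  quad r a - 2 * s * dotW b (convolution r a) + s ^+ 2 * quad r b.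
Proof.
move=> S; have E := conv_adj a b S.
have C : convolution r (fun y => a y - s * b y) = fun y => convolution r a y - s * convolution r b y.
  apply/funext => y; rewrite /convolution mulr_sumr -sumrB; apply: eq_bigr => z _; ring.
have D u v : dotW (fun y => a y - s * b y) (fun y => u y - s * v y)
   = dotW a u - s * dotW b u - s * dotW a v + s ^+ 2 * dotW b v.
  rewrite /dotW !mulr_sumr -!sumrB -big_split; apply: eq_bigr => y _ /=; ring.
by rewrite /quad C D E (dotWC (convolution r a) b); ring.
Qed.

(* A positive semidefinite symmetric A with |A a|^2 >= m |a|^2 and <b, A b> <= K |b|^2
   satisfies <a, A a> >= (m / K) |a|^2: expand 0 <= <c, A c> at c = a - (A a) / K. *)
Lemma psd_gap r m K a : sym_fun r -> psd r -> 0 < K ->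
  (forall b, quad r b <= K * dotW b b) ->
  m * dotW a a <= dotW (convolution r a) (convolution r a) ->
  m / K * dotW a a <= quad r a.
Proof.
move=> S P K0 B M; have := P (fun y => a y - K^-1 * convolution r a y).
rewrite quad_sub_arg //; have := B (convolution r a).
move: M; set N := dotW (convolution r a) _; set q := quad r a; set q' := quad r (convolution r a).
set n := dotW a a => M Bq Q.
have V : K^-1 > 0 by rewrite invr_gt0.
have KV : K * K^-1 = 1 by rewrite mulfV // gt_eqF.
have : K^-1 ^+ 2 * q' <= K^-1 * N.
  apply: (le_trans (y := K^-1 ^+ 2 * (K * N))).
    by rewrite ler_wpM2l // sqr_ge0.
  by rewrite expr2 mulrA -(mulrA _ _ K) (mulrC _ K) KV mulr1.
have : m * K^-1 * n <= K^-1 * N.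
  by rewrite mulrAC mulrC ler_wpM2l // ltW.
rewrite -/(m / K); lra.
Qed.

Lemma conv_sym_step p q i r a y :
  convolution (fun w => p * r w + q * r (w * srefl (simple i))%g) a y =
  convolution r (fun w => p * a w + q * a (w * srefl (simple i))%g) y.
Proof.
have Ws := simple_weyl i; move: (srefl (simple i)) Ws (sreflV (simple i)) => s Ws sV.
rewrite /convolution.
under eq_bigr => z _ do rewrite mulrDl.
under [RHS]eq_bigr => z _ do rewrite mulrDr.
rewrite !big_split /=; congr (_ + _); first by apply: eq_bigr => z _; ring.
rewrite [RHS](reindex_inj (mulIg s)) /=; apply: eq_big => [z|z _].
  by rewrite groupMr.
have ss : (s * s = 1)%g by rewrite -{2}sV mulgV.
by rewrite -!mulgA ss mulg1; ring.
Qed.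

Definition opstep p q i a (w : {perm f4root}) : R :=
  p * a w + q * a (w * srefl (simple i))%g.

(** The convolution operator of a product of factors, written as a composition of elementary
    operators so that lower bounds on the factors multiply. *)
Fixpoint opprod l a : {perm f4root} -> R :=
  if l is (i, p, q) :: l' then
    opstep p q i (opprod l' a)
  else a.

Lemma conv_rprod l r a y : convolution (rprod l r) a y = convolution r (opprod l a) y.
Proof.
elim: l r a y => [|[[i p] q] l IH] r a y //=.
by rewrite IH conv_sym_step.
Qed.

Lemma conv_delta a y : convolution (@delta1 R) a y = a y.
Proof.
rewrite /convolution (bigD1 1%g) //= /delta1 eqxx mul1r mulg1 big1 ?addr0 // => z /andP[_ N].
by rewrite (negPf N) mul0r.
Qed.

Lemma conv_opprod l a : convolution (rprod l (@delta1 R)) a = opprod l a.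
Proof. by apply/funext => y; rewrite conv_rprod conv_delta. Qed.

(** Right translation by s is a symmetric isometric involution, so p + q s has singular values |p +
    q| and |p - q|. *)
Lemma step_lower p q i m a :
  m <= (p - q) ^+ 2 -> m <= (p + q) ^+ 2 ->
  m * dotW a a <= dotW (opstep p q i a) (opstep p q i a).
Proof.
move=> m1 m2; have Ws := simple_weyl i.
pose sa w := a (w * srefl (simple i))%g.
have -> : dotW (opstep p q i a) (opstep p q i a) = (p ^+ 2 + q ^+ 2) * dotW a a + 2 * (p * q) * dotW a sa.
  rewrite mulrDl -{2}(dotW_shift_norm a Ws) -/sa /dotW !mulr_sumr -!big_split.
  by apply: eq_bigr => w _ /=; rewrite /opstep -/(sa w); ring.
have := dotW_le a sa; rewrite dotW_shift_norm // ler_norml => /andP[].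
have := dotW_ge0 a; move: (dotW a a) (dotW a sa) => n t n0 t1 t2.
have [pq|pq] := leP 0 (p * q).
  have : m * n <= (p - q) ^+ 2 * n by exact: ler_wpM2r.
  have : 0 <= p * q * (t + n) by apply: mulr_ge0 => //; lra.
  by lra.
have : m * n <= (p + q) ^+ 2 * n by exact: ler_wpM2r.
have : 0 <= (- (p * q)) * (n - t) by apply: mulr_ge0; lra.
by lra.
Qed.

Lemma opprod_lower m l a : 0 <= m ->
  (forall t, List.In t l -> m <= (t.1.2 - t.2) ^+ 2 /\ m <= (t.1.2 + t.2) ^+ 2) ->
  m ^+ size l * dotW a a <= dotW (opprod l a) (opprod l a).
Proof.
move=> m0; elim: l => [|[[i p] q] l IH] M /=; first by rewrite expr0 mul1r.
have [m1 m2] := M _ (or_introl erefl).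
apply: le_trans (step_lower i (opprod l a) m1 m2).
rewrite exprS -mulrA ler_wpM2l //; apply: IH => t Ht; apply: M; by right.
Qed.

End PositiveDefinite.

(** * Uniform bounds along polynomial families on [0, 1] *)

Lemma poly_bound01 (R : realType) (p : {poly R}) :
  exists2 K, 0 <= K & forall x, 0 <= x <= 1 -> `|p.[x]| <= K.
Proof.
elim/poly_ind: p => [|p c [K K0 H]]; first by exists 0 => // x _; rewrite horner0 normr0.
exists (K + `|c|); first by rewrite addr_ge0.
move=> x x01; rewrite hornerMXaddC; apply: le_trans (ler_normD _ _) _.
rewrite lerD2r normrM -[K]mulr1; apply: ler_pM => //; first exact: H.
by rewrite ler_norml; lra.
Qed.

Lemma poly_lipschitz01 (R : realType) (p : {poly R}) :
  exists2 L, 0 <= L & forall x y, 0 <= x <= 1 -> 0 <= y <= 1 ->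
    `|p.[x] - p.[y]| <= L * `|x - y|.
Proof.
elim/poly_ind: p => [|p c [L L0 H]].
  by exists 0 => // x y _ _; rewrite !horner0 subrr normr0 mul0r.
have [K K0 B] := poly_bound01 p.
exists (L + K); first exact: addr_ge0.
move=> x y x01 y01; rewrite !hornerMXaddC.
have -> : p.[x] * x + c - (p.[y] * y + c) = (p.[x] - p.[y]) * x + p.[y] * (x - y) by ring.
apply: le_trans (ler_normD _ _) _; rewrite !normrM mulrDl.
apply: lerD; last by apply: ler_wpM2r => //; exact: B.
rewrite -[L * _]mulr1; apply: ler_pM => //; first exact: H.
by rewrite ler_norml; lra.
Qed.

Lemma finite_bound (T : finType) (R : realType) (P : T -> R -> Prop) :
  (forall z K K', K <= K' -> P z K -> P z K') ->
  (forall z, exists K, P z K) ->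
  exists2 K, 0 < K & forall z, P z K.
Proof.
move=> mono ex; pose f z := projT1 (cid (ex z)).
exists (1 + \sum_z `|f z|); first by rewrite ltr_pwDl // sumr_ge0.
move=> z; apply: (mono z (f z)); last exact: (projT2 (cid (ex z))).
rewrite (bigD1 z) //=; apply: le_trans (ler_norm _) _.
have : 0 <= \sum_(i | i != z) `|f i| by apply: sumr_ge0.
by lra.
Qed.

Definition specialize (R : realType) (l : seq ('I_4 * {poly R} * {poly R})) (x : R) :=
  [seq (t.1.1, t.1.2.[x], t.2.[x]) | t <- l].

(* Along the family the operator stays symmetric, and invertible with a uniform
   bound, so its signature cannot change. *)
Lemma pd_path (R : realType) (l : seq ('I_4 * {poly R} * {poly R})) (m : R) :
  0 < m ->
  (forall t, List.In t l -> forall x : R, 0 <= x <= 1 ->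
     m <= (t.1.2.[x] - t.2.[x]) ^+ 2 /\ m <= (t.1.2.[x] + t.2.[x]) ^+ 2) ->
  (forall x : R, 0 <= x <= 1 -> sym_fun (rprod (specialize l x) (@delta1 R))) ->
  forall x y : R, 0 <= x <= 1 -> 0 <= y <= 1 ->
  pd (rprod (specialize l x) (@delta1 R)) -> pd (rprod (specialize l y) (@delta1 R)).
Proof.
move=> m0 M S.
pose p z := rprod l (@delta1 _) z.
have E x z : rprod (specialize l x) (@delta1 R) z = (p z).[x].
  exact: (rprod_delta_morph (horner_eval x : {rmorphism {poly R} -> R})).
pose r x := rprod (specialize l x) (@delta1 R).
have [K K0 B] : exists2 K : R, 0 < K & forall (z : {perm f4root}) (x : R), 0 <= x <= 1 -> `|r x z| <= K.
  apply: (finite_bound (P := fun (z : {perm f4root}) (K : R) => forall x : R, 0 <= x <= 1 -> `|r x z| <= K)).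
    by move=> z K K' KK' H x x01; apply: le_trans KK'; exact: H.
  move=> z; have [K _ H] := poly_bound01 (p z); exists K => x x01; rewrite /r E; exact: H.
have [L L0 Lip] : exists2 L : R, 0 < L & forall (z : {perm f4root}) (x y : R), 0 <= x <= 1 -> 0 <= y <= 1 ->
    `|r x z - r y z| <= L * `|x - y|.
  apply: (finite_bound (P := fun (z : {perm f4root}) (L : R) => forall x y : R, 0 <= x <= 1 -> 0 <= y <= 1 ->
    `|r x z - r y z| <= L * `|x - y|)).
    move=> z K1 K2 KK' H x y x01 y01; apply: le_trans (H x y x01 y01) _.
    exact: ler_wpM2r.
  move=> z; have [L _ H] := poly_lipschitz01 (p z).
  by exists L => x y x01 y01; rewrite /r !E; exact: H.
have W0 : 0 < #|weyl|%:R :> R by rewrite ltr0n cardG_gt0.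
pose K' := K * #|weyl|%:R.
have K'0 : 0 < K' by rewrite mulr_gt0.
(* A spectral gap valid for the whole family: m to the number of factors bounds the squared operator
   from below, K' bounds the form from above. *)
pose g := m ^+ size l / K'.
have g0 : 0 < g by rewrite divr_gt0 // exprn_gt0.
have gap x a : 0 <= x <= 1 -> psd (r x) -> g * dotW a a <= quad (r x) a.
  move=> x01 P; apply: psd_gap => //; first exact: S.
    move=> b; apply: le_trans (ler_norm _) _; apply: quad_le => z _; exact: B.
  rewrite /r conv_opprod.
  have <- : size (specialize l x) = size l by rewrite size_map.
  apply: opprod_lower; first exact: ltW.
  move=> t Ht; have [t' In_t' ->] := In_map Ht; exact: M.
(* A displacement that changes the form by at most the gap cannot make it negative anywhere. *)
have next x y : 0 <= x <= 1 -> 0 <= y <= 1 -> L * `|x - y| * #|weyl|%:R <= g ->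
    psd (r x) -> psd (r y).
  move=> x01 y01 d P a.
  have := gap x a x01 P.
  have : `|quad (r x) a - quad (r y) a| <= L * `|x - y| * #|weyl|%:R * dotW a a.
    by rewrite quad_sub; apply: quad_le => z _; exact: Lip.
  rewrite ler_norml => /andP[_].
  have : L * `|x - y| * #|weyl|%:R * dotW a a <= g * dotW a a.
    by apply: ler_wpM2r => //; exact: dotW_ge0.
  by lra.
move=> x y x01 y01 Px.
suff Py : psd (r y).
  move=> a /dotW_gt0 a0; apply: lt_le_trans (gap y a y01 Py).
  exact: mulr_gt0.
(* The number of equal steps from x to y that makes each one short enough for [next]. *)
pose N := (Num.truncn (L * #|weyl|%:R / g)).+1.
have NP : L * #|weyl|%:R / g < N%:R.
  by apply: truncnS_gt.
have N0 : 0 < N%:R :> R by rewrite ltr0n.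
pose u k := x + (y - x) * (k%:R / N%:R).
have step k : (k <= N)%N -> 0 <= u k <= 1.
  move=> kN; have k01 : 0 <= (k%:R / N%:R : R) <= 1.
    by rewrite divr_ge0 // ler_pdivrMr // mul1r ler_nat.
  rewrite /u; move: (k%:R / N%:R) k01 => t t01.
  have -> : x + (y - x) * t = (1 - t) * x + t * y by ring.
  by nra.
suff H k : (k <= N)%N -> psd (r (u k)).
  by have := H N (leqnn N); rewrite /u divff ?gt_eqF // mulr1 addrC subrK.
elim: k => [|k IH] kN.
  rewrite /u mul0r mulr0 addr0 => a; have [Z|/existsNP[w /not_implyP[Ww aw]]] := pselect (forall w, w \in weyl -> a w = 0).
    by rewrite /quad /dotW big1 // => w Ww; rewrite Z // mul0r.
  by apply: ltW; apply: Px; exists w => //; apply/eqP.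
apply: (next (u k)); [exact: step (ltnW kN)|exact: step|  |exact: IH (ltnW kN)].
have -> : u k - u k.+1 = (x - y) / N%:R.
  by rewrite /u -natr1; field; rewrite gt_eqF.
rewrite normrM normfV (ger0_norm (ltW N0)).
have xy : `|x - y| <= 1 by rewrite ler_norml; lra.
move: NP; rewrite ltr_pdivrMr // => NP.
rewrite mulrA mulrAC ler_pdivrMr // mulrAC (mulrC g).
apply: le_trans (ltW NP); rewrite -[X in _ <= X]mulr1.
by apply: ler_wpM2l => //; apply: mulr_ge0; exact: ltW.
Qed.

(** * Deformations *)

Section Paths.
Variables (R : realType) (c : R).
Hypothesis c0 : 0 < c.

(* The Gram function of the invariant form when t = 1; t = 0 removes the short
   factors up to a positive constant. *)
Definition gram (t : R) (x : f4root -> R) : {perm f4root} -> R :=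
  rprod (tfactors 1 c t x coxeter_word) (@delta1 R).

Lemma char0_real : char0 R.
Proof. by move=> z z' /eqP; rewrite eqr_int => /eqP. Qed.

Lemma gram_sym t x : weight x -> sym_fun (gram t x).
Proof. by move=> X w Ww; exact: (rprod_tfactors_inv 1 c t char0_real X Ww). Qed.

(** An affine function with endpoint values of the same sign stays at least as far from 0 as the
    nearer endpoint. *)
Lemma affine_lower (u v : R) : 0 < u * v ->
  exists2 m, 0 < m & forall s, 0 <= s <= 1 -> m <= (u + s * (v - u)) ^+ 2.
Proof.
have H (a b s : R) : 0 < a * b -> a ^+ 2 <= b ^+ 2 -> 0 <= s ->
    a ^+ 2 <= (a + s * (b - a)) ^+ 2.
  move=> ab le s0; have ab' : a * a <= a * b.
    by move: le ab; rewrite !expr2; have [a0|a0|->] := ltgtP a 0 => ? ?; nra.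
  have : 0 <= s * (a * b - a * a) by apply: mulr_ge0 => //; rewrite subr_ge0.
  by have := sqr_ge0 (s * (b - a)); rewrite !expr2; nra.
move=> uv; have u0 : u != 0 by apply: contraTneq uv => ->; rewrite mul0r ltxx.
have v0 : v != 0 by apply: contraTneq uv => ->; rewrite mulr0 ltxx.
have [le|lt] := leP (u ^+ 2) (v ^+ 2).
  exists (u ^+ 2); first by rewrite exprn_even_gt0.
  by move=> s /andP[s0 _]; exact: H.
exists (v ^+ 2); first by rewrite exprn_even_gt0.
move=> s /andP[s0 s1].
have -> : u + s * (v - u) = v + (1 - s) * (u - v) by ring.
by apply: H; [rewrite mulrC|exact: ltW|rewrite subr_ge0].
Qed.

Lemma factors_lower (l : seq ('I_4 * {poly R} * {poly R})) :
  (forall t, List.In t l ->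
     [/\ (size t.1.2 <= 2)%N, (size t.2 <= 2)%N,
         0 < (t.1.2.[0] - t.2.[0]) * (t.1.2.[1] - t.2.[1])
       & 0 < (t.1.2.[0] + t.2.[0]) * (t.1.2.[1] + t.2.[1])]) ->
  exists2 m, 0 < m & forall t, List.In t l -> forall s : R, 0 <= s <= 1 ->
     m <= (t.1.2.[s] - t.2.[s]) ^+ 2 /\ m <= (t.1.2.[s] + t.2.[s]) ^+ 2.
Proof.
have aff (p : {poly R}) s : (size p <= 2)%N -> p.[s] = p.[0] + s * (p.[1] - p.[0]).
  move=> sp; rewrite !(horner_coef_wide _ sp) !big_ord_recl !big_ord0 /bump /=.
  by ring.
elim: l => [|t l IH] P; first by exists 1.
have [|m m0 M] := IH; first by move=> t' Ht'; apply: P; right.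
have [sp sq /affine_lower[m1 m10 M1] /affine_lower[m2 m20 M2]] := P t (or_introl erefl).
exists (Num.min m (Num.min m1 m2)); first by rewrite !lt_min m0 m10 m20.
move=> t' [<-|Ht'] s s01.
  rewrite !ge_min; split; apply/orP; right; apply/orP; [left|right].
    apply: le_trans (M1 s s01) _; rewrite (aff _ s sp) (aff _ s sq).
    by rewrite le_eqVlt; apply/orP; left; apply/eqP; congr (_ ^+ 2); ring.
  apply: le_trans (M2 s s01) _; rewrite (aff _ s sp) (aff _ s sq).
  by rewrite le_eqVlt; apply/orP; left; apply/eqP; congr (_ ^+ 2); ring.
by have [A B] := M t' Ht' s s01; rewrite !ge_min A B.
Qed.

Lemma gram_path (t : {poly R}) (x : f4root -> {poly R}) (s s' : R) :
  let l := tfactors 1 c%:P t x coxeter_word in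
  (forall s : R, weight (fun b => (x b).[s])) ->
  (forall b, is_long b -> [/\ (size (x b) <= 2)%N,
     0 < (1 - (x b).[0]) * (1 - (x b).[1]) & 0 < (1 + (x b).[0]) * (1 + (x b).[1])]) ->
  (forall b, ~~ is_long b -> [/\ (size (t * x b)%R <= 2)%N,
     0 < (c - (t * x b).[0]) * (c - (t * x b).[1])
     & 0 < (c + (t * x b).[0]) * (c + (t * x b).[1])]) ->
  0 <= s <= 1 -> 0 <= s' <= 1 ->
  pd (gram t.[s] (fun b => (x b).[s])) -> pd (gram t.[s'] (fun b => (x b).[s'])).
Proof.
move=> l X L Sh s01 s'01.
have E u : gram t.[u] (fun b => (x b).[u]) = rprod (specialize l u) (@delta1 R).
  rewrite /gram /specialize /l /tfactors; move: (betaseq coxeter_word) => bs.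
  rewrite -map_comp; congr (rprod _ _); apply: eq_map => jb; rewrite [RHS]/=.
  rewrite /by_length; case: ifP => _; congr (_, _, _);
    by rewrite ?hornerC ?hornerM ?hornerC.
(* The root paired with a letter is a W-image of that simple root, so the coefficients p and q of a
   factor belong to the same length. *)
have lenE jb : List.In jb (betaseq coxeter_word) ->
    is_long (simple jb.1) = is_long jb.2.
  elim: coxeter_word jb => [|i w IH] jb; first by [].
  rewrite /= => -[<- //|Hj]; have [jb' In' ->] := In_map Hj.
  rewrite [LHS]/= [RHS]/= (weyl_long _ (simple_weyl i)); exact: IH.
have [m m0 M] : exists2 m, 0 < m & forall t, List.In t l -> forall s : R, 0 <= s <= 1 ->
     m <= (t.1.2.[s] - t.2.[s]) ^+ 2 /\ m <= (t.1.2.[s] + t.2.[s]) ^+ 2.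
  rewrite /l /tfactors; apply: factors_lower => u Hu; have [jb In ->] := In_map Hu.
  have J := lenE _ In; rewrite [_.1.2]/= [_.2]/=.
  rewrite /by_length J; case: ifP => [Lb|/negbT Lb].
    have [A B C] := L _ Lb.
    by rewrite mul1r size_poly1 !hornerC.
  have [A B C] := Sh _ Lb; split=> //.
  - exact: leq_trans (size_polyC_leq1 _) _.
  - by rewrite !hornerC.
  - by rewrite !hornerC.
rewrite (E s) (E s'); apply: (@pd_path R l m m0 M _ s s' s01 s'01) => u _.
by have := @gram_sym t.[u] _ (X u); rewrite (E u).
Qed.

(** The long factors stay fixed. The short ones have c + s x(b) and c - s x(b) positive at both
    ends, since the bound x(b) < c also holds at -b. *)
Lemma gram_path_t x s s' : weight x ->
  (forall b, is_long b -> x b != 1) -> (forall b, ~~ is_long b -> x b < c) ->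
  0 <= s <= 1 -> 0 <= s' <= 1 -> pd (gram s x) -> pd (gram s' x).
Proof.
move=> X L Sh s01 s'01.
have Xo b := weight_opp b X.
have Lo b : is_long (oppr_root b) = is_long b by rewrite -srefl_self weyl_long ?srefl_weyl.
have := @gram_path 'X (fun b => (x b)%:P) s s'; rewrite /= !hornerX.
have E u : (fun b => (x b)%:P.[u]) = x by apply/funext => b; rewrite hornerC.
rewrite !E; apply => //.
- by move=> u; rewrite E.
- move=> b Lb; rewrite !hornerC; split.
  + exact: leq_trans (size_polyC_leq1 _) _.
  + by rewrite -expr2 exprn_even_gt0 //= subr_eq0 eq_sym L.
  + rewrite -expr2 exprn_even_gt0 //= -[x b]opprK -Xo subr_eq0 eq_sym L // Lo //.
- move=> b Lb; rewrite !hornerM !hornerX !hornerC mul0r mul1r subr0 addr0; split.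
  + by rewrite mulrC mul_polyC (leq_trans (size_scale_leq _ _)) ?size_polyX.
  + by rewrite mulr_gt0 // subr_gt0 Sh.
  + by rewrite mulr_gt0 // -[x b]opprK -Xo subr_gt0 Sh // Lo.
Qed.

(** At t = 0 the short factors are the constant c, and on the segment from x to y no long root
    reaches 1 or -1. *)
Lemma gram_path_x (x y : f4root -> R) : weight x -> weight y ->
  (forall b, is_long b -> [/\ x b != 1, y b != 1 & (x b < 1) = (y b < 1)]) ->
  pd (gram 0 x) -> pd (gram 0 y).
Proof.
move=> X Y L.
have Xo b := weight_opp b X; have Yo b := weight_opp b Y.
have Lo b : is_long (oppr_root b) = is_long b by rewrite -srefl_self weyl_long ?srefl_weyl.
have := @gram_path 0 (fun b => (x b)%:P + (y b - x b)%:P * 'X) 0 1.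
rewrite /= !horner0.
have Eu b u : ((x b)%:P + (y b - x b)%:P * 'X).[u] = x b + (y b - x b) * u.
  by rewrite hornerD hornerM hornerX !hornerC.
have E0 : (fun b => ((x b)%:P + (y b - x b)%:P * 'X).[0]) = x.
  by apply/funext => b; rewrite Eu; ring.
have E1 : (fun b => ((x b)%:P + (y b - x b)%:P * 'X).[1]) = y.
  by apply/funext => b; rewrite Eu; ring.
rewrite E0 E1; apply => //.
- by move=> u a b; rewrite !Eu X Y; move: (cart b a) => n; ring.
- have same u v : u != 1 -> v != 1 -> (u < 1) = (v < 1) -> 0 < (1 - u) * (1 - v) :> R.
    move=> u1 v1; have [lu|lu|/eqP] := ltgtP u 1; last by rewrite (negPf u1).
      by move=> /esym lv; rewrite mulr_gt0 ?subr_gt0.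
    have [lv|lv|/eqP] := ltgtP v 1 => //; last by rewrite (negPf v1).
    by move=> _; rewrite nmulr_rgt0 subr_lt0.
  move=> b Lb; have := L b Lb; have := L (oppr_root b); rewrite Lo Lb Xo Yo.
  move=> /(_ isT)[A B C] [A' B' C'].
  have -> : ((x b)%:P + (y b - x b)%:P * 'X).[0] = x b by rewrite Eu; ring.
  have -> : ((x b)%:P + (y b - x b)%:P * 'X).[1] = y b by rewrite Eu; ring.
  split; [|exact: same|].
    apply: leq_trans (size_polyD _ _) _; rewrite geq_max.
    rewrite (leq_trans (size_polyC_leq1 _)) //=.
    by rewrite mul_polyC (leq_trans (size_scale_leq _ _)) ?size_polyX.
  by rewrite -[x b]opprK -[y b]opprK; exact: same.
- move=> b _; rewrite mul0r size_poly0 !horner0 subr0 addr0; split=> //; exact: mulr_gt0.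
- by rewrite lexx ler01.
- by rewrite lexx ler01.
Qed.

End Paths.

(** * Elements of the group algebra of S_3 *)

Lemma simple_long (i : 'I_4) : is_long (simple i) = (i < 2)%N.
Proof.
Transparent simple.
by rewrite /is_long /= dotv4 !mxE; move: i; apply: ord4P.
Opaque simple.
Qed.

Definition sa : {perm f4root} := srefl (simple 0).
Definition sb : {perm f4root} := srefl (simple 1).

Lemma sa_weyl : sa \in weyl. Proof. exact: simple_weyl. Qed.
Lemma sb_weyl : sb \in weyl. Proof. exact: simple_weyl. Qed.

Lemma braid_ab : (sb * (sa * sb) = sa * (sb * sa))%g.
Proof.
apply/permP => b; rewrite !permM; apply: coords_inj; rewrite !coords_srefl.
pose P t := zrefl 1 (zrefl 0 (zrefl 1 t)) == zrefl 0 (zrefl 1 (zrefl 0 t)).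
have F : all P root_coords by vm_compute.
exact/eqP/(coords_all F b).
Qed.

Lemma sa_saK v : (sa * (sa * v) = v)%g.
Proof. by rewrite mulgA sreflM mul1g. Qed.

Lemma sb_sbK v : (sb * (sb * v) = v)%g.
Proof. by rewrite mulgA sreflM mul1g. Qed.

Lemma braid_abl v : (sb * (sa * (sb * v)) = sa * (sb * (sa * v)))%g.
Proof. by have := congr1 (fun w => w * v)%g braid_ab; rewrite /= -!mulgA. Qed.

Lemma sa_sa : (sa * sa = 1)%g. Proof. exact: sreflM. Qed.
Lemma sb_sb : (sb * sb = 1)%g. Proof. exact: sreflM. Qed.

(** The braid relation is oriented towards sa sb sa, so rewriting brings right-associated words to
    six normal forms. *)
Definition s3E := (sa_saK, sb_sbK, braid_abl, sa_sa, sb_sb, braid_ab, @mulg1 {perm f4root}, @mul1g {perm f4root}).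

(* Elements of the group algebra of <sa, sb> = S_3, as coefficients on
   1, sa, sb, sa sb, sb sa, sa sb sa. *)
Definition six (D : Type) : Type := (D * D * D * D * D * D)%type.

Definition comb (D : pzRingType) (u : six D) (w : {perm f4root}) : D :=
  let: (u0, u1, u2, u3, u4, u5) := u in
  u0 * (w == 1%g)%:R + u1 * (w == sa)%:R + u2 * (w == sb)%:R
  + u3 * (w == sa * sb)%g%:R + u4 * (w == sb * sa)%g%:R
  + u5 * (w == sa * (sb * sa))%g%:R.

Definition stepa (D : pzRingType) (p q : D) (u : six D) : six D :=
  let: (u0, u1, u2, u3, u4, u5) := u in
  (p * u0 + q * u1, p * u1 + q * u0, p * u2 + q * u4,
   p * u3 + q * u5, p * u4 + q * u2, p * u5 + q * u3).

Definition stepb (D : pzRingType) (p q : D) (u : six D) : six D :=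
  let: (u0, u1, u2, u3, u4, u5) := u in
  (p * u0 + q * u2, p * u1 + q * u3, p * u2 + q * u0,
   p * u3 + q * u1, p * u4 + q * u5, p * u5 + q * u4).

Lemma eq_mul_invol (v w s : {perm f4root}) : (s * s = 1)%g ->
  ((w * s)%g == v) = (w == v * s)%g.
Proof.
move=> ss; apply/eqP/eqP => [<-|->]; by rewrite -mulgA ss mulg1.
Qed.

Lemma comb_stepa (D : comPzRingType) (p q : D) u w :
  p * comb u w + q * comb u (w * sa)%g = comb (stepa p q u) w.
Proof.
case: u => [[[[[u0 u1] u2] u3] u4] u5]; rewrite /comb /stepa.
rewrite !(eq_mul_invol _ _ sa_sa) -!mulgA !s3E; ring.
Qed.

Lemma comb_stepb (D : comPzRingType) (p q : D) u w :
  p * comb u w + q * comb u (w * sb)%g = comb (stepb p q u) w.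
Proof.
case: u => [[[[[u0 u1] u2] u3] u4] u5]; rewrite /comb /stepb.
rewrite !(eq_mul_invol _ _ sb_sb) -!mulgA !s3E; ring.
Qed.

Lemma comb_delta (D : pzRingType) : comb (1, 0, 0, 0, 0, 0) = @delta1 D.
Proof. by apply/funext => w; rewrite /comb !mul0r !addr0 mul1r. Qed.

Definition six_map (D E : Type) (f : D -> E) (u : six D) : six E :=
  let: (u0, u1, u2, u3, u4, u5) := u in (f u0, f u1, f u2, f u3, f u4, f u5).

Definition zdot (s t : zvec) : int :=
  let: (a, b, c, d) := s in let: (a', b', c', d') := t in
  a * a' + b * b' + c * c' + d * d'.

Arguments zdot : simpl never.

(* Binary integers, since the coefficients at the sample points are large. *)
Fixpoint run6 (n : zvec) (d : int) (l : seq (nat * zvec)) (u : six BinNums.Z) : six BinNums.Z :=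
  if l is (i, z) :: l' then
    let p := Z_of_int d in let q := Z_of_int (zdot z n) in
    run6 n d l' (if i == 0%N then stepa p q u else if i == 1%N then stepb p q u else u)
  else u.

Definition ringZ (R : pzRingType) (z : BinNums.Z) : R := (int_of_Z z)%:~R.

Lemma ringZD (R : pzRingType) : {morph @ringZ R : a b / a + b}.
Proof. by move=> a b; rewrite /ringZ rmorphD intrD. Qed.

Lemma ringZM (R : pzRingType) : {morph @ringZ R : a b / a * b}.
Proof. by move=> a b; rewrite /ringZ rmorphM intrM. Qed.

(** With p = 1 and q = 0 the short factors are the identity, so [run6] skips the letters 2 and 3. *)
Lemma rprod_comb (R : comPzRingType) n d bs u w :
  rprod [seq (jb.1, by_length (d%:~R : R) 1 (simple jb.1),
              by_length (zdot (coords jb.2) n)%:~R 0 (simple jb.1)) | jb <- bs]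
    (comb (six_map (@ringZ R) u)) w =
  comb (six_map (@ringZ R) (run6 n d [seq (val jb.1, coords jb.2) | jb <- bs] u)) w.
Proof.
elim: bs u => [//|[i b] bs IH] u; rewrite [map _ _]/= [run6 _ _ _ _]/= -IH.
rewrite {1}/rprod -/rprod; apply: eq_rprod => v.
have Zd z : z%:~R = ringZ R (Z_of_int z) by rewrite /ringZ Z_of_intK.
rewrite /by_length simple_long !Zd.
set p := Z_of_int d; set q := Z_of_int (zdot _ _).
move: i @p @q; apply: ord4P => p q; rewrite /=.
- rewrite comb_stepa; congr (comb _ v).
  by case: u => [[[[[u0 u1] u2] u3] u4] u5]; rewrite /= !ringZD !ringZM.
- rewrite comb_stepb; congr (comb _ v).
  by case: u => [[[[[u0 u1] u2] u3] u4] u5]; rewrite /= !ringZD !ringZM.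
- by rewrite mul1r mul0r addr0.
- by rewrite mul1r mul0r addr0.
Qed.

(** * Definiteness tested in the representations of S_3 *)

Section Definiteness.
Variable R : realType.

Lemma conv_comb (u : six R) a y : convolution (comb u) a y =
  let: (u0, u1, u2, u3, u4, u5) := u in
  u0 * a y + u1 * a (y * sa)%g + u2 * a (y * sb)%g + u3 * a (y * (sa * sb))%g
  + u4 * a (y * (sb * sa))%g + u5 * a (y * (sa * (sb * sa)))%g.
Proof.
have I (v : R) g : g \in weyl -> \sum_(z in weyl) v * (z == g)%:R * a (y * z)%g = v * a (y * g)%g.
  move=> Wg; rewrite (bigD1 g) //= eqxx mulr1 big1 ?addr0 // => z /andP[_ /negPf ->].
  by rewrite mulr0 mul0r.
have Wa := sa_weyl; have Wb := sb_weyl.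
case: u => [[[[[u0 u1] u2] u3] u4] u5]; rewrite /convolution /comb.
under eq_bigr => z _ do rewrite !mulrDl.
by rewrite !big_split /= !I ?groupM ?group1 // mulg1.
Qed.

Definition q6 (r u : six R) : R :=
  let: (r0, r1, r2, r3, r4, r5) := r in let: (u0, u1, u2, u3, u4, u5) := u in
  u0 * (r0 * u0 + r1 * u1 + r2 * u2 + r3 * u3 + r4 * u4 + r5 * u5)
  + u1 * (r0 * u1 + r1 * u0 + r2 * u3 + r3 * u2 + r4 * u5 + r5 * u4)
  + u2 * (r0 * u2 + r1 * u4 + r2 * u0 + r3 * u5 + r4 * u1 + r5 * u3)
  + u3 * (r0 * u3 + r1 * u5 + r2 * u1 + r3 * u4 + r4 * u0 + r5 * u2)
  + u4 * (r0 * u4 + r1 * u2 + r2 * u5 + r3 * u0 + r4 * u3 + r5 * u1)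
  + u5 * (r0 * u5 + r1 * u3 + r2 * u4 + r3 * u1 + r4 * u2 + r5 * u0).

Definition orbit6 (a : {perm f4root} -> R) y : six R :=
  (a y, a (y * sa)%g, a (y * sb)%g, a (y * (sa * sb))%g, a (y * (sb * sa))%g,
   a (y * (sa * (sb * sa)))%g).

(** The form splits over the cosets y S_3; summing over all y counts each coset six times. *)
Lemma quad_comb (r : six R) a : 6 * quad (comb r) a = \sum_(y in weyl) q6 r (orbit6 a y).
Proof.
have Wa := sa_weyl; have Wb := sb_weyl.
pose F y := a y * convolution (comb r) a y.
have sh g : g \in weyl -> quad (comb r) a = \sum_(y in weyl) F (y * g)%g.
  move=> Wg; rewrite /quad /dotW (reindex_inj (mulIg g)).
  by apply: eq_bigl => y; rewrite groupMr.
transitivity (\sum_(y in weyl) F (y * 1)%g + \sum_(y in weyl) F (y * sa)%g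
  + \sum_(y in weyl) F (y * sb)%g + \sum_(y in weyl) F (y * (sa * sb))%g
  + \sum_(y in weyl) F (y * (sb * sa))%g + \sum_(y in weyl) F (y * (sa * (sb * sa)))%g).
  by rewrite -!sh ?groupM ?group1 //; ring.
rewrite -!big_split; apply: eq_bigr => y _ /=.
rewrite /F !conv_comb /orbit6 /q6 {sh F}; case: r => [[[[[r0 r1] r2] r3] r4] r5].
rewrite -!mulgA !s3E.
by move: (a _) (a _) (a _) (a _) (a _) (a _) => *; ring.
Qed.

(* Positivity in the trivial and sign representations of S_3, then positive trace
   and determinant in the 2-dimensional one. *)
Definition good6 (D : numDomainType) (r : six D) : bool :=
  let: (r0, r1, r2, r3, r4, r5) := r in
  [&& r3 == r4, 0 < r0 + r1 + r2 + r3 + r4 + r5, 0 < r0 - r1 - r2 + r3 + r4 - r5,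
      0 < r0 - r3
    & r1 * r1 + r2 * r2 + r5 * r5 - r1 * r2 - r1 * r5 - r2 * r5 < (r0 - r3) * (r0 - r3)].

(** The inequality between arithmetic and geometric means gives 2|B| <= d (p + p'); as en < d^2,
    equality forces p p' = 0, then p + p' = 0. It serves the two-dimensional representation of
    S_3. *)
Lemma binary_form_ge0 (d en B p p' : R) :
  0 < d -> en < d * d -> B * B <= en * (p * p') -> 0 <= p -> 0 <= p' ->
  0 <= d * (p + p') + 2 * B /\ (d * (p + p') + 2 * B = 0 -> p = 0).
Proof.
move=> D en1 BE p0 p'0.
have H : (2 * B) ^+ 2 <= 4 * (en * (p * p')) by rewrite expr2; lra.
have pp : 0 <= p * p' by exact: mulr_ge0.
have s0 : 0 <= d * (p + p') by rewrite mulr_ge0 ?addr_ge0 // ltW.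
have K : 4 * (en * (p * p')) <= (d * (p + p')) ^+ 2.
  have : 0 <= (d * d - en) * (p * p') by apply: mulr_ge0 => //; rewrite subr_ge0 ltW.
  have : 0 <= (d * (p - p')) ^+ 2 by exact: sqr_ge0.
  by rewrite !expr2; nra.
have N : `|2 * B| <= d * (p + p').
  by rewrite -ler_sqr ?nnegrE // -normrX ger0_norm ?sqr_ge0 //; lra.
split; first by move: N; rewrite ler_norml => /andP[]; lra.
move=> Z; have B2 : (2 * B) ^+ 2 = (d * (p + p')) ^+ 2.
  have -> : 2 * B = - (d * (p + p')) by lra.
  by rewrite sqrrN.
have Q : 0 <= (d * (p - p')) ^+ 2 by exact: sqr_ge0.
have pz : p * p' = 0.
  apply/eqP; rewrite eq_le pp andbT leNgt; apply/negP => pp0.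
  have : 0 < (d * d - en) * (p * p') by apply: mulr_gt0 => //; rewrite subr_gt0.
  by move: H B2 Q; rewrite !expr2; nra.
have : (d * (p + p')) ^+ 2 <= 0 by move: H; rewrite pz mulr0 mulr0 B2.
rewrite -B2 B2 => Z2.
have : d * (p + p') = 0 by apply/eqP; rewrite -sqrf_eq0 eq_le Z2 sqr_ge0.
by move/eqP; rewrite mulf_eq0 gt_eqF //= => /eqP; lra.
Qed.

(** Decomposition over the representations of S_3. Strictness at u0 suffices, because the first
    entry of [orbit6 a w] is a(w). *)
Lemma q6_good (r u : six R) : good6 r ->
  0 <= q6 r u /\ (u.1.1.1.1.1 != 0 -> 0 < q6 r u).
Proof.
case: r => [[[[[r0 r1] r2] r3] r4] r5]; case: u => [[[[[u0 u1] u2] u3] u4] u5].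
case/and5P => /eqP <- T G D E; rewrite /q6 /=.
set e := u0 + u3 + u4; set o := u1 + u2 + u5.
pose p := (u0 * u0 + u3 * u3 + u4 * u4) - e * e / 3.
pose p' := (u1 * u1 + u2 * u2 + u5 * u5) - o * o / 3.
pose n1 := u0 * u1 + u3 * u5 + u4 * u2 - e * o / 3.
pose n2 := u0 * u2 + u3 * u1 + u4 * u5 - e * o / 3.
pose al := r1 - r5; pose be := r2 - r5.
pose B := al * n1 + be * n2.
set q := (X in 0 <= X).
(* The trivial, sign and two-dimensional parts; e and o sum over even and odd elements, p and p' are
   the squared norms of the remaining sum-zero vectors. *)
have qE : q = (r0 + r1 + r2 + r3 + r3 + r5) / 6 * (e + o) ^+ 2
            + (r0 - r1 - r2 + r3 + r3 - r5) / 6 * (e - o) ^+ 2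
            + ((r0 - r3) * (p + p') + 2 * B).
  by rewrite /q /B /n1 /n2 /p /p' /al /be /e /o; field.
have p0 : 0 <= p.
  have -> : p = ((u0 - u3) ^+ 2 + (u0 - u4) ^+ 2 + (u3 - u4) ^+ 2) / 3.
    by rewrite /p /e; field.
  by rewrite divr_ge0 // !addr_ge0 ?sqr_ge0.
have p'0 : 0 <= p'.
  have -> : p' = ((u1 - u2) ^+ 2 + (u1 - u5) ^+ 2 + (u2 - u5) ^+ 2) / 3.
    by rewrite /p' /o; field.
  by rewrite divr_ge0 // !addr_ge0 ?sqr_ge0.
pose en := al * al + be * be - al * be.
(* Sum-zero vectors of length 3 form a plane, so the pairings n1 and n2 determine p p'; the defect
   in the inequality is then an explicit square. *)
have BE : B * B <= en * (p * p').
  have -> : p * p' = 4 / 3 * (n1 * n1 + n1 * n2 + n2 * n2).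
    by rewrite /p /p' /n1 /n2 /e /o; field.
  rewrite -subr_ge0.
  have -> : en * (4 / 3 * (n1 * n1 + n1 * n2 + n2 * n2)) - B * B =
     (al * n1 + 2 * (al * n2) - 2 * (be * n1) - be * n2) ^+ 2 / 3.
    by rewrite /en /B; field.
  by rewrite divr_ge0 // sqr_ge0.
have en1 : en < (r0 - r3) * (r0 - r3).
  by apply: le_lt_trans E; rewrite le_eqVlt; apply/orP; left; apply/eqP; rewrite /en /al /be; ring.
have main := binary_form_ge0 D en1 BE p0 p'0.
have T0 : 0 <= (r0 + r1 + r2 + r3 + r3 + r5) / 6 * (e + o) ^+ 2.
  by rewrite mulr_ge0 ?sqr_ge0 // divr_ge0 // ltW.
have G0 : 0 <= (r0 - r1 - r2 + r3 + r3 - r5) / 6 * (e - o) ^+ 2.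
  by rewrite mulr_ge0 ?sqr_ge0 // divr_ge0 // ltW.
have [M1 M2] := main.
have q0 : 0 <= q by rewrite qE; apply: addr_ge0 => //; exact: addr_ge0.
split=> // un; suff qn : q != 0 by change (0 < q); rewrite lt_neqAle eq_sym qn.
rewrite qE.
apply: contra un => /eqP Z.
have Z1 : (r0 - r3) * (p + p') + 2 * B = 0 by lra.
have Z2 : (r0 + r1 + r2 + r3 + r3 + r5) / 6 * (e + o) ^+ 2 = 0 by lra.
have Z3 : (r0 - r1 - r2 + r3 + r3 - r5) / 6 * (e - o) ^+ 2 = 0 by lra.
have {}Z2 : e + o = 0.
  by apply/eqP; move/eqP: Z2; rewrite mulf_eq0 sqrf_eq0 gt_eqF //= divr_gt0.
have {}Z3 : e - o = 0.
  by apply/eqP; move/eqP: Z3; rewrite mulf_eq0 sqrf_eq0 gt_eqF //= divr_gt0.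
have e0 : e = 0 by lra.
have pz := M2 Z1.
have : u0 * u0 + u3 * u3 + u4 * u4 = 0 by move: pz; rewrite /p e0 mul0r mul0r subr0.
have := sqr_ge0 u3; have := sqr_ge0 u4; have := sqr_ge0 u0; rewrite !expr2 => *.
by rewrite -sqrf_eq0 expr2; apply/eqP; lra.
Qed.

Lemma pd_comb (r : six R) : good6 r -> pd (comb r).
Proof.
move=> G a [w Ww aw]; have : 0 < 6 * quad (comb r) a; last by lra.
rewrite quad_comb (bigD1 w) //=; apply: ltr_pwDl.
  by have [_] := q6_good (orbit6 a w) G; apply.
by apply: sumr_ge0 => y _; have [] := q6_good (orbit6 a y) G.
Qed.

(** A negative value in the sign representation, or a negative trace in the two-dimensional one. *)
Definition bad6 (D : numDomainType) (r : six D) : bool :=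
  let: (r0, r1, r2, r3, r4, r5) := r in
  (r0 - r1 - r2 + r3 + r4 - r5 < 0) || (2 * r0 - r3 - r4 < 0).

(** S_3 acts simply transitively on the six roots of A_2, so the image of one root separates its
    elements. *)
Lemma uniq_six : uniq [:: 1%g; sa; sb; (sa * sb)%g; (sb * sa)%g; (sa * (sb * sa))%g].
Proof.
apply: (@map_uniq _ _ (fun w : {perm f4root} => coords (w (simple 0)))).
by rewrite /= !permM perm1 !coords_srefl !coords_simple; vm_compute.
Qed.

Lemma comb_orbit6 (u : six R) : orbit6 (comb u) 1%g = u.
Proof.
have := uniq_six; rewrite /= !inE !negb_or.
case/and5P => /and5P[a1 a2 a3 a4 a5] /and4P[b1 b2 b3 b4] /and3P[c1 c2 c3] /andP[d1 d2] /andP[e1 _].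
have F (v w : {perm f4root}) : v != w -> ((v == w) = false) * ((w == v) = false).
  by move=> N; rewrite (negPf N) eq_sym (negPf N).
case: u => [[[[[u0 u1] u2] u3] u4] u5]; rewrite /orbit6 /comb !mul1g !eqxx.
rewrite !(F _ _ a1, F _ _ a2, F _ _ a3, F _ _ a4, F _ _ a5, F _ _ b1, F _ _ b2, F _ _ b3).
rewrite !(F _ _ b4, F _ _ c1, F _ _ c2, F _ _ c3, F _ _ d1, F _ _ d2, F _ _ e1).
by rewrite !(mulr0, mulr1, addr0, add0r).
Qed.

Lemma not_pd_comb (r : six R) : bad6 r -> ~ pd (comb r).
Proof.
move=> B P.
have Wa := sa_weyl; have Wb := sb_weyl.
have Q (u : six R) : quad (comb r) (comb u) = q6 r u.
  rewrite /quad dotWC; set b := convolution _ _.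
  have -> : dotW b (comb u) = convolution (comb u) b 1%g.
    by apply: eq_bigr => z _; rewrite mul1g mulrC.
  rewrite conv_comb /b !conv_comb; move: (comb_orbit6 u).
  case: r {B P b} => [[[[[r0 r1] r2] r3] r4] r5].
  case: u => [[[[[u0 u1] u2] u3] u4] u5] /=.
  rewrite /orbit6 !mul1g -!mulgA !s3E => -[-> -> -> -> -> ->].
  by ring.
have pos (u : six R) : comb u 1%g != 0 -> 0 < q6 r u.
  by move=> u1; rewrite -Q; apply: P; exists 1%g.
have val1 (u : six R) : comb u 1%g = u.1.1.1.1.1.
  by have := congr1 (fun v : six R => v.1.1.1.1.1) (comb_orbit6 u).
(* The sign character, then 1 - sa sb: their values are 6 times and exactly 1 times the two
   expressions in [bad6]. *)
have := pos (1, -1, -1, 1, 1, -1); rewrite val1 oner_neq0 => /(_ isT).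
have := pos (1, 0, 0, -1, 0, 0); rewrite val1 oner_neq0 => /(_ isT).
case: r {P Q pos} B => [[[[[r0 r1] r2] r3] r4] r5] /orP; rewrite /q6 => -[]; lra.
Qed.

Lemma ringZ_lt (a b : BinNums.Z) : (ringZ R a < ringZ R b) = (a < b).
Proof. by rewrite /ringZ ltr_int; apply/idP/idP; lia. Qed.

Lemma ringZN : {morph @ringZ R : a / - a}.
Proof. by move=> a; rewrite /ringZ rmorphN mulrNz. Qed.

Lemma good6_ringZ (r : six BinNums.Z) : good6 r -> good6 (six_map (@ringZ R) r).
Proof.
have ringZ0 : ringZ R 0 = 0 by [].
case: r => [[[[[r0 r1] r2] r3] r4] r5] /and5P[/eqP -> T G D E]; rewrite /= eqxx /=.
move: T G D E; rewrite -!ringZ_lt !(ringZD, ringZN, ringZM) ringZ0.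
by move=> -> -> -> ->.
Qed.

Lemma bad6_ringZ (r : six BinNums.Z) : bad6 r -> bad6 (six_map (@ringZ R) r).
Proof.
have ringZ0 : ringZ R 0 = 0 by [].
have ringZ1 : ringZ R 1 = 1 by [].
case: r => [[[[[r0 r1] r2] r3] r4] r5]; rewrite /bad6 /=.
by rewrite -!ringZ_lt !(ringZD, ringZN, ringZM) ringZ0 ringZ1.
Qed.

End Definiteness.

(** * The graded Hecke algebra *)

Lemma dotv_rootv (K : numFieldType) (a b : f4root) :
  dotv (rootv K a) (rootv K b) = (dotv (val a) (val b))%:~R.
Proof. by rewrite !dotv4 !mxE !rmorphD !rmorphM. Qed.

Lemma coroot_rootv (K : numFieldType) (a b : f4root) :
  coroot a (rootv K b) = (cart b a)%:~R.
Proof.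
rewrite /coroot !dotv_rootv; apply: (mulIf (x := (dotv (val a) (val a))%:~R)).
  by rewrite intr_eq0 dotv_root_neq0.
rewrite mulfVK ?intr_eq0 ?dotv_root_neq0 // -intrM -cartE intrM //.
Qed.

Definition root_weight (K : fieldType) (nu : 'rV[K]_4) (b : f4root) : K :=
  dotv (rootv K b) nu.

Lemma root_weightP (K : numFieldType) (nu : 'rV[K]_4) : weight (root_weight nu).
Proof.
by move=> a b; rewrite /root_weight rootv_srefl /refl coroot_rootv dotvB.
Qed.

Section Hecke.
Local Open Scope complex_scope.
Local Open Scope ring_scope.

Lemma conj_realC (K : rcfType) (r : K) : (r%:C)^* = r%:C.
Proof. by apply/CrealP; rewrite complex_real. Qed.

Variable R : realType.
Local Notation C := R[i].
Local Notation S := (mpoly.mpoly 4 C).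
Variables (c : R) (H : gradedHecke c).
Local Notation t := (hecke_t H).
Local Notation hS := (hecke_S H).
Local Notation star := (@hecke_star R c H).

Definition parC (e : f4root) : C := (cpar c e)%:C.

Definition omega (b : f4root) : H := hS (linform (rootv C b)).

(** Iterating the cross relation collects one correction per inversion of w. Adding a letter s_a on
    the left carries the inversions by s_a, up to a itself, whose term accounts for the scalar in
    the cross relation. *)
Lemma omega_t w b : w \in weyl ->
  omega b * t w = t w * omega (w b) +
    \sum_(e | pos e && ~~ pos (w e)) (parC e * (cart b e)%:~R) *: t (srefl e * w)%g.
Proof.
move=> Ww; move: w Ww b; apply: weyl_ind_l => [|w i Ww IH] b.
  rewrite hecke_t1 mulr1 mul1r perm1 big1 ?addr0 // => e.
  by rewrite perm1; case: pos.
have Ws := simple_weyl i.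
have cross : omega b * t (srefl (simple i)) =
    t (srefl (simple i)) * omega (srefl (simple i) b)
    + (parC (simple i) * (cart b (simple i))%:~R)%:A.
  have := hecke_cross H i (rootv C b); cbv zeta; rewrite -rootv_srefl coroot_rootv; exact: id.
have Ps := @pos_srefl_sum H i (fun e => ~~ pos (w e)).
move: (simple i) Ws cross Ps => a Ws cross Ps.
rewrite hecke_tM // mulrA cross mulrDl -mulrA IH mulrDr mulrA permM -addrA.
congr (_ + _).
pose f e : H := (parC e * (cart (srefl a b) e)%:~R) *: t (srefl a * (srefl e * w))%g.
have -> : t (srefl a) * (\sum_(e | pos e && ~~ pos (w e))
    (parC e * (cart (srefl a b) e)%:~R) *: t (srefl e * w)%g) =
    \sum_(e | pos e && ~~ pos (w e)) f e.
  rewrite mulr_sumr; apply: eq_bigr => e _.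
  by rewrite -scalerAr -hecke_tM ?groupM ?srefl_weyl.
rewrite [in RHS](reindex_inj (@perm_inj _ (srefl a))).
have -> : \sum_(j | pos (srefl a j) && ~~ pos ((srefl a * w)%g (srefl a j)))
    (parC (srefl a j) * (cart b (srefl a j))%:~R) *: t (srefl (srefl a j) * (srefl a * w))%g
    = \sum_(e | pos (srefl a e) && ~~ pos (w e)) f e.
  apply: eq_big => [e|e _]; first by rewrite permM srefl_invol.
  have -> : cart b (srefl a e) = cart (srefl a b) e.
    by rewrite -{2}[e](srefl_invol a) cart_srefl.
  rewrite /f.
  have -> : parC (srefl a e) = parC e by rewrite /parC /cpar weyl_long.
  by rewrite [X in t X]mulgA (weyl_sreflC (srefl a e) Ws) srefl_invol -mulgA.
rewrite Ps; last by move=> e; rewrite weyl_opp // pos_opp.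
have fa : f a = - ((parC a * (cart b a)%:~R) *: t w).
  rewrite /f mulgA sreflM mul1g.
  have -> : cart (srefl a b) a = - cart b a.
    have := cart_srefl a (oppr_root a) b.
    by rewrite cart_opp weyl_opp // srefl_self oppr_rootK.
  by rewrite rmorphN mulrN scaleNr.
have -> : f (oppr_root a) = - f a.
  rewrite /f srefl_opp cart_opp rmorphN mulrN scaleNr.
  by have -> : parC (oppr_root a) = parC a by rewrite /parC /cpar -srefl_self weyl_long.
by rewrite opprK -addrA mulr_algl; case: ifP => _; rewrite fa addNr addr0.
Qed.

Lemma star_add x y : star (x + y) = star x + star y.
Proof. by have := @hecke_star_semilinear R c H 1 x y; rewrite rmorph1 !scale1r. Qed.

Lemma star0 : star 0 = 0.
Proof. by apply: (addIr (star 0)); rewrite -star_add !add0r. Qed.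

Lemma star_scale z x : star (z *: x) = z^* *: star x.
Proof. by have := @hecke_star_semilinear R c H z x 0; rewrite star0 !addr0. Qed.

Lemma star1 : star 1 = 1.
Proof. by rewrite -(hecke_t1 H) hecke_star_t // invg1. Qed.

Lemma star_sum (I : Type) (s : seq I) (P : pred I) (F : I -> H) :
  star (\sum_(i <- s | P i) F i) = \sum_(i <- s | P i) star (F i).
Proof. exact: (big_morph _ star_add star0). Qed.

Lemma star_omega b : star (omega b) =
  - omega b + \sum_(e | pos e) (parC e * (cart b e)%:~R) *: t (srefl e).
Proof.
have E : map_mx Num.conj (rootv C b) = rootv C b.
  by apply/rowP => j; rewrite !mxE rmorph_int.
rewrite /omega hecke_star_S E; congr (_ + _).
by apply: eq_big => [e|e _]; rewrite ?positiveE // coroot_rootv.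
Qed.

(** The star contributes a sum over all positive roots; the commutation past t_w removes the
    inversions of w. What remains is the index set of [KZ]. *)
Lemma star_omega_t w b : w \in weyl -> star (omega b) * t w =
  - (t w * omega (w b)) +
    \sum_(e | pos e && pos (w e)) (parC e * (cart b e)%:~R) *: t (srefl e * w)%g.
Proof.
move=> Ww; rewrite star_omega mulrDl mulNr omega_t // opprD -addrA; congr (_ + _).
have -> : (\sum_(e | pos e) (parC e * (cart b e)%:~R) *: t (srefl e)) * t w =
    \sum_(e | pos e) (parC e * (cart b e)%:~R) *: t (srefl e * w)%g.
  rewrite mulr_suml; apply: eq_bigr => e _.
  by rewrite -scalerAl -(hecke_tM H (srefl_weyl e) Ww).
by rewrite [X in _ + X](bigID (fun e => pos (w e))) [X in _ + X]addrC addKr.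
Qed.

(** * The functional on H attached to a solution of the linear system *)

Definition hcoef (h : H) : {perm f4root} -> S := projT1 (cid (hecke_span h)).

Lemma hcoefE h : h = \sum_(w in weyl) t w * hS (hcoef h w).
Proof. exact: (projT2 (cid (hecke_span h))). Qed.

Lemma hcoef_uniq h (p : {perm f4root} -> S) :
  h = \sum_(w in weyl) t w * hS (p w) -> {in weyl, forall w, hcoef h w = p w}.
Proof.
move=> E w Ww; apply/eqP; rewrite -subr_eq0; apply/eqP.
apply: (hecke_free (g := H) (p := fun w => hcoef h w - p w)) => //.
under eq_bigr => v _ do rewrite rmorphB mulrBr.
by rewrite sumrB -hcoefE -E subrr.
Qed.

Lemma t_sum_delta w p : w \in weyl ->
  t w * hS p = \sum_(v in weyl) t v * hS (if v == w then p else 0).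
Proof.
move=> Ww; rewrite (bigD1 w) //= eqxx big1 ?addr0 // => v /andP[_ /negPf ->].
by rewrite rmorph0 mulr0.
Qed.

Section Functional.
Variable nu : 'rV[R]_4.
Local Notation nuC := (map_mx (fun x => x%:C) nu).
Local Notation ev := (mpoly.meval (fun j => nuC 0 j)).
Local Notation x := (root_weight nu).

Lemma ev_linform b : ev (linform (rootv C b)) = (x b)%:C.
Proof.
rewrite /linform raddf_sum /root_weight /dotv rmorph_sum /=; apply: eq_bigr => i _.
by rewrite mpoly.mevalZ mpoly.mevalXU !mxE rmorphM rmorph_int.
Qed.

(** It sends t_w p to phi(w) p(nu) and plays the role of pairing h (x) 1 with the cyclic vector 1
    (x) 1. *)
Definition Phi (phi : {perm f4root} -> R) (h : H) : C :=
  \sum_(w in weyl) (phi w)%:C * ev (hcoef h w).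

Section PhiTheory.
Variable phi : {perm f4root} -> R.
Local Notation F := (Phi phi).

Lemma PhiE h p : h = \sum_(w in weyl) t w * hS (p w) ->
  F h = \sum_(w in weyl) (phi w)%:C * ev (p w).
Proof. by move=> E; apply: eq_bigr => w Ww; rewrite (hcoef_uniq E). Qed.

Lemma PhiD h k : F (h + k) = F h + F k.
Proof.
rewrite (@PhiE _ (fun w => hcoef h w + hcoef k w)).
  by rewrite /Phi -big_split; apply: eq_bigr => w _; rewrite mpoly.mevalD mulrDr.
rewrite {1}(hcoefE h) {1}(hcoefE k) -big_split; apply: eq_bigr => w _.
by rewrite rmorphD mulrDr.
Qed.

Lemma PhiMr h p : F (h * hS p) = ev p * F h.
Proof.
rewrite (@PhiE _ (fun w => hcoef h w * p)).
  rewrite /Phi mulr_sumr; apply: eq_bigr => w _.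
  by rewrite mpoly.mevalM; ring.
rewrite {1}(hcoefE h) mulr_suml; apply: eq_bigr => w _.
by rewrite -mulrA -rmorphM.
Qed.

Lemma PhiZ z h : F (z *: h) = z * F h.
Proof.
rewrite (@PhiE _ (fun w => z *: hcoef h w)).
  rewrite /Phi mulr_sumr; apply: eq_bigr => w _.
  by rewrite mpoly.mevalZ; ring.
rewrite {1}(hcoefE h) scaler_sumr; apply: eq_bigr => w _.
by rewrite linearZ /= scalerAr.
Qed.

Lemma Phi0 : F 0 = 0.
Proof. by rewrite -(scale0r 0) PhiZ mul0r. Qed.

Lemma Phi_sum (I : Type) (s : seq I) (P : pred I) (G : I -> H) :
  F (\sum_(i <- s | P i) G i) = \sum_(i <- s | P i) F (G i).
Proof. exact: (big_morph _ PhiD Phi0). Qed.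

Lemma PhiT w : w \in weyl -> F (t w) = (phi w)%:C.
Proof.
move=> Ww; have -> : t w = t w * hS 1 by rewrite rmorph1 mulr1.
rewrite (PhiE (t_sum_delta _ Ww)) (bigD1 w) //= eqxx mpoly.meval1 mulr1.
by rewrite big1 ?addr0 // => v /andP[_ /negPf ->]; rewrite mpoly.meval0 mulr0.
Qed.

Lemma PhiB h k : F (h - k) = F h - F k.
Proof. by rewrite -scaleN1r PhiD PhiZ mulN1r. Qed.

Hypothesis K : KZ (by_length 1 c) x (fun b => - x b) phi.
Hypothesis sym : sym_fun phi.

Lemma Phi_omega b h : F (star (omega b) * h) = (x b)%:C * F h.
Proof.
rewrite {1}(hcoefE h) mulr_sumr Phi_sum [in RHS]/Phi mulr_sumr; apply: eq_bigr => w Ww.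
rewrite [star _ * _]mulrA PhiMr star_omega_t // [- _ + _]addrC PhiB PhiMr ev_linform PhiT // Phi_sum.
have E : \sum_(e | pos e && pos (w e)) F ((parC e * (cart b e)%:~R) *: t (srefl e * w)%g)
  = ((x b + x (w b)) * phi w)%:C.
  rewrite -{1}[x (w b)]opprK -K // rmorph_sum; apply: eq_bigr => e _.
  rewrite PhiZ PhiT ?groupM ?srefl_weyl // !rmorphM rmorph_int.
  by rewrite /parC /cpar /by_length; case: ifP.
by rewrite E !rmorphM rmorphD /=; ring.
Qed.

Lemma hSD p q : hS (p + q) = hS p + hS q. Proof. exact: rmorphD. Qed.

Lemma hSZ z p : hS (z *: p) = z *: hS p. Proof. exact: linearZ. Qed.

Definition leftp (p : S) := forall h, F (star (hS p) * h) = (ev p)^* * F h.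

Lemma leftp_X i : leftp (mpoly.mpolyX C (mpoly.mnm1 i)).
Proof.
(* The long root 2 eps_i: half of its linear form is the i-th variable. *)
pose v : 'rV[int]_4 := \row_j (2 * (i == j)%:R).
have Rv : v \in f4_roots.
  by rewrite mem_f4_roots dotv4 !mxE; move: (i); apply: ord4P.
pose b : f4root := SeqSub Rv.
have E : mpoly.mpolyX C (mpoly.mnm1 i) = 2^-1 *: linform (rootv C b).
  rewrite /linform (bigD1 i) //= big1 ?addr0 => [|j Nj].
    by rewrite !mxE eqxx mulr1 scalerA /= -[2%:~R]/(2%:R) mulVf ?scale1r ?pnatr_eq0.
  by rewrite !mxE eq_sym (negPf Nj) mulr0 scale0r.
move=> h; rewrite E linearZ /= star_scale -scalerAl PhiZ Phi_omega mpoly.mevalZ ev_linform.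
by rewrite rmorphM /= mulrA; congr (_ * _ * _); rewrite conj_realC.
Qed.

Lemma leftpP p : leftp p.
Proof.
have L1 : leftp 1 by move=> h; rewrite rmorph1 star1 mul1r mpoly.meval1 rmorph1 mul1r.
have LM p1 p2 : leftp p1 -> leftp p2 -> leftp (p1 * p2).
  by move=> L L' h; rewrite rmorphM hecke_star_anti -mulrA L' L mpoly.mevalM rmorphM mulrA mulrAC mulrC mulrA.
have LXn i k : leftp (mpoly.mpolyX C (mpoly.mnm1 i) ^+ k).
  elim: k => [|k IH]; first by rewrite expr0.
  by rewrite exprS; apply: LM => //; exact: leftp_X.
elim/mpoly.mpolyind: p => [h|z m p _ _ L h].
  by rewrite rmorph0 star0 mul0r Phi0 mpoly.meval0 rmorph0 mul0r.
rewrite hSD hSZ star_add mulrDl PhiD L star_scale -scalerAl PhiZ.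
have LX : leftp (mpoly.mpolyX C m).
  rewrite mpoly.mpolyXE_id; by apply: (big_ind leftp).
by rewrite LX mpoly.mevalD mpoly.mevalZ rmorphD rmorphM /=; ring.
Qed.

Lemma Phi_star h : F (star h) = (F h)^*.
Proof.
rewrite {1}(hcoefE h) star_sum Phi_sum [in RHS]/Phi rmorph_sum; apply: eq_bigr => w Ww.
rewrite hecke_star_anti leftpP hecke_star_t // PhiT ?groupV // sym // rmorphM /=.
by rewrite mulrC; congr (_ * _); rewrite conj_realC.
Qed.

End PhiTheory.
End Functional.
End Hecke.

(** * Unitarity of the principal series *)

Section Unitarity.
Local Open Scope complex_scope.
Local Open Scope ring_scope.
Variable R : realType.
Local Notation C := R[i].
Local Notation S := (mpoly.mpoly 4 C).
Variables (c : R) (H : gradedHecke c).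
Local Notation t := (hecke_t H).
Local Notation hS := (hecke_S H).
Local Notation star := (@hecke_star R c H).
Variable nu : 'rV[R]_4.
Local Notation nuC := (map_mx (fun x => x%:C) nu).
Local Notation ev := (mpoly.meval (fun j => nuC 0 j)).
Local Notation x := (root_weight nu).
Local Notation X := (@principal_series R c H nuC).
Local Notation pi := (\pi_X%qT : H^o -> X).

Lemma piE (h k : H) : pi h = pi k -> (h - k : H^o) \in @balancing R c H nuC.
Proof. by move/eqP; rewrite -Quotient.idealrBE. Qed.

Lemma ps_pi0 : pi (0 : H) = 0.
Proof.
by apply: (addIr (pi (0 : H))); rewrite -(@ps_piD R c H nuC) addr0 add0r.
Qed.

Lemma Phi_balancing phi (h k : H) :
  (h : H^o) \in @balancing R c H nuC -> Phi nu phi (k * h) = 0.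
Proof.
case/asboolP => n [g [p ->]]; rewrite mulr_sumr Phi_sum big1 // => i _.
by rewrite mulrBr mulrA PhiB PhiMr -scalerAr PhiZ subrr.
Qed.

Lemma pi_coef (h : H) :
  pi h = pi (\sum_(w in weyl) ev (hcoef h w) *: t w).
Proof.
apply/eqP; rewrite -Quotient.idealrBE; apply/asboolP.
exists #|weyl|, (fun i => t (enum_val i)), (fun i => hcoef h (enum_val i)).
by rewrite {1}(hcoefE h) -sumrB [LHS]big_enum_val.
Qed.

Lemma quad_pair (phi : {perm f4root} -> R) (a b : {perm f4root} -> R) :
  \sum_(y in weyl) \sum_(w in weyl) a y * b w * phi (y^-1 * w)%g =
  dotW a (convolution phi b).
Proof.
rewrite /dotW; apply: eq_bigr => y Wy; rewrite /convolution mulr_sumr.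
rewrite (reindex_inj (mulgI y)); apply: eq_big => [z|z _].
  by rewrite groupMl.
by rewrite mulgA mulVg mul1g; ring.
Qed.

(** The form is <h, k> = Phi(k^* h). It kills the balancing relations on the right argument of Phi
    directly, and on the left one through Hermitian symmetry. *)
Lemma unitary_of_pd (phi : {perm f4root} -> R) :
  KZ (by_length 1 c) x (fun b => - x b) phi -> sym_fun phi -> pd phi ->
  unitary_module X.
Proof.
move=> K sym P; pose F := @Phi R c H nu phi.
have FB u h k : (h - k : H^o) \in @balancing R c H nuC -> F (u * h) = F (u * k).
  by move=> B; apply/eqP; rewrite -subr_eq0 -PhiB -mulrBr Phi_balancing.
have Fstar u : F (star u) = (F u)^* by exact: Phi_star.
pose f (u v : X) : C := F (star (repr v : H^o) * (repr u : H^o)).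
have fE (h k : H) : f (pi h) (pi k) = F (star k * h).
  have R1 (g : H) : (repr (pi g) - g : H^o) \in @balancing R c H nuC.
    by apply: piE; rewrite reprK.
  rewrite /f (FB _ _ _ (R1 h)) -[LHS]conjCK -Fstar hecke_star_anti hecke_starK.
  by rewrite (FB _ _ _ (R1 k)) -Fstar hecke_star_anti hecke_starK.
exists f; split.
- move=> z u v w; have [h ->] := ps_piP u; have [k ->] := ps_piP v.
  have [g ->] := ps_piP w; rewrite -[(_ : H) *: _]/(ps_scale _ _) ps_scale_pi -ps_piD !fE.
  rewrite mulrDr [F _]PhiD; congr (_ + _).
  rewrite -[(_ : H) *: _]/(z%:A * h) mulr_algl -scalerAr; exact: PhiZ.
- move=> u v; have [h ->] := ps_piP u; have [k ->] := ps_piP v.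
  by rewrite !fE -Fstar hecke_star_anti hecke_starK.
- move=> u; have [h ->] := ps_piP u; rewrite pi_coef.
  pose a w := ev (hcoef h w).
  rewrite -[\sum_(w in weyl) _]/(\sum_(w in weyl) a w *: t w) => u0.
  have aN : exists2 w, w \in weyl & a w != 0.
    apply: contrapT => N; case/negP: u0; apply/eqP.
    rewrite big1 ?ps_pi0 // => w Ww.
    have [->|/eqP aw] := pselect (a w = 0); first by rewrite scale0r.
    by case: N; exists w.
  rewrite fE star_sum mulr_suml [F _]Phi_sum.
  have E : \sum_(y in weyl) F (star (a y *: t y) * (\sum_(w in weyl) a w *: t w))
     = \sum_(y in weyl) \sum_(w in weyl) (a y)^* * a w * (phi (y^-1 * w)%g)%:C.
    apply: eq_bigr => y Wy; rewrite mulr_sumr [F _]Phi_sum; apply: eq_bigr => w Ww.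
    rewrite star_scale -scalerAl -scalerAr hecke_star_t // -hecke_tM ?groupV //.
    by rewrite scalerA PhiZ PhiT // groupMl // groupV.
  rewrite E ltcE /=.
  (* As phi is real and symmetric, the value is the sum of the real forms on both parts and the
     cross terms cancel. *)
  pose ar w := complex.Re (a w); pose ai w := complex.Im (a w).
  have Ere : complex.Re (\sum_(y in weyl) \sum_(w in weyl) (a y)^* * a w * (phi (y^-1 * w)%g)%:C)
     = quad phi ar + quad phi ai.
    rewrite raddf_sum /quad -!quad_pair -big_split; apply: eq_bigr => y _.
    rewrite raddf_sum -big_split; apply: eq_bigr => w _.
    by rewrite /ar /ai; case: (a y) (a w) => [p q] [p' q'] /=; ring.
  have Eim : complex.Im (\sum_(y in weyl) \sum_(w in weyl) (a y)^* * a w * (phi (y^-1 * w)%g)%:C)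
     = dotW ar (convolution phi ai) - dotW ai (convolution phi ar).
    rewrite raddf_sum /quad -!quad_pair -sumrB; apply: eq_bigr => y _.
    rewrite raddf_sum -sumrB; apply: eq_bigr => w _.
    by rewrite /ar /ai; case: (a y) (a w) => [p q] [p' q'] /=; ring.
  rewrite Ere Eim conv_adj // (dotWC (convolution phi ar)) subrr eqxx /=.
  have ge0 b : 0 <= quad phi b.
    have [[w Ww bw]|N] := pselect (exists2 w, w \in weyl & b w != 0).
      by apply: ltW; apply: P; exists w.
    rewrite /quad /dotW big1 // => w Ww.
    have [->|/eqP bw] := pselect (b w = 0); first by rewrite mul0r.
    by case: N; exists w.
  case: aN => w Ww aw; have [r0|r0] := eqVneq (ar w) 0.
    rewrite ltr_wpDl //; apply: P; exists w => //.
    apply: contra aw => /eqP i0; rewrite eq_complex /=.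
    by rewrite -/(ar w) -/(ai w) r0 i0 eqxx.
  by rewrite ltr_wpDr //; apply: P; exists w.
- move=> u v w; have [h ->] := ps_piP v; have [k ->] := ps_piP w.
  rewrite -[_ *: _]/(ps_scale _ _) -[star _ *: _]/(ps_scale _ _) !ps_scale_pi !fE.
  by rewrite -[u *: _]/(u * h) -[star u *: _]/(star u * k) hecke_star_anti hecke_starK mulrA.
Qed.

(** The function w -> <t_w, 1> might be complex. The system has real coefficients, so its real part
    is again a solution, and real test vectors see only this part. *)
Lemma pd_of_unitary : unitary_module X ->
  exists2 phi : {perm f4root} -> R,
    KZ (by_length 1 c) x (fun b => - x b) phi & pd phi.
Proof.
case=> f [flin fherm fpos fstar].
have [pi1 pi1E] : exists v : X, v = pi (1 : H) by eexists.
pose phiC w := f (pi (t w)) pi1.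
have fD u v w : f (u + v) w = f u w + f v w.
  have := flin 1 u v w; rewrite !scale1r mul1r; exact.
have f0 w : f 0 w = 0 by apply: (addIr (f 0 w)); rewrite -fD !add0r.
have pim (h k : H) : pi (h * k) = h *: pi k.
  by rewrite -[RHS]/(ps_scale _ _) ps_scale_pi.
have fS (z : C) (h : H) w : f (pi (z *: h)) w = z * f (pi h) w.
  have := flin z (pi h) 0 w; rewrite !addr0 f0 addr0 => <-.
  by rewrite -pim mulr_algl.
have fDp (h k : H) w : f (pi (h + k)) w = f (pi h) w + f (pi k) w by rewrite ps_piD fD.
have fp0 w : f (pi (0 : H)) w = 0 by rewrite ps_pi0 f0.
have fsum (I : Type) (s : seq I) (P : pred I) (G : I -> H) w :
    f (pi (\sum_(i <- s | P i) G i)) w = \sum_(i <- s | P i) f (pi (G i)) w.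
  by apply: (big_morph (fun h : H => f (pi h) w)) => // h k; exact: fDp.
have piS (h : H) p : pi (h * hS p) = pi (ev p *: h).
  apply/eqP; rewrite -Quotient.idealrBE; apply/asboolP.
  by exists 1, (fun=> h), (fun=> p); rewrite big_ord1.
pose phi w := complex.Re (phiC w).
have ReD (p q : C) : complex.Re (p + q) = complex.Re p + complex.Re q.
  by case: p q => [? ?] [? ?].
have Re_sum (I : Type) (s : seq I) (P : pred I) (G : I -> C) :
    complex.Re (\sum_(i <- s | P i) G i) = \sum_(i <- s | P i) complex.Re (G i).
  exact: (big_morph (@complex.Re R) ReD).
exists phi.
  move=> b w Ww; rewrite opprK.
  have E : f (pi (star (omega H b) * t w)) pi1 = (x b)%:C * phiC w.
    rewrite pim fstar hecke_starK pi1E -pim mulr1 -[omega H b]mul1r piS ev_linform.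
    by rewrite fherm fS rmorphM /= -fherm -pi1E; congr (_ * _); rewrite conj_realC.
  move: E; rewrite star_omega_t // fDp fsum -scaleN1r fS piS ev_linform fS -/(phiC w).
  move=> /(congr1 (@complex.Re R)); rewrite ReD Re_sum.
  have -> : complex.Re ((x b)%:C * phiC w) = x b * phi w.
    by rewrite /phi; case: (phiC w) => p q /=; ring.
  have -> : complex.Re (-1 * ((x (w b))%:C * phiC w)) = - x (w b) * phi w.
    by rewrite /phi; case: (phiC w) => p q /=; ring.
  move=> E; rewrite mulrDl -E mulNr addrAC addNr add0r.
  apply: eq_bigr => e _; rewrite fS -/(phiC _) /phi /parC /cpar.
  rewrite -(rmorph_int (real_complex R)) -rmorphM.
  by case: (phiC _) => p q; rewrite /by_length; case: ifP => _ /=; ring.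
move=> a aN.
pose u := pi (\sum_(w in weyl) (a w)%:C *: t w).
have u0 : u != 0.
  apply/eqP => u0; case: aN => v Wv; case/eqP.
  (* The functional of the indicator of v reads off the coefficient of t_v, so the t_w stay
     independent in the quotient. *)
  have : Phi nu (fun w => (w == v)%:R) (1 * \sum_(w in weyl) (a w)%:C *: t w) = 0.
    by apply: Phi_balancing; rewrite -[X in X \in _]subr0; apply: piE; rewrite ps_pi0.
  rewrite mul1r Phi_sum (bigD1 v) //= PhiZ PhiT // eqxx mulr1 big1 ?addr0.
    by move=> [].
  by move=> w /andP[Ww /negPf N]; rewrite PhiZ PhiT // N mulr0.
have := fpos u u0; rewrite ltcE => /andP[_] /=.
suff -> : complex.Re (f u u) = quad phi a by [].
rewrite /u fsum raddf_sum /= /quad -quad_pair exchange_big; apply: eq_bigr => w Ww.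
rewrite fS fherm fsum rmorph_sum /= mulr_sumr raddf_sum; apply: eq_bigr => y Wy.
rewrite fS rmorphM /= -fherm.
have -> : f (pi (t w)) (pi (t y)) = phiC (y^-1 * w)%g.
  rewrite /phiC hecke_tM ?groupV // pim fstar hecke_star_t ?groupV // invgK pi1E.
  by rewrite -pim mulr1.
rewrite /phi; case: (phiC _) => p q /=; ring.
Qed.

End Unitarity.

(** * Sign cells *)

Section Regions.
Variables (R : realType) (c : R).
Implicit Types nu mu : 'rV[R]_4.
Local Notation x := root_weight.

Lemma root_weightD nu mu b s : x (nu + s *: mu) b = x nu b + s * x mu b.
Proof. by rewrite /root_weight !dotv4 !mxE; ring. Qed.

Lemma chamber_pos nu b : chamber nu -> pos b -> 0 <= x nu b.
Proof.
rewrite -positiveE => Cnu /asboolP[n E].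
have -> : x nu b = \sum_i x nu (simple i) *+ n i.
  rewrite /root_weight /rootv E raddf_sum.
  pose g (v : 'rV[R]_4) := dotv v nu.
  have gD : {morph g : u v / u + v >-> u + v}.
    by move=> u v; rewrite /g !dotv4 !mxE; ring.
  have g0 : g 0 = 0 by rewrite /g !dotv4 !mxE !mul0r !addr0.
  rewrite -/(g _) (big_morph g gD g0); apply: eq_bigr => i _.
  rewrite raddfMn -/(g _).
  by elim: (n i) => [|k IH]; rewrite ?mulr0n // !mulrS gD IH.
by apply: sumr_ge0 => i _; apply: mulrn_wge0; exact: Cnu.
Qed.

Lemma mix_gt0 (s a b : R) : 0 <= s -> s <= 1 -> 0 < a -> 0 < b ->
  0 < (1 - s) * a + s * b.
Proof.
move=> s0 s1 a0 b0; have [->|sn] := eqVneq s 0; first by rewrite mul0r subr0 mul1r addr0.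
apply: ltr_wpDl; first by rewrite mulr_ge0 ?subr_ge0 // ltW.
by rewrite mulr_gt0 // lt_neqAle eq_sym sn.
Qed.

Definition cell (nu0 : 'rV[R]_4) : set 'rV[R]_4 := chamber `&`
  [set nu | forall a, x nu a != cpar c a /\ (x nu a < cpar c a) = (x nu0 a < cpar c a)].

Lemma continuous_root_weight b : continuous (fun nu : 'rV[R]_4 => x nu b).
Proof.
have -> : (fun nu : 'rV[R]_4 => x nu b) = (fun nu =>
    rootv R b 0 0 * nu 0 0 + rootv R b 0 1 * nu 0 1 + rootv R b 0 2 * nu 0 2
    + rootv R b 0 3 * nu 0 3).
  by apply/funext => nu; rewrite /root_weight dotv4.
have L j : continuous (fun nu : 'rV[R]_4 => rootv R b 0 j * nu 0 j).
  move=> nu; apply: (@continuous_comp _ _ _ (fun nu : 'rV[R]_4 => nu 0 j) ( *%R (rootv R b 0 j))).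
    exact: (@coord_continuous R 1 4 0 j nu).
  exact: mulrl_continuous.
have D (f g : 'rV[R]_4 -> R) : continuous f -> continuous g ->
    continuous (fun nu => f nu + g nu).
  by move=> cf cg nu; exact: (cvgD (cf nu) (cg nu)).
exact: (D _ _ (D _ _ (D _ _ (L 0) (L 1)) (L 2)) (L 3)).
Qed.

(** A connected set avoiding the walls cannot change sides, by the intermediate value property;
    conversely a cell is convex and segments join its points to nu0. *)
Lemma component_cell nu0 : (chamber `\` walls c) nu0 ->
  connected_component (chamber `\` walls c) nu0 = cell nu0.
Proof.
case=> C0 W0; apply/seteqP; split=> [nu [B [B0 BA Bc] Bnu]|nu [Cnu S]].
  split=> [|a]; first by have [] := BA nu Bnu.
  have N mu : B mu -> x mu a != cpar c a.
    by move=> /BA[_ W]; apply/eqP => E; apply: W; exists a.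
  split; first exact: N.
  have := connected_continuous_connected Bc
    (continuous_subspaceT (A := B) (@continuous_root_weight a)).
  move/connected_intervalP => I.
  have out mu mu' : B mu -> B mu' -> x mu a < cpar c a -> x mu' a < cpar c a.
    move=> Bm Bm' lt; rewrite ltNge; apply/negP => le.
    have [v Bv E] : [set x nu a | nu in B] (cpar c a).
      by apply: (I (x mu a) (x mu' a)); [exists mu|exists mu'|rewrite (ltW lt) le].
    by have := N v Bv; rewrite E eqxx.
  by apply/idP/idP; exact: out.
pose g (s : R) : 'rV[R]_4 := nu0 + s *: (nu - nu0).
have cg : continuous g.
  move=> s; apply: cvgD; first exact: cvg_cst.
  exact: scalel_continuous.
exists (g @` `[0, 1]); last first.
  by exists 1; rewrite /= ?in_itv /= ?ler01 ?lexx // /g scale1r addrC subrK.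
split.
- by exists 0; rewrite /= ?in_itv /= ?ler01 ?lexx // /g scale0r addr0.
- move=> mu [s]; rewrite /= in_itv /= => /andP[s0 s1] <-.
  have xg b : x (g s) b = (1 - s) * x nu0 b + s * x nu b.
    by rewrite /g /root_weight !dotv4 !mxE; ring.
  split.
    move=> i; have := xg (simple i); rewrite /root_weight => ->.
    have A := C0 i; have B := Cnu i.
    by rewrite addr_ge0 // mulr_ge0 // subr_ge0.
  case=> b; rewrite -[dotv _ _]/(x (g s) b) xg => E.
  have [N1 N2] := S b.
  have N0 : x nu0 b != cpar c b.
    by apply/eqP => E0; apply: W0; exists b.
  move: N2 N1 N0 E; move: (x nu0 b) (x nu b) (cpar c b) => u v k.
  have [v1|v1|_] := ltgtP v k; last by move=> _.
    move=> /esym u1 _ _ E; have := @mix_gt0 s (k - u) (k - v) s0 s1.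
    by rewrite !subr_gt0 => /(_ u1 v1) ?; lra.
  have [u1|u1|_] := ltgtP u k => //.
  move=> _ _ _ E; have := @mix_gt0 s (u - k) (v - k) s0 s1.
  by rewrite !subr_gt0 => /(_ u1 v1) ?; lra.
- apply: connected_continuous_connected; first exact: segment_connected.
  exact: continuous_subspaceT.
Qed.

Definition delta_vec : 'rV[R]_4 := \row_j nth 0 [:: 729; 81; 9; 1] j.

Lemma root_weight_delta b : x delta_vec b = (height b)%:~R.
Proof.
Transparent height.
rewrite /root_weight /height /coords /row_coords dotv4 !mxE /=.
by rewrite !rmorphD !rmorphM /=; ring.
Opaque height.
Qed.

Lemma small_perturbation (T : finType) (u v : T -> R) :
  exists2 e0, 0 < e0 & forall e, 0 <= e <= e0 -> forall t, u t != 0 ->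
    0 < u t * (u t + e * v t).
Proof.
have [K K0 B] : exists2 K, 0 < K & forall t, u t != 0 -> `|v t| <= K * `|u t|.
  apply: (finite_bound (P := fun t (K : R) => u t != 0 -> `|v t| <= K * `|u t|)).
    by move=> t K K' KK' H ut; apply: le_trans (H ut) _; apply: ler_wpM2r.
  move=> t; exists (`|v t| / `|u t|) => ut.
  by rewrite divfK // normr_eq0.
exists (2 * K)^-1; first by rewrite invr_gt0 mulr_gt0.
move=> e /andP[e0 eK] t ut; have ev : `|e * v t| <= `|u t| / 2.
  rewrite normrM ger0_norm //; apply: (le_trans (y := (2 * K)^-1 * (K * `|u t|))).
    by apply: ler_pM => //; exact: B.
  rewrite le_eqVlt; apply/orP; left; apply/eqP; field.
  by rewrite gt_eqF.
have u2 : 0 < u t * u t by rewrite -expr2 exprn_even_gt0.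
move: ev; rewrite mulrDr; have [u0|u0|/eqP u0] := ltgtP (u t) 0; last by rewrite u0 in ut.
  by rewrite (ltr0_norm u0) ler_norml => /andP[A B']; nra.
by rewrite (gtr0_norm u0) ler_norml => /andP[A B']; nra.
Qed.

Lemma cell_eq nu0 nu : cell nu0 nu -> cell nu = cell nu0.
Proof.
move=> [Cnu S]; apply/seteqP; split=> mu [Cm Sm]; split=> // a.
  by have [A B] := Sm a; have [_ B'] := S a; rewrite -B'.
by have [A B] := Sm a; have [_ B'] := S a; rewrite B'.
Qed.

(** A small push along [delta_vec] crosses no wall. Roots equal on nu0 are separated by their
    heights, and the others keep their distinct values. *)
Lemma regular_in_cell nu0 : (chamber `\` walls c) nu0 ->
  exists2 nu, cell nu0 nu & injective (x nu).
Proof.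
case=> C0 W0.
have [e1 e10 H1] := small_perturbation (fun a => x nu0 a - cpar c a)
  (fun a => (height a)%:~R).
have [e2 e20 H2] := small_perturbation (fun ab : f4root * f4root => x nu0 ab.1 - x nu0 ab.2)
  (fun ab => (height ab.1)%:~R - (height ab.2)%:~R).
pose e := Num.min e1 e2.
have e0 : 0 < e by rewrite lt_min e10 e20.
have le1 : 0 <= e <= e1 by rewrite ltW // ge_min lexx.
have le2 : 0 <= e <= e2 by rewrite ltW // ge_min lexx orbT.
exists (nu0 + e *: delta_vec).
  split.
    move=> i; rewrite -[dotv _ _]/(x _ (simple i)) root_weightD root_weight_delta.
    rewrite addr_ge0 //; first exact: C0.
    by apply: mulr_ge0; [exact: ltW|rewrite ler0z; apply: ltW; exact: pos_simple].
  move=> a; rewrite root_weightD root_weight_delta.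
  have N0 : x nu0 a - cpar c a != 0.
    by rewrite subr_eq0; apply/eqP => E0; apply: W0; exists a.
  have := H1 e le1 a N0; move: N0; set h := (height a)%:~R; rewrite subr_eq0.
  move: (x nu0 a) (cpar c a) => u k N P.
  have {}P : 0 < (u - k) * (u + e * h - k) by rewrite addrAC.
  split; first by apply: contraTneq P => ->; rewrite subrr mulr0 ltxx.
  have [lt|gt|E] := ltgtP u k; last by rewrite E eqxx in N.
    by move: P; rewrite nmulr_rgt0 ?subr_lt0.
  by move: P; rewrite pmulr_rgt0 ?subr_gt0 // => /ltW; rewrite leNgt => /negPf.
move=> a b; rewrite !root_weightD !root_weight_delta => E.
have [E0|/eqP N0] := pselect (x nu0 a = x nu0 b).
  move: E; rewrite E0 => /addrI /(mulfI (lt0r_neq0 e0)) /eqP; rewrite eqr_int => /eqP.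
  exact: height_inj.
rewrite -subr_eq0 in N0; have := H2 e le2 (a, b) N0; rewrite /=.
have -> : x nu0 a - x nu0 b + e * ((height a)%:~R - (height b)%:~R) =
    (x nu0 a + e * (height a)%:~R) - (x nu0 b + e * (height b)%:~R).
  by rewrite mulrBr opprD addrACA.
by rewrite E subrr mulr0 ltxx.
Qed.

End Regions.

(** * The long hyperplanes in the dominant chamber *)

(** This order fixes the columns of the sign tables [signs] and [sample_signs]. *)
Definition long_positive : seq zvec :=
  [:: (1, -1, -1, -1); (1, -1, -1, 1); (0, 0, 0, 2); (1, -1, 1, 1); (1, -1, 1, -1);
      (2, 0, 0, 0); (1, 1, -1, 1); (1, 1, 1, 1); (0, 0, 2, 0); (1, 1, 1, -1);
      (1, 1, -1, -1); (0, 2, 0, 0)].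

(* A point (n, d), standing for n / d, of each sign cell of the long hyperplanes
   in the dominant chamber. *)
Definition samples : seq (zvec * int) :=
  [:: ((0, 0, 0, 0), 7);
   ((4, 0, 0, 0), 7);
   ((5, 1, 1, 1), 7);
   ((4, 2, 2, 0), 7);
   ((6, 2, 1, 1), 7);
   ((6, 2, 0, 0), 7);
   ((7, 1, 1, 1), 7);
   ((4, 4, 0, 0), 7);
   ((8, 2, 1, 1), 7);
   ((8, 4, 3, 1), 7);
   ((8, 1, 1, 0), 7);
   ((10, 4, 2, 0), 7);
   ((9, 1, 1, 1), 7);
   ((12, 4, 1, 1), 7);
   ((8, 4, 4, 0), 7);
   ((8, 0, 0, 0), 7);
   ((15, 4, 4, 1), 7);
   ((12, 4, 0, 0), 7);
   ((16, 4, 4, 0), 7);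
   ((12, 4, 4, 4), 7);
   ((20, 4, 4, 4), 7)].

(* (z, true) and (z, false) encode the inequalities <z, nu> < 1 and <z, nu> > 1
   defining the seven regions. *)
Definition conditions : seq (seq (zvec * bool)) :=
  [:: [:: ((2, 0, 0, 0), true)];
   [:: ((1, 1, 1, 1), false); ((1, 1, 1, -1), true)];
   [:: ((1, 1, -1, 1), false); ((1, -1, 1, 1), true); ((1, 1, -1, -1), true)];
   [:: ((1, -1, 1, 1), true); ((0, 2, 0, 0), false)];
   [:: ((0, 2, 0, 0), false); ((1, -1, 1, -1), false); ((0, 0, 2, 0), true); ((1, -1, -1, 1), true)];
   [:: ((0, 2, 0, 0), false); ((1, -1, -1, -1), false); ((0, 0, 2, 0), true)];
   [:: ((1, -1, -1, -1), false); ((0, 0, 0, 2), false)]].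

(** One sample for each entry of [conditions], in the same order, so that both are accessed by one
    index. *)
Definition representatives : seq (zvec * int) :=
  [:: ((0, 0, 0, 0), 7); ((5, 1, 1, 1), 7); ((6, 2, 1, 1), 7); ((4, 4, 0, 0), 7); ((10, 4, 2, 0), 7); ((12, 4, 0, 0), 7); ((20, 4, 4, 4), 7)].

Definition zsat (e : zvec * int) (l : seq (zvec * bool)) : bool :=
  all (fun zb => (zdot zb.1 e.1 < e.2) == zb.2) l.

Definition coeffs (e : zvec * int) : six BinNums.Z :=
  run6 e.1 e.2 coxeter_betas (1, 0, 0, 0, 0, 0).

Arguments coeffs : simpl never.

Lemma samples_dichotomy :
  all (fun e => if has (zsat e) conditions then good6 (coeffs e) else bad6 (coeffs e))
    samples.
Proof. by vm_compute. Qed.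

Lemma representatives_good : all (fun e => good6 (coeffs e)) representatives.
Proof. by vm_compute. Qed.

Definition sample_ok (e : zvec * int) : bool :=
  (0 < e.2) && all (fun z => (0 <= zdot z e.1) && (zdot z e.1 != e.2)) long_positive.

Lemma samples_ok : all sample_ok samples.
Proof. by vm_compute. Qed.

Lemma representatives_ok : all sample_ok representatives.
Proof. by vm_compute. Qed.

Definition zsigns (e : zvec * int) : seq bool :=
  [seq zdot z e.1 < e.2 | z <- long_positive].

Definition signs : seq (seq bool) :=
  [:: [:: true; true; true; true; true; true; true; true; true; true; true; true];
   [:: true; true; true; true; true; false; true; false; true; true; true; true];
   [:: true; true; true; true; true; false; false; false; true; false; true; true];
   [:: true; true; true; true; true; false; false; false; true; false; false; false];
   [:: true; true; true; false; false; false; false; false; true; false; false; false];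
   [:: false; false; true; false; false; false; false; false; true; false; false; false];
   [:: false; false; false; false; false; false; false; false; false; false; false; false]].

Definition sample_signs : seq (seq bool) :=
  [:: [:: true; true; true; true; true; true; true; true; true; true; true; true];
   [:: true; true; true; true; true; false; true; true; true; true; true; true];
   [:: true; true; true; true; true; false; true; false; true; true; true; true];
   [:: true; true; true; true; true; false; true; false; true; false; true; true];
   [:: true; true; true; true; true; false; false; false; true; false; true; true];
   [:: true; true; true; true; true; false; false; false; true; false; false; true];
   [:: true; true; true; false; true; false; false; false; true; false; true; true];
   [:: true; true; true; true; true; false; false; false; true; false; false; false];
   [:: true; true; true; false; true; false; false; false; true; false; false; true];
   [:: true; true; true; false; true; false; false; false; true; false; false; false];
   [:: true; true; true; false; false; false; false; false; true; false; false; true];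
   [:: true; true; true; false; false; false; false; false; true; false; false; false];
   [:: true; false; true; false; false; false; false; false; true; false; false; true];
   [:: true; false; true; false; false; false; false; false; true; false; false; false];
   [:: true; true; true; false; false; false; false; false; false; false; false; false];
   [:: false; false; true; false; false; false; false; false; true; false; false; true];
   [:: true; false; true; false; false; false; false; false; false; false; false; false];
   [:: false; false; true; false; false; false; false; false; true; false; false; false];
   [:: false; false; true; false; false; false; false; false; false; false; false; false];
   [:: true; false; false; false; false; false; false; false; false; false; false; false];
   [:: false; false; false; false; false; false; false; false; false; false; false; false]].

Lemma zsigns_samples : map zsigns samples = sample_signs.
Proof. by vm_compute. Qed.

Lemma zsigns_representatives : map zsigns representatives = signs.
Proof. by vm_compute. Qed.

Definition znorm (z : zvec) : int :=
  let: (a, b, c, d) := z in a * a + b * b + c * c + d * d.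

Definition short_roots : seq zvec :=
  [:: (-1, -1, 0, 0); (-1, 0, -1, 0); (-1, 0, 0, -1); (-1, 0, 0, 1); (-1, 0, 1, 0); (-1, 1, 0, 0); (0, -1, -1, 0); (0, -1, 0, -1); (0, -1, 0, 1); (0, -1, 1, 0); (0, 0, -1, -1); (0, 0, -1, 1); (0, 0, 1, -1); (0, 0, 1, 1); (0, 1, -1, 0); (0, 1, 0, -1); (0, 1, 0, 1); (0, 1, 1, 0); (1, -1, 0, 0); (1, 0, -1, 0); (1, 0, 0, -1); (1, 0, 0, 1); (1, 0, 1, 0); (1, 1, 0, 0)].

Lemma coords_norm b : znorm (coords b) = dotv (val b) (val b).
Proof. by rewrite dotv4. Qed.

Lemma long_positiveP b : is_long b -> pos b -> coords b \in long_positive.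
Proof.
rewrite /is_long /pos heightE -coords_norm.
pose P z := (znorm z == 4) ==> (0 < zheight z) ==> (z \in long_positive).
have F : all P root_coords by vm_compute.
by have := coords_all F b; rewrite /P => + L Pz; rewrite L Pz.
Qed.

Lemma short_rootsP b : ~~ is_long b -> coords b \in short_roots.
Proof.
rewrite /is_long -coords_norm.
pose P z := (znorm z == 4) || (z \in short_roots).
have F : all P root_coords by vm_compute.
by have := coords_all F b; rewrite /P => + /negPf L; rewrite L.
Qed.

Lemma exists_root z : z \in root_coords -> exists b, coords b = z.
Proof.
case: z => [[[a b] c] d]; rewrite mem_filter => /andP[N _].
pose v : 'rV[int]_4 := \row_j nth 0 [:: a; b; c; d] j.
have Rv : v \in f4_roots by rewrite mem_f4_roots dotv4 !mxE.
by exists (SeqSub Rv); rewrite /coords /row_coords !mxE.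
Qed.

Section Glue.
Variable R : realType.
Implicit Types nu : 'rV[R]_4.
Local Notation x := root_weight.

Definition zlin (z : zvec) nu : R :=
  let: (a, b, c, d) := z in
  a%:~R * nu 0 0 + b%:~R * nu 0 1 + c%:~R * nu 0 2 + d%:~R * nu 0 3.

Arguments zlin : simpl never.

Lemma root_weightE nu b : x nu b = zlin (coords b) nu.
Proof. by rewrite /root_weight dotv4 !mxE. Qed.

Lemma chamberP nu : chamber nu ->
  [/\ nu 0 1 + nu 0 2 + nu 0 3 <= nu 0 0, nu 0 2 <= nu 0 1, nu 0 3 <= nu 0 2 & 0 <= nu 0 3].
Proof.
move=> Cnu; have L (i : 'I_4) : 0 <= zlin (zsimple i) nu.
  by rewrite -coords_simple -root_weightE; exact: Cnu.
have := L 0; have := L 1; have := L 2; have := L 3; rewrite /zlin /= => *.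
by split; lra.
Qed.

(** eps_1 + eps_2 is the highest short root, so it bounds all short roots on the dominant
    chamber. *)
Lemma short_lt (c : R) nu b : chamber nu -> nu 0 0 + nu 0 1 < c ->
  ~~ is_long b -> x nu b < c.
Proof.
move=> /chamberP[c1 c2 c3 c4] lt /short_rootsP; rewrite root_weightE.
rewrite !inE; do 23?case/orP; move=> /eqP ->; rewrite /zlin; lra.
Qed.

Lemma neg_root_le0 nu b : chamber nu -> ~~ pos b -> x nu b <= 0.
Proof.
move=> Cnu; rewrite -pos_opp => /(chamber_pos Cnu).
by rewrite weight_opp ?oppr_ge0 //; exact: root_weightP.
Qed.

Fixpoint sat_all (l : seq (zvec * bool)) nu : Prop :=
  if l is (z, s) :: l' then
    (if s then zlin z nu < 1 else 1 < zlin z nu) /\ sat_all l' nu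
  else True.

Lemma sat_inP l nu : sat_all l nu <->
  forall z s, (z, s) \in l -> if s then zlin z nu < 1 else 1 < zlin z nu.
Proof.
elim: l => [|[z s] l IH]; first by split.
rewrite /= IH; split=> [[A B] z' s'|A].
  by rewrite inE => /orP[/eqP[-> ->]|]; [|exact: B].
by split=> [|z' s' M]; apply: A; rewrite inE ?eqxx // M orbT.
Qed.

Lemma sat_signs i nu : (i < 7)%N -> chamber nu -> sat_all (nth [::] conditions i) nu ->
  sat_all (zip long_positive (nth [::] signs i)) nu.
Proof.
move=> i7 /chamberP[c1 c2 c3 c4].
by case: i i7 => [|[|[|[|[|[|[|//]]]]]]] _; rewrite /= /zlin => *; repeat split; lra.
Qed.

Lemma cmp1 (v : R) : v != 1 -> (v < 1 /\ (v < 1) = true) \/ (1 < v /\ (v < 1) = false).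
Proof. by have [h|h|] := ltgtP v 1 => // _; [left|right]. Qed.

Lemma sample_cases (a b c d : R) :
  b + c + d <= a -> c <= b -> d <= c -> 0 <= d ->
  2 * a != 1 ->
  a + b + c + d != 1 ->
  a + b + c - d != 1 ->
  a + b - c + d != 1 ->
  a + b - c - d != 1 ->
  a - b + c + d != 1 ->
  a - b + c - d != 1 ->
  a - b - c + d != 1 ->
  a - b - c - d != 1 ->
  2 * b != 1 ->
  2 * c != 1 ->
  2 * d != 1 ->
  [:: a - b - c - d < 1;
     a - b - c + d < 1;
     2 * d < 1;
     a - b + c + d < 1;
     a - b + c - d < 1;
     2 * a < 1;
     a + b - c + d < 1;
     a + b + c + d < 1;
     2 * c < 1;
     a + b + c - d < 1;
     a + b - c - d < 1;
     2 * b < 1] \in sample_signs.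
Proof.
move=> c1 c2 c3 c4.
(* The numbers in h0, ..., h11 are the columns of the list. Empty branches are discarded after each
   split, leaving only sign vectors of nonempty cells. *)
all: move=> /cmp1[[h5 e]|[h5 e]]; rewrite e {e}; try (exfalso; lra).
all: move=> /cmp1[[h7 e]|[h7 e]]; rewrite e {e}; try (exfalso; lra).
all: move=> /cmp1[[h9 e]|[h9 e]]; rewrite e {e}; try (exfalso; lra).
all: move=> /cmp1[[h6 e]|[h6 e]]; rewrite e {e}; try (exfalso; lra).
all: move=> /cmp1[[h10 e]|[h10 e]]; rewrite e {e}; try (exfalso; lra).
all: move=> /cmp1[[h3 e]|[h3 e]]; rewrite e {e}; try (exfalso; lra).
all: move=> /cmp1[[h4 e]|[h4 e]]; rewrite e {e}; try (exfalso; lra).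
all: move=> /cmp1[[h1 e]|[h1 e]]; rewrite e {e}; try (exfalso; lra).
all: move=> /cmp1[[h0 e]|[h0 e]]; rewrite e {e}; try (exfalso; lra).
all: move=> /cmp1[[h11 e]|[h11 e]]; rewrite e {e}; try (exfalso; lra).
all: move=> /cmp1[[h8 e]|[h8 e]]; rewrite e {e}; try (exfalso; lra).
all: move=> /cmp1[[h2 e]|[h2 e]]; rewrite e {e}; try (exfalso; lra).
all: by [].
Qed.

Definition zlinE := (mulr1z, mulrN1z, mulr0z, mul1r, mulN1r, mul0r, add0r, addr0).

Lemma sample_exists nu : chamber nu ->
  {in long_positive, forall z, zlin z nu != 1} ->
  exists2 e, e \in samples & [seq zlin z nu < 1 | z <- long_positive] = zsigns e.
Proof.
move=> /chamberP[c1 c2 c3 c4] N.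
suff : [seq zlin z nu < 1 | z <- long_positive] \in map zsigns samples.
  by case/mapP => e; exists e.
have {N} /allP := N; rewrite zsigns_samples /long_positive [all _ _]/= [map _ _]/=.
rewrite /zlin !zlinE; do 12![case/andP => ?] => _.
exact: sample_cases.
Qed.

End Glue.

(** * Classification *)

Section Conclusion.
Variables (R : realType) (c : R).
Hypothesis c0 : 0 < c.
Arguments coeffs : simpl never.
Implicit Types nu : 'rV[R]_4.
Local Notation x := root_weight.

Lemma pd_scale (r r' : {perm f4root} -> R) k : 0 < k ->
  r' =1 (fun w => k * r w) -> pd r <-> pd r'.
Proof.
move=> k0 /funext ->.
have Q a : quad (fun w => k * r w) a = k * quad r a.
  rewrite !quad_sum mulr_sumr; apply: eq_bigr => z _; exact: esym (mulrA _ _ _).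
by split=> P a /P; rewrite Q pmulr_rgt0.
Qed.

Definition sample_point (e : zvec * int) : 'rV[R]_4 :=
  let: (a, b, c, d) := e.1 in
  \row_j ((nth 0 [:: a; b; c; d] j)%:~R / e.2%:~R).

Lemma zlin_sample e z : zlin z (sample_point e) = (zdot z e.1)%:~R / e.2%:~R.
Proof.
case: e => [[[[a b] c'] d] q]; case: z => [[[a' b'] c''] d'].
by rewrite /sample_point /zlin /zdot !mxE /= !intrD !intrM; ring.
Qed.

Lemma gram_sample e : 0 < e.2 ->
  pd (gram c 0 (x (sample_point e))) <-> pd (comb (six_map (@ringZ R) (coeffs e))).
Proof.
move=> d0; have dR : 0 < e.2%:~R :> R by rewrite ltr0z.
(* Multiplying long factors by the denominator makes them integral; dividing short ones by c makes
   them 1. The total scalar is positive. *)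
pose s i : R := by_length e.2%:~R c^-1 (simple i).
pose l := tfactors 1 c 0 (x (sample_point e)) coxeter_word.
have s0 i : 0 < s i by rewrite /s /by_length; case: ifP => _ //; rewrite invr_gt0.
have P0 : 0 < \prod_(t <- l) s t.1.1 by apply: prodr_gt0 => i _.
apply: (pd_scale P0) => w.
rewrite -[\prod_(t <- l) _]mulr1 /gram -/l -rprod_scale /coeffs -coords_coxeter.
rewrite -rprod_comb.
have -> : comb (six_map (@ringZ R) (1, 0, 0, 0, 0, 0)) = (fun w => 1 * delta1 R w).
  by rewrite -comb_delta; apply/funext => v; rewrite mul1r.
rewrite /l /tfactors {l P0}; move: (betaseq coxeter_word) => bs.
rewrite -map_comp; congr (rprod _ _ _); apply: eq_map => jb; rewrite [RHS]/=.
congr (_, _, _).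
  by rewrite /s /by_length; case: ifP => _; rewrite ?mulr1 // mulVf ?gt_eqF.
rewrite /s /by_length root_weightE zlin_sample; case: ifP => _; last by rewrite mul0r mulr0.
by rewrite mul1r mulrC divfK // gt_eqF.
Qed.

(** Two deformations: t goes from 1 to 0 at nu, then nu moves to the sample inside its long cell.
    Negative roots are at most 0 on the chamber and never meet a wall. *)
Lemma pd_gram_sample nu e : chamber nu -> sample_ok e ->
  {in long_positive, forall z, zlin z nu != 1 /\ (zlin z nu < 1) = (zdot z e.1 < e.2)} ->
  (forall b, ~~ is_long b -> x nu b < c) ->
  pd (gram c 1 (x nu)) <-> pd (comb (six_map (@ringZ R) (coeffs e))).
Proof.
move=> Cnu eok agree Sh; have /andP[d0 /allP ok] := eok.
apply: (iff_trans _ (gram_sample d0)).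
have dR : 0 < e.2%:~R :> R by rewrite ltr0z.
have wx := root_weightP nu; have wy := root_weightP (sample_point e).
have L b : is_long b -> [/\ x nu b != 1, x (sample_point e) b != 1
    & (x nu b < 1) = (x (sample_point e) b < 1)].
  move=> Lb; case: (boolP (pos b)) => Pb.
    have Mb := long_positiveP Lb Pb; have [N S] := agree _ Mb.
    have /andP[_ N'] := ok _ Mb.
    rewrite !root_weightE zlin_sample S N ltr_pdivrMr // mul1r ltr_int; split=> //.
    apply/eqP => E; move/negP: N'; apply; rewrite -(eqr_int R); apply/eqP.
    by rewrite -[RHS]mul1r -[X in _ = X * _]E divfK // gt_eqF.
  have Lo : is_long (oppr_root b) by rewrite -srefl_self weyl_long ?srefl_weyl.
  have Po : pos (oppr_root b) by rewrite pos_opp.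
  have /andP[G _] := ok _ (long_positiveP Lo Po).
  have A : x nu b <= 0 by exact: neg_root_le0.
  have B : x (sample_point e) b <= 0.
    rewrite -oppr_ge0 -weight_opp // root_weightE zlin_sample.
    by apply: divr_ge0; [rewrite ler0z|exact: ltW].
  split; [by rewrite lt_eqF //; lra|by rewrite lt_eqF //; lra|].
  by apply/idP/idP => _; lra.
have i01 : 0 <= (1 : R) <= 1 by rewrite ler01 lexx.
have i00 : 0 <= (0 : R) <= 1 by rewrite ler01 lexx.
have N b : is_long b -> x nu b != 1 by case/L.
split=> P.
  apply: (gram_path_x c0 wx wy L).
  exact: (gram_path_t c0 wx N Sh i01 i00 P).
apply: (gram_path_t c0 wx N Sh i00 i01).
apply: (gram_path_x c0 wy wx _ P) => b /L[? ? ?]; by split.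
Qed.

Lemma tfactors1 y word : tfactors 1 c 1 y word = factors (by_length 1 c) y word.
Proof.
apply: eq_map => jb; congr (_, _, _).
by rewrite /by_length; case: ifP; rewrite mul1r.
Qed.

Lemma unitary_of_gram (H : gradedHecke c) nu : pd (gram c 1 (x nu)) ->
  unitary_module (@principal_series R c H (map_mx (fun a => a%:C%C) nu)).
Proof.
move=> P; apply: unitary_of_pd P.
  rewrite /gram tfactors1; apply: KZ_coxeter; exact: root_weightP.
apply: gram_sym; exact: root_weightP.
Qed.

Lemma opprod_const (l : seq ('I_4 * R * R)) :
  opprod l (fun=> 1) = fun=> \prod_(t <- l) (t.1.2 + t.2).
Proof.
elim: l => [|[[i p] q] l IH]; apply/funext => w; first by rewrite big_nil.
by rewrite /= /opstep IH big_cons /= mulrDl.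
Qed.

Lemma coxeter_betas_pos jb : List.In jb (betaseq coxeter_word) -> pos jb.2.
Proof.
have F : all (fun z => 0 < zheight z.2) coxeter_betas by vm_compute.
rewrite -coords_coxeter all_map in F; move: F.
elim: (betaseq coxeter_word) => //= kb l IH /andP[P A] [<-|]; last exact: IH.
by rewrite /pos heightE.
Qed.

(** Uniqueness gives phi = k r on W; both forms are positive on the constant function, whence k >
    0. *)
Lemma gram_of_unitary (H : gradedHecke c) nu : chamber nu -> injective (x nu) ->
  unitary_module (@principal_series R c H (map_mx (fun a => a%:C%C) nu)) ->
  pd (gram c 1 (x nu)).
Proof.
move=> Cnu inj /pd_of_unitary[phi K P].
have wx := root_weightP nu.
set r := gram c 1 (x nu).
have Kr : KZ (by_length 1 c) (x nu) (fun b => - x nu b) r.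
  by rewrite /r /gram tfactors1; exact: KZ_coxeter.
(* Each factor multiplies constants by a parameter plus the value of a positive root at a dominant
   point. *)
have r1 : 0 < quad r (fun=> 1).
  rewrite /quad /r /gram conv_opprod opprod_const /dotW.
  have p0 : 0 < \prod_(t <- tfactors 1 c 1 (x nu) coxeter_word) (t.1.2 + t.2).
    rewrite tfactors1 /factors big_map.
    elim: (betaseq coxeter_word) coxeter_betas_pos => [|jb l IH] A.
      by rewrite big_nil.
    rewrite big_cons mulr_gt0 //; last by apply: IH => kb In; apply: A; right.
    apply: ltr_pwDl; first by rewrite /by_length; case: ifP.
    by apply: chamber_pos => //; apply: A; left.
  move: (\prod_(t <- _) _) p0 => p p0.
  have -> : \sum_(y in weyl) 1 * p = p *+ #|weyl|.
    by rewrite -sumr_const; apply: eq_bigr => y _; rewrite mul1r.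
  by rewrite pmulrn_lgt0 // cardG_gt0.
clearbody r.
have quad0 a (f : {perm f4root} -> R) : {in weyl, forall w, f w = 0} -> quad f a = 0.
  by move=> f0; rewrite quad_sum big1 // => z Wz; rewrite f0 // mul0r.
have rw0 : r w0 != 0.
  apply/eqP => E; have Z := KZ_uniq wx inj Kr E.
  by move: r1; rewrite (quad0 _ _ Z) ltxx.
pose k := phi w0 / r w0.
have E : {in weyl, forall w, phi w = k * r w}.
  move=> w Ww; apply/eqP; rewrite -subr_eq0; apply/eqP.
  apply: (KZ_uniq (phi := fun w => phi w - k * r w) wx inj) => //; last first.
    by rewrite /k divfK // subrr.
  move=> b v Wv; rewrite mulrBr mulrCA -(K b v Wv) -(Kr b v Wv) mulr_sumr -sumrB.
  by apply: eq_bigr => e _; rewrite mulrBr (mulrCA k).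
have Q a : quad phi a = k * quad r a.
  by rewrite !quad_sum mulr_sumr; apply: eq_bigr => z Wz; rewrite E // mulrA.
have k0 : 0 < k.
  have := P (fun=> 1); rewrite Q pmulr_lgt0 //; apply; exists 1%g => //.
  exact: oner_neq0.
by move=> a /P; rewrite Q pmulr_rgt0.
Qed.

Definition region (l : seq (zvec * bool)) : set 'rV[R]_4 :=
  chamber `&` [set nu : 'rV[R]_4 | nu 0 0 + nu 0 1 < c /\ sat_all l nu].

Lemma zip_signs i z : (i < 7)%N -> z \in long_positive ->
  (z, zdot z (nth (0, 0, 0, 0, 0) representatives i).1
      < (nth (0, 0, 0, 0, 0) representatives i).2)
    \in zip long_positive (nth [::] signs i).
Proof.
move=> i7 Mz; set e := nth _ _ _.
have <- : zsigns e = nth [::] signs i.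
  by rewrite -zsigns_representatives (nth_map (0, 0, 0, 0, 0)).
rewrite /zsigns; elim: long_positive Mz => //= z' l IH.
by rewrite !inE => /orP[/eqP <-|/IH ->]; rewrite ?eqxx ?orbT.
Qed.

Lemma region_signs i nu z : (i < 7)%N -> region (nth [::] conditions i) nu ->
  z \in long_positive -> zlin z nu != 1 /\
  (zlin z nu < 1) = (zdot z (nth (0, 0, 0, 0, 0) representatives i).1
      < (nth (0, 0, 0, 0, 0) representatives i).2).
Proof.
move=> i7 [Cnu [_ S]] Mz; have /sat_inP H := sat_signs i7 Cnu S.
have := H _ _ (zip_signs i7 Mz); case: ifP => _ lt.
  by rewrite lt lt_eqF.
by rewrite gt_eqF // ltNge ltW.
Qed.

(** The listed inequalities determine all twelve long signs, and the bound on eps_1 + eps_2 places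
    every short root below c. *)
Lemma region_cell i nu0 : (i < 7)%N -> region (nth [::] conditions i) nu0 ->
  (chamber `\` walls c) nu0 /\ region (nth [::] conditions i) = cell c nu0.
Proof.
move=> i7 F0; have [C0 [k0' S0]] := F0.
have long nu a : region (nth [::] conditions i) nu -> is_long a ->
    x nu a != 1 /\ (x nu a < 1) = (x nu0 a < 1).
  move=> F La; have [Cnu _] := F; case: (boolP (pos a)) => Pa.
    have Ma := long_positiveP La Pa; rewrite !root_weightE.
    have [A B] := region_signs i7 F Ma; have [_ B'] := region_signs i7 F0 Ma.
    by rewrite B B'.
  have A := neg_root_le0 Cnu Pa; have A0 := neg_root_le0 C0 Pa.
  split; first by rewrite lt_eqF //; lra.
  by apply/idP/idP => _; lra.
have sub nu a : region (nth [::] conditions i) nu ->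
    x nu a != cpar c a /\ (x nu a < cpar c a) = (x nu0 a < cpar c a).
  move=> F; rewrite /cpar; case: ifP => [/(long nu a F) //|/negbT Sa].
  have [Cnu [k _]] := F.
  have A := short_lt Cnu k Sa; have A0 := short_lt C0 k0' Sa.
  by rewrite A A0 lt_eqF.
split.
  split=> // -[a E]; have [N _] := sub nu0 a F0.
  by move: N; rewrite -E eqxx.
apply/seteqP; split=> [nu F|nu [Cnu S]].
  by split; [case: F|move=> a; exact: sub].
split=> //; split.
  (* Conversely the sign at eps_1 + eps_2 is itself part of the cell data. *)
  have [b Eb] := @exists_root (1, 1, 0, 0) isT.
  have Sb : ~~ is_long b by rewrite /is_long -coords_norm Eb.
  have [_] := S b; rewrite /cpar (negPf Sb) !root_weightE Eb /zlin !zlinE.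
  by rewrite k0'.
apply/sat_inP => z s Mz.
have Z : z \in long_positive.
  have : all (all (fun zb => zb.1 \in long_positive)) conditions by vm_compute.
  move/allP => /(_ (nth [::] conditions i)); rewrite mem_nth // => /(_ isT) /allP.
  by move/(_ _ Mz).
have [b Eb] : exists b, coords b = z.
  apply: exists_root; have : all (fun z => z \in root_coords) long_positive by vm_compute.
  by move/allP; apply.
have Lb : is_long b.
  have : all (fun z => znorm z == 4) long_positive by vm_compute.
  by move/allP => /(_ _ Z); rewrite /is_long -coords_norm Eb.
have [N] := S b; rewrite /cpar Lb root_weightE root_weightE Eb in N * => E.
have /sat_inP/(_ z s Mz) := S0; move: E N; case: (s) => E N lt.
  by rewrite E.
by rewrite lt_neqAle eq_sym N leNgt E -leNgt ltW.
Qed.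

Lemma unitary_region_conditions (H : gradedHecke c) F :
  (is_region c F /\ unitary_region H F /\ F `<=` chamber `&` halfspaceK c) <->
  (F !=set0 /\ exists2 i, (i < 7)%N & F = region (nth [::] conditions i)).
Proof.
split=> [[[nu0 A0 EF] [U sub]]|[[nu0 F0] [i i7 EF]]].
  rewrite component_cell // in EF.
  have F0 : F nu0 by rewrite EF; split; [case: A0|move=> a; split=> //; apply/eqP => E; case: A0 => _; apply; exists a].
  split; first by exists nu0.
  (* Proportionality of invariant forms needs a point separating the roots, and every region
     contains one. *)
  have [nu1 C1 inj] := regular_in_cell A0.
  have F1 : F nu1 by rewrite EF.
  have [Cnu K1] := sub _ F1.
  have P := gram_of_unitary Cnu inj (U _ F1).
  have Sh b : ~~ is_long b -> x nu1 b < c by exact: short_lt.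
  have N1 : {in long_positive, forall z, zlin z nu1 != 1}.
    move=> z Mz.
    have [b Eb] : exists b, coords b = z.
      apply: exists_root; have : all (fun z => z \in root_coords) long_positive by vm_compute.
      by move/allP; apply.
    have Lb : is_long b.
      have : all (fun z => znorm z == 4) long_positive by vm_compute.
      by move/allP => /(_ _ Mz); rewrite /is_long -coords_norm Eb.
    by have [_ /(_ b)[+ _]] := C1; rewrite /cpar Lb root_weightE Eb.
  have [e Me Es] := sample_exists Cnu N1.
  have ok := allP samples_ok _ Me.
  have agree z : z \in long_positive -> (zlin z nu1 < 1) = (zdot z e.1 < e.2).
    move=> Mz; move: Es; rewrite /zsigns => /eq_in_map; exact.
  have Pe : pd (comb (six_map (@ringZ R) (coeffs e))).
    apply/(pd_gram_sample Cnu ok _ Sh) => // z Mz; split; [exact: N1|exact: agree].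
  have := allP samples_dichotomy _ Me; case: ifP => [/hasP[l Ml sl] _|_ B]; last first.
    by case: (not_pd_comb (bad6_ringZ R B) Pe).
  have [i i7 El] := nthP [::] Ml; exists i => //.
  have F1' : region (nth [::] conditions i) nu1.
    split=> //; split=> //; apply/sat_inP => z s; rewrite El => Mzs.
    have := allP sl _ Mzs => /= /eqP E.
    have Z : z \in long_positive.
      have : all (all (fun zb => zb.1 \in long_positive)) conditions by vm_compute.
      by move/allP => /(_ _ Ml) /allP /(_ _ Mzs).
    move: E; rewrite -agree //; have := N1 z Z.
    by have [lt|lt|] := ltgtP (zlin z nu1) 1 => // _ <-.
  have [_ ->] := region_cell i7 F1'.
  by rewrite EF (cell_eq C1).
rewrite EF in F0; have [A0 E] := region_cell i7 F0.
split; first by exists nu0 => //; rewrite component_cell // EF.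
split; last by rewrite EF => nu [Cnu [k _]].
move=> nu; rewrite EF => Fnu; have [Cnu [k _]] := Fnu.
apply: unitary_of_gram; set e := nth (0, 0, 0, 0, 0) representatives i.
have Me : e \in representatives by exact: mem_nth.
have ok := allP representatives_ok _ Me.
apply/(pd_gram_sample Cnu ok) => [z Mz|b Sb|]; [exact: region_signs|exact: short_lt|].
by apply: pd_comb; apply: good6_ringZ; exact: (allP representatives_good).
Qed.

Lemma region_cases F :
  (exists2 i, (i < 7)%N & F = region (nth [::] conditions i)) <->
  [\/ F = F1 c, F = F2 c, F = F3 c | [\/ F = F4 c, F = F5 c, F = F6 c | F = F7 c]].
Proof.
have E1 : F1 c = region (nth [::] conditions 0).
  apply/seteqP; split=> nu [Cnu].
    by case=> *; split=> //; split=> //; rewrite /= /zlin !zlinE.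
  move=> [k S]; move: S; rewrite /= /zlin !zlinE => -[? _]; by do !split.
have E2 : F2 c = region (nth [::] conditions 1).
  apply/seteqP; split=> nu [Cnu].
    by case=> *; split=> //; split=> //; rewrite /= /zlin !zlinE.
  move=> [k S]; move: S; rewrite /= /zlin !zlinE => -[? [? _]]; by do !split.
have E3 : F3 c = region (nth [::] conditions 2).
  apply/seteqP; split=> nu [Cnu].
    by case=> *; split=> //; split=> //; rewrite /= /zlin !zlinE.
  move=> [k S]; move: S; rewrite /= /zlin !zlinE => -[? [? [? _]]]; by do !split.
have E4 : F4 c = region (nth [::] conditions 3).
  apply/seteqP; split=> nu [Cnu].
    by case=> *; split=> //; split=> //; rewrite /= /zlin !zlinE.
  move=> [k S]; move: S; rewrite /= /zlin !zlinE => -[? [? _]]; by do !split.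
have E5 : F5 c = region (nth [::] conditions 4).
  apply/seteqP; split=> nu [Cnu].
    by case=> *; split=> //; split=> //; rewrite /= /zlin !zlinE.
  move=> [k S]; move: S; rewrite /= /zlin !zlinE => -[? [? [? [? _]]]]; by do !split.
have E6 : F6 c = region (nth [::] conditions 5).
  apply/seteqP; split=> nu [Cnu].
    by case=> *; split=> //; split=> //; rewrite /= /zlin !zlinE.
  move=> [k S]; move: S; rewrite /= /zlin !zlinE => -[? [? [? _]]]; by do !split.
have E7 : F7 c = region (nth [::] conditions 6).
  apply/seteqP; split=> nu [Cnu].
    by case=> *; split=> //; split=> //; rewrite /= /zlin !zlinE.
  move=> [k S]; move: S; rewrite /= /zlin !zlinE => -[? [? _]]; by do !split.
rewrite E1 E2 E3 E4 E5 E6 E7; split.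
  case=> -[|[|[|[|[|[|[|//]]]]]]] _ ->.
  - by apply: Or41.
  - by apply: Or42.
  - by apply: Or43.
  - by apply: Or44; apply: Or41.
  - by apply: Or44; apply: Or42.
  - by apply: Or44; apply: Or43.
  - by apply: Or44; apply: Or44.
by case=> [->|->|->|[->|->|->|->]];
  [exists 0%N|exists 1%N|exists 2|exists 3|exists 4|exists 5|exists 6].
Qed.

End Conclusion.

Theorem proposition5p5 (R : realType) (c : R) (H : gradedHecke c) :
  1 < c ->
  forall F : set 'rV[R]_4,
    (is_region c F /\ unitary_region H F /\ F `<=` chamber `&` halfspaceK c)
    <->
    (F !=set0 /\
     [\/ F = F1 c, F = F2 c, F = F3 c |
      [\/ F = F4 c, F = F5 c, F = F6 c | F = F7 c]]).
Proof.
move=> c1 F; have c0 : 0 < c by exact: lt_trans c1.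
apply: (iff_trans (unitary_region_conditions c0 H F)).
by split=> -[N E]; split=> //; apply/region_cases.
Qed.
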